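(* Consider the Curie–Weiss model $\widehat P_{n,\beta}$ with $\varrho\in\mathcal{B}$ in GHS and $\int x^2\,d\varrho(x)=1$ (so that $\beta_c=1$), and let $\beta>0$ be such that $G_\varrho(\beta,\cdot)$ has a unique global minimum $\alpha$ (i.e. $0<\beta\le1$), of type $k$ and strength $\mu$. Let $\mathbb{E}$ be the expectation under $\widehat P_{n,\beta}$, and let $X_i'$ be drawn from the conditional distribution of the $i$'th coordinate $X_i$ given $(X_j)_{j\ne i}$. In the case $k=1$ (where $0<\beta<1$), put $W=S_n/\sqrt n$; then there is a constant $C$, depending on $\beta$ but not on $n$ and $h$, such that for any uniformly Lipschitz function $h:\mathbb{R}\to\mathbb{R}$ $$\big|\mathbb{E}(h(W))-\Phi_W(h)\big|\le\|h'\|\,C\,\frac{\max\big(\mathbb{E}|X_1|^3,\mathbb{E}|X_1'|^3\big)}{\sqrt n}.$$ Here $\Phi_W(h):=\int_{\mathbb{R}}h(z)\,\Phi_W(dz)$ with $\Phi_W$ the normal distribution with mean zero and variance $\mathbb{E}(W^2)$. For $k\ge2$, put $W:=\frac{S_n-n\alpha}{n^{1-1/2k}}$; then there are constants $C_1,C_2$, not depending on $n$ and $h$, such that for any uniformly Lipschitz function $h$ $$\big|\mathbb{E}(h(W))-\widehat F_{W,k}(h)\big|\le\|h'\|\Big(C_1\frac1{n^{1/k}}+\frac{C_2\max\big(\mathbb{E}|X_1|^3,\mathbb{E}|X_1'|^3\big)}{n^{1-1/2k}}\Big).$$ Here $\widehat F_{W,k}(h):=\int_{\mathbb{R}}h(z)\,\widehat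 F_{W,k}(dz)$, where $\widehat F_{W,k}$ is the probability distribution on $\mathbb{R}$ with density proportional to $\exp\big(-\frac{x^{2k}}{2k\,\mathbb{E}(W^{2k})}\big)$.
   Context: $\mathcal{B}$ is the class of non-degenerate symmetric Borel probability measures $\varrho$ on $\mathbb{R}$ with $\int\exp(bx^2/2)\,d\varrho(x)<\infty$ for all $b>0$. The modified Curie–Weiss measure $\widehat P_{n,\beta}$ on $\mathbb{R}^n$ is the law of the spins $(X_1,\dots,X_n)$ given by $$d\widehat P_{n,\beta}(x)=\frac1{\widehat Z_{n,\beta}}\exp\Big(\frac\beta n\sum_{1\le i<j\le n}x_ix_j\Big)\,d\varrho^{\otimes n}(x),$$ and $S_n=\sum_{i=1}^nX_i$. $\|\cdot\|$ denotes the supremum norm. Put $\phi_\varrho(s)=\log\int e^{sx}\,d\varrho(x)$ and $G_\varrho(\beta,s)=\frac{\beta s^2}{2}-\phi_\varrho(\beta s)$. A minimum $\alpha$ of $G=G_\varrho(\beta,\cdot)$ has type $k\in\mathbb{N}$, $k\ge1$, and strength $\mu>0$ if $G(s)=G(\alpha)+\frac{\mu(s-\alpha)^{2k}}{(2k)!}+\mathcal{O}((s-\alpha)^{2k+1})$ as $s\to\alpha$. GHS is the set of $\varrho\in\mathcal{B}$ satisfying the Griffiths–Hurst–Sherman inequality $\frac{d^3}{ds^3}\phi_\varrho(s)\le0$ for all $s\ge0$, which in its multi-site formulation reads: $\frac{\partial^3}{\partial h_i\partial h_j\partial h_k}\log Z_{n,\beta,h_1,\dots,h_n}\le0$ for all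 (not necessarily distinct) $i,j,k\in\{1,\dots,n\}$, all $n$, $\beta>0$ and $h_1,\dots,h_n\ge0$, where $Z_{n,\beta,h_1,\dots,h_n}=\int\exp\big(\frac{\beta}{2n}(\sum_ix_i)^2+\beta\sum_ih_ix_i\big)\,d\varrho^{\otimes n}(x)$. For $\varrho\in$ GHS with variance one: $G_\varrho(\beta,\cdot)$ has the origin as unique global minimum for $0<\beta\le1$, of type $1$ if $\beta<1$ and of type $k\ge2$ if $\beta=1$, and it has exactly two global minima for $\beta>1$. *)

(* Defs.v *)
From HB Require Import structures.
From mathcomp Require Import all_boot all_order all_algebra.
From mathcomp Require Import all_classical all_reals all_analysis.
From mathcomp Require Import measurable_realfun.

Set Implicit Arguments.
Unset Strict Implicit.
Unset Printing Implicit Defensive.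

Import Order.TTheory GRing.Theory Num.Theory.
Import numFieldNormedType.Exports.

Local Open Scope classical_set_scope.
Local Open Scope ring_scope.

(* The n-fold product measure, as a probability on n-tuples with the sigma-algebra
   generated by the coordinates. *)
Section power_probability.
Context d (T : measurableType d) (R : realType) (P : probability T R).

Definition cons_tuple n (x : T * n.-tuple T) : n.+1.-tuple T :=
  [tuple of x.1 :: x.2].

Lemma measurable_cons_tuple n : measurable_fun [set: T * n.-tuple T] (@cons_tuple n).
Proof. exact: (measurable_cons measurable_fst measurable_snd). Qed.

HB.instance Definition _ n := isMeasurableFun.Build _ _ _ _ (@cons_tuple n)
  (@measurable_cons_tuple n).

Fixpoint power_probability n : probability (n.-tuple T) R :=
  match n with
  | 0 => \d_([tuple] : 0.-tuple T)
  | m.+1 => distribution (P \x power_probability m)%E (@cons_tuple m)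
  end.

End power_probability.

(* The measure with density exp o u with respect to m; mnormalize turns it into
   the probability with density proportional to exp o u. *)
Section exp_density.
Local Open Scope ereal_scope.
Context d (T : measurableType d) (R : realType).
Variables (m : {measure set T -> \bar R}) (u : {mfun T >-> R}).

Definition exp_density (A : set T) : \bar R := \int[m]_(x in A) (expR (u x))%:E.

Let exp_density0 : exp_density set0 = 0.
Proof. by rewrite /exp_density integral_set0. Qed.

Let exp_density_ge0 A : 0 <= exp_density A.
Proof. by apply: integral_ge0 => x _; rewrite lee_fin expR_ge0. Qed.

Let exp_density_sigma_additive : semi_sigma_additive exp_density.
Proof.
apply: semi_sigma_additive_nng_induced => [|x]; last by rewrite lee_fin expR_ge0.
by apply/measurable_EFinP; apply: measurableT_comp.
Qed.

HB.instance Definition _ := isMeasure.Build _ _ _ exp_density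
  exp_density0 exp_density_ge0 exp_density_sigma_additive.

End exp_density.

Section spin_measure_class.
Context {R : realType}.
Implicit Type rho : probability (measurableTypeR R) R.

Definition nondegenerate rho := forall a : R, rho [set a] <> 1%E.

Definition symmetric rho :=
  forall A : set (measurableTypeR R), measurable A -> rho [set x | A (- (x : R))] = rho A.

Definition classB rho :=
  [/\ nondegenerate rho, symmetric rho &
      forall b : R, 0 < b -> (\int[rho]_x (expR (b * x ^+ 2 / 2))%:E < +oo)%E].

Definition phi rho (s : R) : R := ln (\int[rho]_x expR (s * x)).

(* derive1n 3 is the third derivative; phi rho is smooth for rho in classB. *)
Definition GHS rho := classB rho /\ forall s : R, 0 <= s -> derive1n 3 (phi rho) s <= 0.

Definition G rho (beta s : R) : R := beta * s ^+ 2 / 2 - phi rho (beta * s).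

End spin_measure_class.

Section minima.
Context {R : realType}.

Definition unique_global_min (f : R -> R) (alpha : R) :=
  forall s, s != alpha -> f alpha < f s.

Definition has_type_strength (f : R -> R) (alpha : R) (k : nat) (mu : R) :=
  [/\ (1 <= k)%N, 0 < mu &
      (fun s => f s - (f alpha + mu * (s - alpha) ^+ (2 * k) / ((2 * k)`!)%:R))
        =O_ alpha (fun s => (s - alpha) ^+ (2 * k).+1)].

End minima.

Section curie_weiss.
Context {R : realType}.
Local Notation TR := (measurableTypeR R).

Definition hamiltonian (n : nat) (beta : R) (x : n.-tuple TR) : R :=
  beta / n%:R *
    \sum_(i < n) \sum_(j < n | (i < j)%N) (tnth x i : R) * (tnth x j : R).

Lemma measurable_hamiltonian n beta :
  measurable_fun [set: n.-tuple TR] (@hamiltonian n beta).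
Proof.
apply: measurable_funM => //; apply: measurable_sum => i.
under [X in measurable_fun _ X]boolp.funext => x do rewrite big_mkcond.
apply: measurable_sum => j; case: (i < j)%N => //.
by apply: measurable_funM; exact: measurable_tnth.
Qed.

HB.instance Definition _ n beta := isMeasurableFun.Build _ _ _ _
  (@hamiltonian n beta) (@measurable_hamiltonian n beta).

(* The second argument of mnormalize is a default value for a null or infinite
   normalization constant, which does not occur for rho in classB. *)
Definition curie_weiss (rho : probability TR R) (n : nat) (beta : R)
    : probability (n.-tuple TR) R :=
  mnormalize (exp_density (power_probability rho n) (@hamiltonian n beta))
    (power_probability rho n).

Definition spin_sum n (x : n.-tuple TR) : R := \sum_(i < n) (tnth x i : R).

Definition other_spins n (i : 'I_n) (x : n.-tuple TR) : n.-1.-tuple TR :=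
  [tuple tnth x (lift i j) | j < n.-1].

(* kappa is a regular conditional distribution of the i-th coordinate given the
   other coordinates under P. *)
Definition conditional_distribution n (P : probability (n.-tuple TR) R) (i : 'I_n)
    (kappa : R.-pker (n.-1.-tuple TR) ~> TR) :=
  forall (A : set TR) (B : set (n.-1.-tuple TR)), measurable A -> measurable B ->
    P [set x | A (tnth x i) /\ B (other_spins i x)] =
    (\int[P]_(x in [set x | B (other_spins i x)]) kappa (other_spins i x) A)%E.

Definition third_moment n (P : probability (n.-tuple TR) R) (i : 'I_n) : R :=
  \int[P]_x (`|(tnth x i : R)| ^+ 3).

(* E|X_i'|^3, where X_i' is drawn from kappa (X_j)_{j <> i}. *)
Definition resampled_third_moment n (P : probability (n.-tuple TR) R) (i : 'I_n)
    (kappa : R.-pker (n.-1.-tuple TR) ~> TR) : R :=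
  fine (\int[P]_x \int[kappa (other_spins i x)]_t (`|(t : R)| ^+ 3)%:E)%E.

End curie_weiss.

Section limit_laws.
Context {R : realType}.
Local Notation TR := (measurableTypeR R).

Definition exponent_Fhat (k : nat) (v : R) (x : TR) : R :=
  - ((x : R) ^+ (2 * k) / ((2 * k)%:R * v)).

Lemma measurable_exponent_Fhat k v : measurable_fun [set: TR] (exponent_Fhat k v).
Proof.
by apply: measurableT_comp => //; apply: measurable_funM.
Qed.

HB.instance Definition _ k v := isMeasurableFun.Build _ _ _ _
  (exponent_Fhat k v) (measurable_exponent_Fhat k v).

(* The probability with Lebesgue density proportional to exp (- x^(2k) / (2k v));
   the normalization constant is finite for k >= 1 and v > 0, so that the default
   \d_0 is then not used. *)
Definition Fhat (k : nat) (v : R) : probability TR R :=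
  mnormalize (exp_density lebesgue_measure (exponent_Fhat k v)) (\d_(0 : TR)).

(* The supremum norm of h'; a Lipschitz function is differentiable almost
   everywhere only, whence the restriction to the points of differentiability. *)
Definition derivative_norm (h : R -> R) : R :=
  sup [set `|derive1 h x| | x in [set x : R | derivable h x 1]].

End limit_laws.

(* Main.v *)
Require Import Defs.
From HB Require Import structures.
From mathcomp Require Import all_boot all_order all_algebra.
From mathcomp Require Import all_classical all_reals all_analysis.
From mathcomp Require Import ring lra measurable_realfun.
Set Implicit Arguments.
Unset Strict Implicit.
Unset Printing Implicit Defensive.
Import Order.TTheory GRing.Theory Num.Theory.
Import numFieldNormedType.Exports.
Local Open Scope classical_set_scope.
Local Open Scope ring_scope.

(* Stein's method. The function G is even, so its unique minimum is the origin. Write X for the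
   first spin, S for the sum of all n spins, Y = S - X, eps = n^(-1/2k), a = eps^(2k-1), V = a Y
   and W = a S. Exchangeability gives E[(Y - (n-1) X) g(S)] = 0, and given Y the spin X follows
   rho tilted by exp(beta eps V x). The mean of this tilted law is phi'(beta eps V), where
   s - phi'(beta s) = c s^(2k-1) + O(s^(2k+1)), and a Taylor expansion of g turns exchangeability
   into E[c V^(2k-1) g(V) - g'(V)] = O(eps^2 + a).
   By the GHS inequality s (s - phi'(beta s)) is at least of order min(s^(2k), s^2); for g a power
   this gives moments of V that are bounded uniformly in n. Then g(x) = x shows that
   c E W^(2k) = 1 + O(eps^2 + a), and the solution g of the Stein equation
   g' = x^(2k-1) g / v + h - Fhat(h) with v = E W^(2k) bounds the distance by O(eps^2 + a).
   As eps^2 dominates a for k >= 2, the constant C2 may be 0. For k = 1 both are at most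
   n^(-1/2), and the third moment is at least 3/8, since every tilt of rho has second moment at
   least 1. *)

(** * Lipschitz constants and derivatives *)

(** Conditioning is on Y and not on S: the Hamiltonian has no diagonal terms, so given Y the spin X
    feels exactly the field beta Y / n = beta eps V and has an explicit tilted law. The price is the
    passage between V and W = V + a X, which costs O(a). The other errors are O(eps^2) and not
    O(eps) by symmetry, since phi' is odd and the second moment of the tilted law is even. The type
    and strength describe G alone, and an asymptotic expansion cannot be differentiated; the
    coefficient c is found by integrating a Taylor polynomial of phi' and comparing it with the
    expansion of G. The parameter v = E W^(2k) depends on n, so the solution of the Stein equation
    has to be controlled uniformly for v in a compact interval of positive numbers. As h is merely
    Lipschitz, g' need not be differentiable, and Taylor's formula for g rests on increments of g'.
    Finally, ||h'|| sees h only at its points of differentiability; that it bounds all increments of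
    h is a matter of absolute continuity. *)

Section real_integrable.
Context d (T : measurableType d) (R : realType) (mu : {measure set T -> \bar R}).
Variables (D : set T) (mD : measurable D).
Implicit Types f g : T -> R.

Lemma integrable_scale c f : mu.-integrable D (EFin \o f) ->
  mu.-integrable D (EFin \o (fun x => c * f x)).
Proof. by move=> /(integrableZl mD c); apply: eq_integrable => // x _ /=; rewrite EFinM. Qed.

Lemma integrable_add f g : mu.-integrable D (EFin \o f) ->
  mu.-integrable D (EFin \o g) -> mu.-integrable D (EFin \o (fun x => f x + g x)).
Proof. by move=> /(integrableD mD)/[apply]; apply: eq_integrable => // x _ /=; rewrite EFinD. Qed.

Lemma integrable_sub f g : mu.-integrable D (EFin \o f) ->
  mu.-integrable D (EFin \o g) -> mu.-integrable D (EFin \o (fun x => f x - g x)).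
Proof. by move=> /(integrableB mD)/[apply]; apply: eq_integrable => // x _ /=; rewrite EFinB. Qed.

End real_integrable.

Section lipschitz_sup_derivative.
Context {R : realType}.
Local Notation mu := (@lebesgue_measure R).
Implicit Types (p h : R -> R) (a b x y : R).

Definition slope01 p := forall x y, x <= y -> 0 <= p y - p x <= y - x.

Lemma slope01_nondecreasing p : slope01 p -> nondecreasing p.
Proof. by move=> p01 x y /p01 /andP[]; rewrite subr_ge0. Qed.

Lemma slope01_right_continuous p : slope01 p -> right_continuous p.
Proof.
move=> p01; apply: right_continuousW => x; apply/cvgrPdist_lt => e e0.
near=> y; apply: (@le_lt_trans _ _ `|x - y|); last first.
  by near: y; apply: cvgr_dist_lt.
have [xy|yx] := leP x y.
  rewrite distrC [leRHS]distrC; have /andP[h1 h2] := p01 _ _ xy.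
  by rewrite ger0_norm// ger0_norm ?subr_ge0.
have /andP[h1 h2] := p01 _ _ (ltW yx).
by rewrite ger0_norm// ger0_norm ?subr_ge0// ltW.
Unshelve. all: by end_near. Qed.

(* [p] and [x - p x] are both nondecreasing and their Stieltjes measures add up to Lebesgue
   measure, so that the one of [p] has a density. *)
Lemma slope01_integral p a b : slope01 p -> a < b ->
  exists f : R -> R, mu.-integrable setT (EFin \o f) /\
    forall x, a <= x <= b -> p x - p a = \int[mu]_(t in `]a, x]) f t.
Proof.
move=> p01 ab.
pose q x := x - p x.
have q01 : slope01 q.
  by move=> x y xy; have := p01 _ _ xy; rewrite /q; lra.
pose Cp : cumulative R R := HB.pack p
  (isCumulative.Build _ _ _ p (slope01_nondecreasing p01)
     (slope01_right_continuous p01)).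
pose Cq : cumulative R R := HB.pack q
  (isCumulative.Build _ _ _ q (slope01_nondecreasing q01)
     (slope01_right_continuous q01)).
pose mp : {measure set (measurableTypeR R) -> \bar R} := lebesgue_stieltjes_measure Cp.
pose mq : {measure set (measurableTypeR R) -> \bar R} := lebesgue_stieltjes_measure Cq.
have lsmE (C : cumulative R R) (x y : R) : x <= y ->
    lebesgue_stieltjes_measure C `]x, y]%classic = (C y - C x)%:E.
  move=> xy; rewrite /lebesgue_stieltjes_measure/= /measure_extension/= measurable_mu_extE/=; last first.
    exact: is_ocitv.
  by rewrite wlength_itv_bnd.
(* Agreement on half-open intervals is enough, since these determine Lebesgue measure. *)
have sumE A : measurable A -> mu A = (mp A + mq A)%E.
  move=> mA; rewrite -(measure_addE mp mq).
  apply: (lebesgue_measure_unique (mu := measure_add mp mq)) => // X oX.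
  apply: etrans (esym (measure_addE mp mq X)).
  have [->|[[x y] /= xy ->]] := (ocitvP X).1 oX; first by rewrite !measure0 adde0.
  rewrite /lebesgue_measure/= !lsmE ?ltW//= -EFinD /q; congr EFin; lra.
have mab : measurable (`]a, b]%classic : set (measurableTypeR R)) by exact: measurable_itv.
have fab : (mp `]a, b]%classic < +oo)%E by rewrite /mp/= lsmE ?ltW// ltry.
(* Restriction to []a, b]] makes the measure finite, and hence its density integrable. *)
pose nu : {finite_measure set (measurableTypeR R) -> \bar R} := mfrestr mab fab.
have dom : nu `<< mu.
  apply/null_content_dominatesP => A mA A0; rewrite /nu/= /mfrestr /mrestr.
  apply/eqP; rewrite eq_le measure_ge0 andbT.
  apply: (@le_trans _ _ (mp A)).
    by apply: le_measure; rewrite ?inE//; exact: measurableI.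
  apply: (@le_trans _ _ (mp A + mq A)%E); first by rewrite leeDl.
  by rewrite -(sumE A mA) -[X in (_ <= X)%E]A0.
have [f [f0 ffin fint fE]] := radon_nikodym_sigma_finite dom.
exists (fine \o f); split.
  by apply: eq_integrable fint => // x _ /=; rewrite fineK.
move=> x /andP[ax xb].
rewrite /Rintegral.
under eq_integral do rewrite /= fineK//.
rewrite -fE; last exact: measurable_itv.
rewrite /nu/= /mfrestr /mrestr setIidl; first by rewrite lsmE.
by apply: subset_itvl; rewrite bnd_simp.
Qed.

(** Lebesgue's differentiation theorem for the primitive of [f]. Near an interior point [p] is this
    primitive plus the constant [p a]; the hypothesis says nothing beyond the end points, hence the
    strict inequalities. *)
Lemma slope01_ae_derivable p a b f :
  mu.-integrable setT (EFin \o f) ->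
  (forall x, a <= x <= b -> p x - p a = \int[mu]_(t in `]a, x]) f t) ->
  {ae mu, forall x, a < x < b -> derivable p x 1 /\ derive1 p x = f x}.
Proof.
move=> fint pE.
have floc : locally_integrable [set: R] f.
  have := integrable_locally (@measurableT _ R) fint.
  by rewrite patch_setT.
have fy y : mu.-integrable [set` Interval (BRight a) (BRight y)] (EFin \o f).
  by apply: integrableS fint => //; exact: measurable_itv.
have := FTC1 fy floc.
apply: filterS; first exact: (ae_filter_ringOfSetsType mu).
move=> x H /andP[ax xb].
have [|dF FE] := H; first exact: ax.
set F := (fun x0 => _) in dF FE.
have eqF : \forall y \near x, p y = F y + p a.
  near=> y; rewrite /F -pE ?subrK//; apply/andP; split; near: y.
    exact: lt_le_nbhsr.
  exact: lt_le_nbhsl.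
have eqF' : \near x, p x = (F \+ cst (p a)) x by exact: eqF.
split.
  apply: (near_eq_derivable (f := F \+ cst (p a))) => //.
    by apply: filterS eqF'.
  by apply: derivableD.
rewrite derive1E (near_eq_derive _ eqF') deriveD//.
by rewrite derive_cst addr0 -derive1E.
Unshelve. all: by end_near. Qed.

(** All difference quotients are bounded by [L], so that the set in [derivative_norm] is bounded and
    its [sup] is a genuine supremum rather than a default value. *)
Lemma derivative_norm_ub h L x : (forall x y, `|h x - h y| <= L * `|x - y|) ->
  derivable h x 1 -> `|derive1 h x| <= derivative_norm h.
Proof.
move=> hL dh; apply: ub_le_sup; last by exists x.
exists L => _ [y dy <-].
rewrite derive1E.
have key : (fun t => `|t^-1 *: (h (t *: 1 + y) - h y)|) @ 0^' --> `|'D_1 h y|.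
  have /cvg_ex[l hl] := dy; have -> : 'D_1 h y = l by apply/cvg_lim.
  exact: (cvg_norm hl).
apply: (cvgr_to_le key).
near=> t; have t0 : t != 0 by near: t; exact: nbhs_dnbhs_neq.
rewrite normrZ normfV ler_pdivrMl ?normr_gt0// mulrC.
by rewrite (le_trans (hL _ _))// /GRing.scale/= mulr1 addrK.
Unshelve. all: by end_near. Qed.

Lemma derivative_norm_ge0 h : 0 <= derivative_norm h.
Proof.
rewrite /derivative_norm; set A := (X in sup X).
have [[[y Ay] [M ubM]]|nsup] := pselect (has_sup A); last by rewrite sup_out.
apply: le_trans (ub_le_sup _ Ay); last by exists M.
by case: Ay => x _ <-.
Qed.

(** An increment of [h] is the integral of its derivative, which exists almost everywhere, so the
    points of differentiability suffice to bound it. *)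
Lemma lipschitz_derivative_norm h : lipschitz h ->
  forall x y, `|h x - h y| <= derivative_norm h * `|x - y|.
Proof.
move=> /pinfty_ex_gt0 [L L0 hL'].
have hL x y : `|h x - h y| <= L * `|x - y| by exact: (hL' (x, y)).
suff main a b : a < b -> `|h b - h a| <= derivative_norm h * (b - a).
  move=> x y; have [xy|xy|->] := ltgtP x y.
  - by rewrite distrC (distrC x) [X in _ * X]gtr0_norm ?subr_gt0//; exact: main.
  - by rewrite [X in _ * X]gtr0_norm ?subr_gt0//; exact: main.
  - by rewrite !subrr !normr0 mulr0.
move=> ab.
(* a Lipschitz function is an affine image of a function with slopes in [0, 1] *)
pose p x := (x + h x / L) / 2.
have hp x : h x = L * (2 * p x - x) by rewrite /p; field; rewrite gt_eqF.
have p01 : slope01 p.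
  move=> x y xy; have := hL y x.
  rewrite [X in _ <= _ * X]ger0_norm ?subr_ge0// -ler_pdivrMl// => H.
  have : `|L^-1 * (h y - h x)| <= y - x by rewrite normrM gtr0_norm ?invr_gt0.
  rewrite ler_norml /p ![_ / L]mulrC; lra.
(* The interval is enlarged so that every point of []a, b]] is interior to it. *)
have ab1 : a < b + 1 by rewrite ltr_wpDr.
have [f [fint pE]] := slope01_integral p01 ab1.
have Hd := slope01_ae_derivable fint pE.
have fab : mu.-integrable `]a, b] (EFin \o f) by apply: integrableS fint.
have muab : mu `]a, b]%classic = (b - a)%:E.
  by rewrite lebesgue_measure_itv/= lte_fin ab.
have cab (c : R) : mu.-integrable `]a, b] (EFin \o cst c).
  apply: measurable_bounded_integrable => //.
    by rewrite [X in (X < _)%E]muab ltry.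
  by exists `|c|; split => // M /ltW cM x _ /=.
have fint2 : mu.-integrable `]a, b] (EFin \o (fun t => 2 * f t)).
  exact: integrable_scale.
have fint3 : mu.-integrable `]a, b] (EFin \o (fun t => 2 * f t - 1)).
  exact: integrable_sub fint2 (cab 1).
have fint4 : mu.-integrable `]a, b] (EFin \o (fun t => L * (2 * f t - 1))).
  exact: integrable_scale.
have -> : h b - h a = \int[mu]_(t in `]a, b]) (L * (2 * f t - 1)).
  rewrite RintegralZl// RintegralB//; last exact: (cab 1).
  rewrite RintegralZl// -pE; last by rewrite ltW//= lerDl.
  rewrite Rintegral_cst//= [X in fine X]muab/= 2!hp; ring.
apply: le_trans (le_normr_Rintegral _ _) _ => //.
rewrite -(mul1r (derivative_norm h * _)).
have -> : 1 * (derivative_norm h * (b - a)) = \int[mu]_(t in `]a, b]) derivative_norm h.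
  by rewrite Rintegral_cst// [X in fine X]muab mul1r.
apply: fine_le.
- by apply: integrable_fin_num => //; exact: integrable_norm fint4.
- by apply: integrable_fin_num => //; exact: cab.
apply: ae_ge0_le_integral => //.
- by have /integrableP[] := integrable_norm fint4.
- by move=> x _; rewrite lee_fin derivative_norm_ge0.
apply: filterS Hd; first exact: (ae_filter_ringOfSetsType mu).
move=> x H; rewrite /= in_itv/= => /andP[ax xb].
have [|dp pf] := H; first by rewrite ax (le_lt_trans xb)// ltrDl.
have hE : h = (L \*: (2 \*: p - id)).
  by apply/funext => y; rewrite hp.
rewrite lee_fin.
have dh : is_derive x 1 h (L * (2 * f x - 1)).
  have dp' : is_derive x 1 p (f x) by split => //; rewrite -derive1E.
  by rewrite hE; apply: is_derive_eq.
have <- : derive1 h x = L * (2 * f x - 1) by rewrite derive1E; exact: derive_val.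
by apply: derivative_norm_ub hL _; exact: ex_derive.
Qed.

End lipschitz_sup_derivative.

(** * The Curie-Weiss law *)

Section exp_density_integral.
Context d (T : measurableType d) (R : realType).
Variables (m : {sigma_finite_measure set T -> \bar R}) (u : {mfun T >-> R}).
Variable P0 : probability T R.
Hypothesis exp_fin : (\int[m]_x (expR (u x))%:E < +oo)%E.
Hypothesis exp_pos : (0 < \int[m]_x (expR (u x))%:E)%E.

Let measurable_exp : measurable_fun setT (fun x => expR (u x)).
Proof. by apply: measurableT_comp. Qed.

(** The change of variables holds for the Radon-Nikodym derivative, which agrees almost everywhere
    with [expR (u x)] because both have the same integral over every measurable set. [nu] is the
    same measure, presented as a finite one. *)
Lemma ge0_integral_exp_density (f : T -> \bar R) : (forall x, 0 <= f x)%E ->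
  measurable_fun setT f ->
  (\int[exp_density m u]_x f x = \int[m]_x (f x * (expR (u x))%:E))%E.
Proof.
move=> f0 mf.
have finu : (exp_density m u setT < +oo)%E by [].
pose nu : {finite_measure set T -> \bar R} := mfrestr measurableT finu.
have nuE A : nu A = exp_density m u A by rewrite /nu/= /mfrestr /mrestr setIT.
rewrite (_ : integral (exp_density m u) _ _ = \int[nu]_x f x)%E; last first.
  by apply: eq_measure_integral => A mA _; exact/esym/nuE.
have dom : nu `<< m.
  apply/null_content_dominatesP => A mA A0; apply: etrans (nuE A) _; rewrite /exp_density.
  by apply: null_set_integral => //; apply/measurable_funTS/measurable_EFinP.
rewrite -[LHS](Radon_Nikodym_SigmaFinite.change_of_variables dom f0 measurableT mf).
have gint := Radon_Nikodym_SigmaFinite.f_integrable dom.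
have gae : ae_eq m setT (Radon_Nikodym_SigmaFinite.f nu m) (fun x => (expR (u x))%:E).
  apply: integral_ae_eq => //.
    exact/measurable_EFinP.
  by move=> E _ mE; rewrite -Radon_Nikodym_SigmaFinite.f_integral.
apply: ge0_ae_eq_integral => //.
- by apply: emeasurable_funM => //; exact: (measurable_int _ gint).
- by apply: emeasurable_funM => //; exact/measurable_EFinP.
- by move=> x _; rewrite mule_ge0// Radon_Nikodym_SigmaFinite.f_ge0.
- by move=> x _; rewrite mule_ge0// lee_fin expR_ge0.
- by apply: filterS gae => x + _ => ->.
Qed.

Definition exp_mass := fine (\int[m]_x (expR (u x))%:E).

Lemma exp_mass_gt0 : 0 < exp_mass.
Proof. by rewrite /exp_mass fine_gt0// exp_pos exp_fin. Qed.

Local Notation Q := (mnormalize (exp_density m u) P0).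

Lemma ge0_integral_gibbs (f : T -> \bar R) : (forall x, 0 <= f x)%E ->
  measurable_fun setT f ->
  (\int[Q]_x f x = exp_mass^-1%:E * \int[m]_x (f x * (expR (u x))%:E))%E.
Proof.
move=> f0 mf; rewrite -ge0_integral_exp_density//.
have k0 : 0 <= exp_mass^-1 by rewrite invr_ge0 ltW// exp_mass_gt0.
rewrite -[exp_mass^-1]/((NngNum k0)%:num) -ge0_integral_mscale//.
apply: eq_measure_integral => A mA _.
rewrite /=/mnormalize.
(* The mass is neither zero nor infinite, so [mnormalize] does not fall back on [P0]. *)
by rewrite gt_eqF// lt_eqF//= /mscale/= muleC.
Qed.

Lemma integrable_gibbs (f : T -> R) : measurable_fun setT f ->
  m.-integrable setT (EFin \o (fun x => f x * expR (u x))) ->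
  Q.-integrable setT (EFin \o f).
Proof.
move=> mf /integrableP[_ fin]; apply/integrableP; split.
  exact/measurable_EFinP.
rewrite ge0_integral_gibbs//; last first.
  by apply: measurableT_comp => //; exact/measurable_EFinP.
apply: lte_mul_pinfty; rewrite ?lee_fin ?invr_ge0 ?ltW ?exp_mass_gt0//.
rewrite (le_lt_trans _ fin)// le_eqVlt; apply/orP; left; apply/eqP.
apply: eq_integral => x _ /=.
by rewrite normrM EFinM (ger0_norm (expR_ge0 _)).
Qed.

Lemma Rintegral_gibbs (f : T -> R) : measurable_fun setT f ->
  m.-integrable setT (EFin \o (fun x => f x * expR (u x))) ->
  \int[Q]_x f x = exp_mass^-1 * \int[m]_x (f x * expR (u x)).
Proof.
move=> mf fi; have Qi := integrable_gibbs mf fi.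
set K := exp_mass^-1.
suff H : (\int[Q]_x (f x)%:E = K%:E * \int[m]_x (f x * expR (u x))%:E)%E.
  by rewrite /Rintegral H fineM//; exact: integrable_fin_num fi.
rewrite integralE [in RHS]integralE.
have mf' : measurable_fun setT (EFin \o f) by exact/measurable_EFinP.
rewrite !ge0_integral_gibbs//; last 2 first.
- exact: measurable_funeneg.
- exact: measurable_funepos.
have -> : (\int[m]_x ((fun y => (f y)%:E)^\+ x * (expR (u x))%:E) =
    \int[m]_x ((fun y => (f y * expR (u y))%:E)^\+ x))%E.
  apply: eq_integral => x _.
  by rewrite !funeposE/= -!EFin_max -EFinM maxr_pMl ?expR_ge0// mul0r.
have -> : (\int[m]_x ((fun y => (f y)%:E)^\- x * (expR (u x))%:E) =
    \int[m]_x ((fun y => (f y * expR (u y))%:E)^\- x))%E.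
  apply: eq_integral => x _.
  by rewrite !funenegE/= -!EFin_max -EFinM maxr_pMl ?expR_ge0// mul0r mulNr.
have pf := integrable_pos_fin_num measurableT fi.
have nf := integrable_neg_fin_num measurableT fi.
set A := (\int[m]_x _)%E; set B := (\int[m]_x _)%E.
have -> : A = (fine A)%:E by rewrite fineK.
have -> : B = (fine B)%:E by rewrite fineK.
exact: (congr1 EFin (esym (mulrBr _ _ _))).
Qed.

End exp_density_integral.

(** * Exchangeability and integrability under the product measure *)

Section curie_weiss_reduction.
Context {R : realType}.
Local Notation TR := (measurableTypeR R).
Implicit Types (rho : probability TR R) (n : nat).

(** Together with [spin_sum] it determines the Hamiltonian, and it dominates every integrand
    below. *)
Definition square_sum n (t : n.-tuple TR) : R := \sum_(i < n) (tnth t i : R) ^+ 2.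

Definition pair_sum n (t : n.-tuple TR) : R :=
  \sum_(i < n) \sum_(j < n | (i < j)%N) (tnth t i : R) * (tnth t j : R).

Lemma measurable_spin_sum n : measurable_fun setT (@spin_sum R n).
Proof. by apply: measurable_sum => i; exact: measurable_tnth. Qed.

Lemma measurable_square_sum n : measurable_fun setT (@square_sum n).
Proof.
by apply: measurable_sum => i; apply: measurable_funX; exact: measurable_tnth.
Qed.

Lemma spin_sum_cons n x (t : n.-tuple TR) :
  spin_sum (Defs.cons_tuple (x, t)) = x + spin_sum t.
Proof.
rewrite /spin_sum big_ord_recl /=; congr (_ + _).
by apply: eq_bigr => i _; rewrite !(tnth_nth 0).
Qed.

Lemma square_sum_cons n x (t : n.-tuple TR) :
  square_sum (Defs.cons_tuple (x, t)) = x ^+ 2 + square_sum t.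
Proof.
rewrite /square_sum big_ord_recl /=; congr (_ + _).
by apply: eq_bigr => i _; rewrite !(tnth_nth 0).
Qed.

Lemma pair_sum_cons n x (t : n.-tuple TR) :
  pair_sum (Defs.cons_tuple (x, t)) = x * spin_sum t + pair_sum t.
Proof.
rewrite /pair_sum big_ord_recl /=; congr (_ + _).
  rewrite big_mkcond big_ord_recl /= add0r mulr_sumr.
  by apply: eq_bigr => i _; rewrite !(tnth_nth 0).
apply: eq_bigr => i _; rewrite big_mkcond big_ord_recl /= add0r [RHS]big_mkcond.
by apply: eq_bigr => j _; rewrite !(tnth_nth 0).
Qed.

Lemma pair_sumE n (t : n.-tuple TR) :
  pair_sum t = (spin_sum t ^+ 2 - square_sum t) / 2.
Proof.
elim: n t => [|n IH] t.
  by rewrite /pair_sum /spin_sum /square_sum !big_ord0; ring.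
rewrite (tuple_eta t).
have -> : [tuple of thead t :: behead t] = Defs.cons_tuple (thead t, [tuple of behead t]).
  exact/val_inj.
by rewrite pair_sum_cons spin_sum_cons square_sum_cons IH; field.
Qed.

(** Crude in [n], but it serves only integrability at fixed [n], where every Gaussian exponent is
    allowed. *)
Lemma pair_sum_le n (t : n.-tuple TR) : pair_sum t <= n%:R * (n%:R * square_sum t).
Proof.
have Q0 i : (tnth t i : R) ^+ 2 <= square_sum t.
  by rewrite /square_sum (bigD1 i)//= lerDl sumr_ge0// => j _; exact: sqr_ge0.
have Q1 : 0 <= square_sum t by apply: sumr_ge0 => j _; exact: sqr_ge0.
rewrite /pair_sum; apply: (@le_trans _ _ (\sum_(i < n) n%:R * square_sum t)); last first.
  by rewrite sumr_const card_ord -[leLHS]mulr_natl.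
apply: ler_sum => i _.
apply: (@le_trans _ _ (\sum_(j < n) square_sum t)); last first.
  by rewrite sumr_const card_ord -[leLHS]mulr_natl.
rewrite big_mkcond; apply: ler_sum => j _; case: ifP => // _.
have := Q0 i; have := Q0 j; set x := tnth t i; set y := tnth t j.
have : 0 <= ((x : R) - y) ^+ 2 by exact: sqr_ge0.
by rewrite sqrrB; lra.
Qed.

Section power_integral.
Variable rho : probability TR R.
Local Notation pw := (power_probability rho).

Lemma ge0_integral_power n (f : n.+1.-tuple TR -> \bar R) :
  (forall t, 0 <= f t)%E -> measurable_fun setT f ->
  (\int[pw n.+1]_t f t = \int[rho]_x \int[pw n]_t f (Defs.cons_tuple (x, t)))%E.
Proof.
move=> f0 mf; rewrite ge0_integral_distribution// fubini_tonelli1//.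
- by apply: measurableT_comp => //; exact: measurable_cons_tuple.
- by move=> ?; exact: f0.
Qed.

Lemma integrable_power_exp_square n (b : R) :
  (\int[rho]_x (expR (b * x ^+ 2))%:E < +oo)%E ->
  (\int[pw n]_t (expR (b * square_sum t))%:E < +oo)%E.
Proof.
move=> Hb; elim: n => [|n IH].
  rewrite (eq_integral (cst 1%E)) ?integral_cst ?mul1e ?probability_setT ?ltry//.
  by move=> t _; rewrite /square_sum big_ord0 mulr0 expR0.
rewrite ge0_integral_power//; last first.
  apply/measurable_EFinP; apply: measurableT_comp => //.
  by apply: measurable_funM => //; exact: measurable_square_sum.
set I := (\int[pw n]_t (expR (b * square_sum t))%:E)%E in IH.
rewrite (eq_integral (fun x : TR => (expR (b * x ^+ 2))%:E * I)%E); last first.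
  move=> x _; under eq_integral do rewrite square_sum_cons mulrDr expRD EFinM.
  rewrite ge0_integralZl//.
  apply/measurable_EFinP; apply: measurableT_comp => //.
  by apply: measurable_funM => //; exact: measurable_square_sum.
have I0 : (0 <= I)%E by apply: integral_ge0 => *; rewrite lee_fin expR_ge0.
rewrite ge0_integralZr//.
- apply: lte_mul_pinfty => //; last by rewrite ge0_fin_numE// integral_ge0// => *; rewrite lee_fin expR_ge0.
  by apply: integral_ge0 => *; rewrite lee_fin expR_ge0.
- apply/measurable_EFinP; apply: measurableT_comp => //.
  by apply: measurable_funM => //; exact: measurable_funX.
Qed.

(** Induction on the number of spins brings the [i]-th coordinate to the second place, and Tonelli's
    theorem swaps the first two. The integrand sees the other coordinates through symmetric sums
    only, which is all that the Gibbs weight needs. *)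
Lemma ge0_power_exchange n (f : TR * (TR * TR) -> \bar R) (i : 'I_n.+1) :
  (forall z, 0 <= f z)%E -> measurable_fun setT f ->
  (\int[pw n.+1]_t f (tnth t i, (spin_sum t, square_sum t)) =
   \int[pw n.+1]_t f (tnth t ord0, (spin_sum t, square_sum t)))%E.
Proof.
move=> f0 mf; elim: n i f f0 mf => [|n IH] i f f0 mf; first by rewrite (ord1 i).
have [->//|[j ->]] : i = ord0 \/ exists j, i = lift ord0 j.
  by case: (unliftP ord0 i) => [j|] ->; [right; exists j|left].
have mS k : measurable_fun setT (@spin_sum R k) := @measurable_spin_sum k.
have mQ k : measurable_fun setT (@square_sum k) := @measurable_square_sum k.
have mF k (l : 'I_k) : measurable_fun setT (fun t : k.-tuple TR =>
    f (tnth t l, (spin_sum t, square_sum t))).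
  apply: measurableT_comp => //; apply: measurable_fun_pair.
    exact: measurable_tnth.
  by apply: measurable_fun_pair; [exact: mS|exact: mQ].
pose sq (x y : R) (t : n.-tuple TR) : TR * TR :=
  (x + (y + spin_sum t), x ^+ 2 + (y ^+ 2 + square_sum t)).
(* All coordinates but the first two are integrated out; [z.2] is the one singled out, still in
   second place. *)
pose h (z : TR * TR) : \bar R := (\int[pw n]_t f (z.2, sq z.1 z.2 t))%E.
have mh : measurable_fun setT h.
  pose F (z : (TR * TR) * n.-tuple TR) := f (z.1.2, sq z.1.1 z.1.2 z.2).
  suff mF3 : measurable_fun setT F.
    by apply: (@measurable_fun_fubini_tonelli_F _ _ _ _ R (pw n) F) => // z; exact: f0.
  have m11 : measurable_fun setT (fun z : (TR * TR) * n.-tuple TR => z.1.1).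
    exact: measurableT_comp.
  have m12 : measurable_fun setT (fun z : (TR * TR) * n.-tuple TR => z.1.2).
    exact: measurableT_comp.
  have mS2 : measurable_fun setT (fun z : (TR * TR) * n.-tuple TR => spin_sum z.2).
    exact: measurableT_comp (mS n) measurable_snd.
  have mQ2 : measurable_fun setT (fun z : (TR * TR) * n.-tuple TR => square_sum z.2).
    exact: measurableT_comp (mQ n) measurable_snd.
  apply: measurableT_comp => //; apply: measurable_fun_pair => //.
  apply: measurable_fun_pair.
    by apply: measurable_funD => //; exact: measurable_funD.
  apply: measurable_funD; first exact: measurable_funX.
  by apply: measurable_funD => //; exact: measurable_funX.
have h0 z : (0 <= h z)%E by apply: integral_ge0.
transitivity (\int[rho]_x \int[rho]_y h (x, y))%E.
  rewrite ge0_integral_power//; apply: eq_integral => x _.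
  (* Freezing the first coordinate only shifts the two sums, so the induction hypothesis applies to
     the shifted function. *)
  pose g (z : TR * (TR * TR)) : \bar R := f (z.1, ((x : R) + z.2.1, (x : R) ^+ 2 + z.2.2)).
  have mg : measurable_fun setT g.
    apply: measurableT_comp => //; apply: measurable_fun_pair => //.
    apply: measurable_fun_pair.
      by apply: measurable_funD => //; exact: measurableT_comp.
    by apply: measurable_funD => //; exact: measurableT_comp.
  transitivity (\int[pw n.+1]_t g (tnth t j, (spin_sum t, square_sum t)))%E.
    apply: eq_integral => t _; rewrite spin_sum_cons square_sum_cons.
    by rewrite /g/= (tnth_nth 0) /= -(tnth_nth 0).
  have g0 z : (0 <= g z)%E by exact: f0.
  rewrite (IH j g)// ge0_integral_power//; last first.
    apply: measurableT_comp => //; apply: measurable_fun_pair.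
      exact: measurable_tnth.
    by apply: measurable_fun_pair; [exact: mS|exact: mQ].
  apply: eq_integral => y _; apply: eq_integral => t _.
  by rewrite /g/= spin_sum_cons square_sum_cons.
rewrite fubini_tonelli//.
rewrite [RHS]ge0_integral_power//; apply: eq_integral => x _.
rewrite [RHS]ge0_integral_power//; last first.
  apply: measurableT_comp (mF n.+2 ord0) _.
  by apply: measurableT_comp; [exact: measurable_cons_tuple|exact: measurable_pair1].
apply: eq_integral => y _; apply: eq_integral => t _.
by rewrite /= !spin_sum_cons !square_sum_cons addrCA [x ^+ 2 + _]addrCA.
Qed.

End power_integral.

End curie_weiss_reduction.

(** * Expectations of polynomially growing functions under the Gibbs measure *)

Section curie_weiss_expectation.
Context {R : realType}.
Local Notation TR := (measurableTypeR R).

(** The two arguments stand for X and Y. The class is closed under sums, products and composition,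
    and all its members are integrable, so that integrability never needs a separate estimate. *)
Definition poly_growth (F : TR * TR -> R) := measurable_fun setT F /\
  exists C N, forall x y : R, `|F (x, y)| <= C * (1 + `|x| + `|y|) ^+ N.

Variables (rho : probability TR R) (beta : R).
Hypotheses (rhoB : classB rho) (beta_gt0 : 0 < beta).
Local Notation pw := (power_probability rho).

Lemma exp_square_fin (b : R) : 0 < b ->
  (\int[rho]_x (expR (b * x ^+ 2))%:E < +oo)%E.
Proof.
move=> b0; case: rhoB => _ _ /(_ (b * 2)); rewrite mulr_gt0// => /(_ isT).
by under eq_integral do rewrite mulrAC mulfK ?pnatr_eq0//.
Qed.

Definition cw_head n (t : n.+1.-tuple TR) : R := tnth t ord0.
Definition cw_tail n (t : n.+1.-tuple TR) : R := spin_sum t - cw_head t.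

Lemma measurable_cw_head n : measurable_fun setT (@cw_head n).
Proof. exact: measurable_tnth. Qed.

Lemma measurable_cw_tail n : measurable_fun setT (@cw_tail n).
Proof.
by apply: measurable_funB; [exact: measurable_spin_sum|exact: measurable_cw_head].
Qed.

Lemma cw_head_cons n x (t : n.-tuple TR) : cw_head (Defs.cons_tuple (x, t)) = x.
Proof. by rewrite /cw_head (tnth_nth 0). Qed.

Lemma cw_tail_cons n x (t : n.-tuple TR) :
  cw_tail (Defs.cons_tuple (x, t)) = spin_sum t.
Proof. by rewrite /cw_tail spin_sum_cons cw_head_cons addrAC subrr add0r. Qed.

Let H n : n.-tuple TR -> R := @hamiltonian R n beta.

Let HE n (t : n.-tuple TR) : H t = beta / n%:R * pair_sum t.
Proof. by []. Qed.

Lemma abs_tnth_le n (t : n.-tuple TR) i : `|tnth t i : R| <= 1 + square_sum t.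
Proof.
have Q0 : (tnth t i : R) ^+ 2 <= square_sum t.
  by rewrite /square_sum (bigD1 i)//= lerDl sumr_ge0// => j _; exact: sqr_ge0.
apply: (@le_trans _ _ (1 + (tnth t i : R) ^+ 2)); last by rewrite lerD2l.
rewrite -(real_normK (num_real _)); set z := `|_|.
have := sqr_ge0 (z - 1); rewrite sqrrB; have : 0 <= z by exact: normr_ge0.
lra.
Qed.

Lemma integrable_hamiltonian_bound n (F : n.-tuple TR -> R) (C : R) N :
  (0 < n)%N -> measurable_fun setT F ->
  (forall t, `|F t| <= C * (1 + square_sum t) ^+ N) ->
  (pw n).-integrable setT (EFin \o (fun t => F t * expR (H t))).
Proof.
move=> n0 mF FC.
apply/integrableP; split.
  by apply/measurable_EFinP/measurable_funM => //; exact: measurableT_comp.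
(* [N] pays for the polynomial factor, by [1 + x <= expR x], and [beta * n] for the Hamiltonian, by
   [pair_sum_le]. *)
pose b := N%:R + beta * n%:R.
have b0 : 0 < b by rewrite ltr_wpDl// mulr_gt0// ltr0n.
apply: (@le_lt_trans _ _ (\int[pw n]_t (`|C|%:E * (expR (b * square_sum t))%:E))%E); last first.
  rewrite ge0_integralZl//; last first.
    apply/measurable_EFinP; apply: measurableT_comp => //.
    by apply: measurable_funM => //; exact: measurable_square_sum.
  apply: lte_mul_pinfty => //; apply: integrable_power_exp_square.
  exact: exp_square_fin.
apply: ge0_le_integral => //.
- by apply: measurableT_comp => //; apply/measurable_EFinP/measurable_funM => //; exact: measurableT_comp.
- apply: emeasurable_funM => //; apply/measurable_EFinP; apply: measurableT_comp => //.
  by apply: measurable_funM => //; exact: measurable_square_sum.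
move=> t _; rewrite -EFinM lee_fin normrM (ger0_norm (expR_ge0 _)).
have Q1 : 0 <= square_sum t by apply: sumr_ge0 => j _; exact: sqr_ge0.
rewrite /b mulrDl expRD mulrA; apply: ler_pM => //; rewrite ?expR_ge0//.
- apply: le_trans (FC t) _; apply: (@le_trans _ _ (`|C| * (1 + square_sum t) ^+ N)).
    by rewrite ler_wpM2r ?ler_norm// exprn_ge0// addr_ge0.
  by rewrite ler_wpM2l// expRM_natl lerXn2r// ?nnegrE ?addr_ge0 ?expR_ge0 ?expR_ge1Dx.
- rewrite ler_expR HE -!mulrA ler_pM2l// ler_pdivrMl ?ltr0n//.
  exact: pair_sum_le.
Qed.

Lemma hamiltonian_mass_fin n : (0 < n)%N ->
  (\int[pw n]_t (expR (H t))%:E < +oo)%E.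
Proof.
move=> n0.
have /integrableP[_] : (pw n).-integrable setT (EFin \o (fun t => cst 1 t * expR (H t))).
  apply: (@integrable_hamiltonian_bound _ _ 1 0) => // t.
  by rewrite expr0 mulr1 normr1.
apply: le_lt_trans; rewrite le_eqVlt; apply/orP; left; apply/eqP.
by apply: eq_integral => t _ /=; rewrite mul1r ger0_norm ?expR_ge0.
Qed.

Lemma hamiltonian_mass_gt0 n : (0 < \int[pw n]_t (expR (H t))%:E)%E.
Proof.
have mE : measurable_fun setT (EFin \o (fun t => expR (H (n:=n) t))).
  by apply/measurable_EFinP; exact: measurableT_comp.
rewrite lt_neqAle integral_ge0 ?andbT; last by move=> *; rewrite lee_fin expR_ge0.
apply/negP => /eqP/esym I0.
have : ae_eq (pw n) setT (EFin \o (fun t => expR (H (n:=n) t))) (cst 0%E).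
  apply/ae_eq_integral_abs => //.
  by under eq_integral do rewrite gee0_abs ?lee_fin ?expR_ge0//.
move=> [N [mN N0 sub]].
have : (pw n) setT = 0%E.
  apply: (@subset_measure0 _ _ _ _ _ N) => //.
  move=> t _; apply: sub => /= /(_ I) [] /eqP.
  by rewrite expR_eq0.
by rewrite probability_setT => -[] /eqP; rewrite oner_eq0.
Qed.

Lemma tilt_integrable (f : TR -> R) (C h : R) N : measurable_fun setT f ->
  (forall x : R, `|f x| <= C * (1 + `|x|) ^+ N) ->
  rho.-integrable setT (EFin \o (fun x => f x * expR (h * x))).
Proof.
(* The polynomial and the tilt together cost an exponential of [(N + |h|) |x|], at most
   [b (1 + x^2)]; the summand 1 keeps [b] positive. *)
move=> mf fC; pose b := N%:R + `|h| + 1.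
have b0 : 0 < b by rewrite ltr_wpDl// addr_ge0.
have mexp (c : R) : measurable_fun setT (fun x : TR => expR (c * x)).
  by apply: measurableT_comp => //; exact: measurable_funM.
apply/integrableP; split.
  by apply/measurable_EFinP/measurable_funM.
have mexp2 : measurable_fun setT (fun x : TR => (expR (b * x ^+ 2))%:E).
  apply/measurable_EFinP; apply: measurableT_comp => //.
  by apply: measurable_funM => //; exact: measurable_funX.
apply: (@le_lt_trans _ _ (\int[rho]_x ((`|C| * expR b)%:E * (expR (b * x ^+ 2))%:E))%E); last first.
  rewrite ge0_integralZl//.
  by apply: lte_mul_pinfty => //; exact: exp_square_fin.
apply: ge0_le_integral => //.
- by apply: measurableT_comp => //; apply/measurable_EFinP/measurable_funM.
- exact: emeasurable_funM.
move=> x _; rewrite -EFinM lee_fin normrM (ger0_norm (expR_ge0 _)).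
have x1 : `|x : R| <= 1 + x ^+ 2.
  rewrite -(real_normK (num_real _)); set z := `|_|.
  have := sqr_ge0 (z - 1); rewrite sqrrB; have : 0 <= z by exact: normr_ge0.
  lra.
have fx : `|f x| <= `|C| * expR (N%:R * `|x : R|).
  apply: le_trans (fC x) _; apply: (@le_trans _ _ (`|C| * (1 + `|x : R|) ^+ N)).
    by rewrite ler_wpM2r ?ler_norm// exprn_ge0// addr_ge0.
  by rewrite ler_wpM2l// expRM_natl lerXn2r// ?nnegrE ?addr_ge0 ?expR_ge0 ?expR_ge1Dx.
have hx : expR (h * x) <= expR (`|h| * `|x : R|).
  by rewrite ler_expR -normrM ler_norm.
apply: le_trans (ler_pM (normr_ge0 _) (expR_ge0 _) fx hx) _.
rewrite -!mulrA ler_wpM2l// -!expRD ler_expR -mulrDl.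
apply: (@le_trans _ _ (b * `|x : R|)).
  by rewrite ler_wpM2r// /b lerDl.
by rewrite -[X in _ <= X + _]mulr1 -mulrDr ler_pM2l.
Qed.

Lemma abs_spin_sum_le n (t : n.-tuple TR) : `|spin_sum t| <= n%:R * (1 + square_sum t).
Proof.
apply: le_trans (ler_norm_sum _ _ _) _.
rewrite mulr_natl -[X in _ *+ X]card_ord -sumr_const.
by apply: ler_sum => i _; exact: abs_tnth_le.
Qed.

Lemma cw_growth n (F : TR * TR -> R) (C : R) N :
  (forall x y : R, `|F (x, y)| <= C * (1 + `|x| + `|y|) ^+ N) ->
  forall t : n.+1.-tuple TR, `|F (cw_head t, cw_tail t)| <=
    `|C| * (n.+4)%:R ^+ N * (1 + square_sum t) ^+ N.
Proof.
move=> FC t; apply: le_trans (FC _ _) _.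
have Q1 : 0 <= square_sum t by apply: sumr_ge0 => j _; exact: sqr_ge0.
set z := 1 + _ + _.
have z0 : 0 <= z by rewrite /z !addr_ge0.
apply: (@le_trans _ _ (`|C| * z ^+ N)).
  by rewrite ler_wpM2r ?ler_norm// exprn_ge0.
(* The factor is 1 for the constant, 2 for the head, which also enters through the tail, and [n.+1]
   for the spin sum. *)
suff zle : z <= n.+4%:R * (1 + square_sum t).
  have r0 : 0 <= n.+4%:R * (1 + square_sum t) by rewrite mulr_ge0// addr_ge0.
  by rewrite -mulrA ler_wpM2l// -exprMn; apply: lerXn2r.
have hx : `|cw_head t| <= 1 + square_sum t by exact: abs_tnth_le.
have hS : `|spin_sum t| <= n.+1%:R * (1 + square_sum t).
  exact: abs_spin_sum_le.
have hY : `|cw_tail t| <= `|spin_sum t| + `|cw_head t| by exact: ler_normB.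
have e4 : n.+4%:R = n%:R + 4 :> R by rewrite -addn4 natrD.
have e1 : n.+1%:R = n%:R + 1 :> R by rewrite -addn1 natrD.
rewrite e4; rewrite e1 in hS.
rewrite /z; nra.
Qed.

Local Notation P n := (curie_weiss rho n.+1 beta).
Local Notation Z n := (exp_mass (pw n.+1) (@hamiltonian R n.+1 beta)).

Section growth.
Variables (n : nat) (F : TR * TR -> R).
Hypothesis pgF : poly_growth F.

Let mf : measurable_fun setT (fun t : n.+1.-tuple TR => F (cw_head t, cw_tail t)).
Proof.
case: pgF => mF _; apply: measurableT_comp => //; apply: measurable_fun_pair.
  exact: measurable_cw_head.
exact: measurable_cw_tail.
Qed.

Lemma cw_integrable_exp : (pw n.+1).-integrable setT
  (EFin \o (fun t => F (cw_head t, cw_tail t) * expR (hamiltonian beta t))).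
Proof.
case: pgF => _ [C [N FC]].
by apply: (@integrable_hamiltonian_bound _ _ (`|C| * (n.+4)%:R ^+ N) N) => // t; exact: cw_growth.
Qed.

Lemma cw_integrable : (P n).-integrable setT (EFin \o (fun t => F (cw_head t, cw_tail t))).
Proof.
apply: integrable_gibbs => //; last exact: cw_integrable_exp.
- exact: hamiltonian_mass_fin.
- exact: hamiltonian_mass_gt0.
Qed.

Lemma cw_expectationE : \int[P n]_t F (cw_head t, cw_tail t) =
  (Z n)^-1 * \int[pw n.+1]_t (F (cw_head t, cw_tail t) * expR (hamiltonian beta t)).
Proof.
apply: Rintegral_gibbs => //; last exact: cw_integrable_exp.
- exact: hamiltonian_mass_fin.
- exact: hamiltonian_mass_gt0.
Qed.

End growth.

Lemma cw_mass_gt0 n : 0 < Z n.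
Proof.
by apply: exp_mass_gt0; [exact: hamiltonian_mass_fin|exact: hamiltonian_mass_gt0].
Qed.

(* Given the other spins, whose sum is [y], the density of the first one with respect to
   [rho] is proportional to [expR (beta / n.+1%:R * y * x)]. *)
Lemma cw_conditional_le0 n (F : TR * TR -> R) : poly_growth F ->
  (forall y : R, \int[rho]_x (F (x, y) * expR (beta / n.+1%:R * y * x)) <= 0) ->
  \int[P n]_t F (cw_head t, cw_tail t) <= 0.
Proof.
move=> pgF F0; rewrite cw_expectationE// pmulr_rle0 ?invr_gt0 ?cw_mass_gt0//.
have fi := cw_integrable_exp n pgF.
set f := (fun t => _) in fi *.
have mf : measurable_fun setT f.
  by case/integrableP : fi => /measurable_EFinP.
have fi2 : (rho \x pw n)%E.-integrable setT ((EFin \o f) \o @Defs.cons_tuple _ TR n).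
  case/integrableP : fi => mEf fin; apply/integrableP; split.
    by apply: measurableT_comp => //.
  by rewrite ge0_integral_distribution// in fin; exact: measurableT_comp.
suff le0 : (\int[pw n.+1]_t (f t)%:E <= 0)%E.
  by rewrite /Rintegral; move: le0; case: (\int[_]_t _)%E => //= r; rewrite lee_fin.
rewrite integral_distribution//; last exact/measurable_EFinP.
rewrite -integral21_prod_meas1//.
pose I (t : n.-tuple TR) := (\int[rho]_x (f (Defs.cons_tuple (x, t)))%:E)%E.
have I0 t : (I t <= 0)%E.
  have [C [N FC]] := pgF.2.
  (* Splitting off the spin [x], the pair sum becomes [x * y] plus that of the other spins, which
     only contributes the positive factor [c]. *)
  pose y : R := spin_sum t; pose c := expR (beta / n.+1%:R * pair_sum t).
  have mFy : measurable_fun setT (fun x : TR => F (x, y)).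
    by apply: measurableT_comp; [exact: pgF.1|exact: measurable_pair2].
  have Fi : rho.-integrable setT (EFin \o
      (fun x => F (x, y) * expR (beta / n.+1%:R * y * x))).
    apply: (@tilt_integrable _ (`|C| * (1 + `|y|) ^+ N) _ N) => // x.
    apply: le_trans (FC _ _) _; rewrite -mulrA -exprMn.
    apply: (@le_trans _ _ (`|C| * (1 + `|x| + `|y|) ^+ N)).
      by rewrite ler_wpM2r ?ler_norm// exprn_ge0// !addr_ge0.
    rewrite ler_wpM2l//; apply: lerXn2r; rewrite ?nnegrE ?mulr_ge0 ?addr_ge0//.
    by have := mulr_ge0 (normr_ge0 x) (normr_ge0 y); rewrite mulrDl mulrDr; lra.
  have -> : I t = (\int[rho]_x (c%:E * (F (x, y) * expR (beta / n.+1%:R * y * x))%:E))%E.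
    apply: eq_integral => x _; rewrite /f cw_head_cons cw_tail_cons -EFinM.
    rewrite /hamiltonian -/(pair_sum _) pair_sum_cons mulrDr expRD -/c -/y.
    by congr EFin; rewrite [RHS]mulrC -[RHS]mulrA -(mulrA _ y) (mulrC y).
  rewrite integralZl// -(fineK (integrable_fin_num _ Fi))//.
  rewrite -EFinM lee_fin pmulr_rle0 ?expR_gt0//; exact: F0.
rewrite (eq_integral (fun t => - (- I t))%E); last by move=> t _; rewrite oppeK.
rewrite integral_ge0N//; last by move=> t _; rewrite oppe_ge0.
by rewrite oppe_le0; apply: integral_ge0 => t _; rewrite oppe_ge0.
Qed.

Lemma power_exchange n (f : TR * (TR * TR) -> R) (i : 'I_n.+1) :
  measurable_fun setT f ->
  \int[pw n.+1]_t f (tnth t i, (spin_sum t, square_sum t)) =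
  \int[pw n.+1]_t f (tnth t ord0, (spin_sum t, square_sum t)).
Proof.
move=> mf; rewrite /Rintegral; congr fine; rewrite integralE [RHS]integralE.
have me : measurable_fun setT (EFin \o f) by exact/measurable_EFinP.
congr (_ - _)%E.
- have := ge0_power_exchange rho i (f := (EFin \o f)^\+%E) _ (measurable_funepos me).
  move=> H1; apply: etrans (etrans (H1 _) _); [| by move=> z; exact: funepos_ge0|].
  + by apply: eq_integral => t _; rewrite !funeposE.
  + by apply: eq_integral => t _; rewrite !funeposE.
- have := ge0_power_exchange rho i (f := (EFin \o f)^\-%E) _ (measurable_funeneg me).
  move=> H1; apply: etrans (etrans (H1 _) _); [| by move=> z; exact: funeneg_ge0|].
  + by apply: eq_integral => t _; rewrite !funenegE.
  + by apply: eq_integral => t _; rewrite !funenegE.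
Qed.

(* [cw_tail t - n%:R * cw_head t] is the sum over all spins of the difference with the first. *)
Lemma cw_exchange n (g : R -> R) :
  measurable_fun setT (g : TR -> R) ->
  (exists C N, forall x : R, `|g x| <= C * (1 + `|x|) ^+ N) ->
  \int[P n]_t ((cw_tail t - n%:R * cw_head t) * g (cw_head t + cw_tail t)) = 0.
Proof.
move=> mg [C [N gC]].
pose F (z : TR * TR) : R := ((z.2 : R) - n%:R * z.1) * g ((z.1 : R) + z.2).
have mF : measurable_fun setT F.
  apply: measurable_funM.
    by apply: measurable_funB => //; exact: measurable_funM.
  by apply: measurableT_comp => //; exact: measurable_funD.
have pgF : poly_growth F.
  split => //; exists (n.+1%:R * `|C|), N.+1 => x y; rewrite /F/= normrM.
  have -> : n.+1%:R * `|C| * (1 + `|x| + `|y|) ^+ N.+1 =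
    (n.+1%:R * (1 + `|x| + `|y|)) * (`|C| * (1 + `|x| + `|y|) ^+ N) by rewrite exprS; ring.
  apply: ler_pM => //.
    apply: le_trans (ler_normB _ _) _; rewrite normrM ger0_norm ?ler0n//.
    have x0 := normr_ge0 x; have y0 := normr_ge0 y; have n0 : 0 <= n%:R :> R by rewrite ler0n.
    have -> : n.+1%:R = n%:R + 1 :> R by rewrite -addn1 natrD.
    by have := mulr_ge0 n0 y0; lra.
  apply: le_trans (gC _) _; apply: (@le_trans _ _ (`|C| * (1 + `|x + y|) ^+ N)).
    by rewrite ler_wpM2r ?ler_norm// exprn_ge0// addr_ge0.
  rewrite ler_wpM2l//; apply: lerXn2r; rewrite ?nnegrE ?addr_ge0//.
  by rewrite -addrA lerD2l ler_normD.
rewrite (cw_expectationE n pgF).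
have S0 (t : n.+1.-tuple TR) : cw_head t + cw_tail t = spin_sum t.
  by rewrite /cw_tail addrC subrK.
(* By [pair_sumE] the Gibbs weight is a function of the two symmetric sums and can be absorbed into
   the integrand of [power_exchange]. *)
pose G (z : TR * (TR * TR)) : R := (z.1 : R) * g z.2.1 *
  expR (beta / n.+1%:R * (((z.2.1 : R) ^+ 2 - z.2.2) / 2)).
have mG : measurable_fun setT G.
  have m1 : measurable_fun setT (fun z : TR * (TR * TR) => z.2.1) by exact: measurableT_comp.
  have m2 : measurable_fun setT (fun z : TR * (TR * TR) => z.2.2) by exact: measurableT_comp.
  apply: measurable_funM.
    by apply: measurable_funM => //; exact: measurableT_comp.
  apply: measurableT_comp => //; apply: measurable_funM => //.
  by apply: measurable_funM => //; apply: measurable_funB => //; exact: measurable_funX.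
have Gi (i : 'I_n.+1) : (pw n.+1).-integrable setT
    (EFin \o (fun t => G (tnth t i, (spin_sum t, square_sum t)))).
  have := @integrable_hamiltonian_bound n.+1
    (fun t => (tnth t i : R) * g (spin_sum t)) (`|C| * n.+2%:R ^+ N) N.+1 isT.
  have mti : measurable_fun setT (fun t : n.+1.-tuple TR => (tnth t i : R) * g (spin_sum t)).
    apply: measurable_funM; first exact: measurable_tnth.
    by apply: measurableT_comp; [exact: mg|exact: measurable_spin_sum].
  move=> /(_ mti) H1; apply: eq_integrable (H1 _) => // [t _|t].
    by rewrite /= HE pair_sumE.
  have Q1 : 0 <= square_sum t by apply: sumr_ge0 => j _; exact: sqr_ge0.
  rewrite normrM exprS mulrCA; apply: ler_pM => //; first exact: abs_tnth_le.
  apply: le_trans (gC _) _; apply: (@le_trans _ _ (`|C| * (1 + `|spin_sum t|) ^+ N)).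
    by rewrite ler_wpM2r ?ler_norm// exprn_ge0// addr_ge0.
  rewrite -mulrA ler_wpM2l// -exprMn.
  have r0 : 0 <= n.+2%:R * (1 + square_sum t) by rewrite mulr_ge0// addr_ge0.
  apply: lerXn2r; rewrite ?nnegrE ?addr_ge0//.
  have := abs_spin_sum_le t; rewrite -[n.+2]addn1 natrD; lra.
have zero s : (pw n.+1).-integrable setT (EFin \o (fun t => \sum_(i <- s)
      (G (tnth t i, (spin_sum t, square_sum t)) - G (tnth t ord0, (spin_sum t, square_sum t))))) /\
    \int[pw n.+1]_t (\sum_(i <- s)
      (G (tnth t i, (spin_sum t, square_sum t)) - G (tnth t ord0, (spin_sum t, square_sum t)))) = 0.
  elim: s => [|i s [IH1 IH2]].
    under [X in _.-integrable _ X]boolp.funext do rewrite /= big_nil.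
    split; first exact: integrable0.
    by under eq_Rintegral do rewrite big_nil; rewrite Rintegral_cst// mul0r.
  have d1 := integrable_sub measurableT (Gi i) (Gi ord0).
  split.
    apply: eq_integrable (integrable_add measurableT d1 IH1) => // t _.
    by rewrite /= big_cons.
  under eq_Rintegral do rewrite big_cons.
  by rewrite RintegralD// IH2 addr0 RintegralB// power_exchange// subrr.
have [_ z] := zero (index_enum 'I_n.+1).
rewrite -[RHS](mulr0 (Z n)^-1) -[in RHS]z; congr (_ * _).
apply: eq_Rintegral => t _.
rewrite sumrB sumr_const card_ord /G/= -!mulr_suml /F/= S0 /hamiltonian -/(pair_sum _) pair_sumE.
rewrite -mulrnAl -mulrnAl -mulrBl -mulrBl; congr (_ * _ * _).
rewrite -/(spin_sum t) -/(cw_head t) /cw_tail mulrS -[cw_head t *+ n]mulr_natl.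
ring.
Qed.

End curie_weiss_expectation.

Section real_calculus.
Context {R : realType}.
Implicit Types (f g df : R -> R) (x y : R).

Lemma mean_value f df : (forall x, is_derive x 1 f (df x)) ->
  forall x y, exists2 c, Num.min x y <= c <= Num.max x y & f y - f x = df c * (y - x).
Proof.
move=> dfE.
have cf a b : {within `[a, b], continuous f}.
  apply: continuous_subspaceT => z; apply: differentiable_continuous.
  by apply/derivable1_diffP; exact: ex_derive.
suff H x y : x <= y -> exists2 c, x <= c <= y & f y - f x = df c * (y - x).
  move=> x y; have [xy|yx] := leP x y; first exact: H.
  have [c cxy E] := H _ _ (ltW yx); exists c => //.
  by rewrite -opprB E; ring.
move=> xy; have [c] := MVT_segment xy (fun z _ => dfE z) (cf x y).
by rewrite in_itv/=; exists c.
Qed.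

(** With a quadratic remainder, differentiation under the integral sign reduces to integrating one
    pointwise inequality. *)
Lemma is_derive_quadratic f x (d C : R) :
  (forall t, `|t| <= 1 -> `|f (x + t) - f x - t * d| <= C * t ^+ 2) ->
  is_derive x 1 f d.
Proof.
move=> H.
have lim : (fun t => t^-1 *: ((f \o shift x) (t *: (1 : R)) - f x)) @ 0^' --> d.
  apply/cvgrPdist_le => e e0; near=> t.
  have t0 : t != 0 by near: t; exact: nbhs_dnbhs_neq.
  have t1 : `|t| <= 1 by near: t; apply: dnbhs0_le.
  have te : `|t| <= e / (`|C| + 1) by near: t; apply: dnbhs0_le; rewrite divr_gt0// ltr_wpDl.
  rewrite distrC /= /GRing.scale/= mulr1 (addrC t x).
  have -> : t^-1 * (f (x + t) - f x) - d = t^-1 * (f (x + t) - f x - t * d).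
    by rewrite [RHS]mulrBr mulKf.
  rewrite normrM normfV ler_pdivrMl ?normr_gt0//.
  apply: le_trans (H _ t1) _.
  rewrite -[t ^+ 2]real_normK ?num_real// expr2 mulrA [leRHS]mulrC ler_wpM2r//.
  apply: (@le_trans _ _ ((`|C| + 1) * `|t|)).
    by rewrite ler_wpM2r// (le_trans (ler_norm _))// lerDl.
  by rewrite mulrC -ler_pdivlMr// ltr_wpDl.
by apply: DeriveDef; [apply/cvg_ex; exists d|exact/cvg_lim].
Unshelve. all: by end_near. Qed.

(** The convexity bounds [1 + u <= expR u] and [1 - u <= expR (- u)] give 0 <= [expR u - 1 - u] <=
    [u * (expR u - 1)], and a second use of them yields the square. *)
Lemma expR_quadratic (u : R) : `|expR u - 1 - u| <= u ^+ 2 * expR `|u|.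
Proof.
have h1 := expR_ge1Dx u; have h2 := expR_ge1Dx (- u).
have h3 : expR u * expR (- u) = 1 by rewrite expRxMexpNx_1.
have h4 : expR u - 1 <= u * expR u by nra.
rewrite ger0_norm; last by lra.
have [u0|u0] := leP 0 u.
  by rewrite ger0_norm//; nra.
have : 1 <= expR `|u| by rewrite -expR0 ler_expR.
have : 0 <= u ^+ 2 by exact: sqr_ge0.
nra.
Qed.

End real_calculus.

(** * Derivatives of the moment generating function *)

Section exponential_moments.
Context {R : realType}.
Local Notation TR := (measurableTypeR R).
Variable rho : probability TR R.
Hypothesis rhoB : classB rho.

(** The [p]-th derivative of the moment generating function of [rho]. *)
Definition emom (p : nat) (h : R) : R := \int[rho]_x ((x : R) ^+ p * expR (h * x)).

Lemma growth_expr p : exists C N, forall x : R, `|x ^+ p| <= C * (1 + `|x|) ^+ N.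
Proof.
exists 1, p => x; rewrite mul1r normrX; apply: lerXn2r; rewrite ?nnegrE ?addr_ge0//.
by rewrite lerDr.
Qed.

Lemma integrable_emom p h :
  rho.-integrable setT (EFin \o (fun x : TR => (x : R) ^+ p * expR (h * x))).
Proof.
have [C [N H]] := growth_expr p.
by apply: (tilt_integrable rhoB) H; exact: measurable_funX.
Qed.

Lemma integrable_normX_emom p h :
  rho.-integrable setT (EFin \o (fun x : TR => `|x : R| ^+ p * expR (h * x))).
Proof.
have [C [N H]] := growth_expr p.
apply: (@tilt_integrable _ _ rhoB _ C _ N) => [|x]; last by rewrite -normrX normr_id.
by apply: measurable_funX; exact: normr_measurable.
Qed.

Let opp (x : TR) : TR := - (x : R).

Let measurable_opp : measurable_fun setT opp.
Proof. exact: measurableT_comp. Qed.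

Let integral_pushforward_opp (f : TR -> \bar R) (m : measurable_fun setT opp) :
  (\int[pushforward rho opp]_x f x = \int[rho]_x f x)%E.
Proof.
have [_ sym _] := rhoB.
by apply: eq_measure_integral => A mA _; exact: (sym A mA).
Qed.

Lemma Rintegral_opp (f : TR -> R) : measurable_fun setT f ->
  rho.-integrable setT (EFin \o f) ->
  \int[rho]_x f (- (x : R)) = \int[rho]_x f x.
Proof.
move=> mf fi; have mef : measurable_fun setT (EFin \o f) by exact/measurable_EFinP.
rewrite /Rintegral -[in RHS](integral_pushforward_opp _ measurable_opp).
rewrite integral_pushforward//.
apply/integrableP; split; first exact: measurableT_comp.
case/integrableP : fi => _; rewrite -(integral_pushforward_opp _ measurable_opp).
rewrite ge0_integral_pushforward//; exact: measurableT_comp.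
Qed.

Lemma emomN p h : emom p (- h) = (-1) ^+ p * emom p h.
Proof.
rewrite /emom -RintegralZl//; last exact: integrable_emom.
rewrite -Rintegral_opp; first last.
- exact: integrable_emom.
- apply: measurable_funM; first exact: measurable_funX.
  by apply: measurableT_comp => //; exact: measurable_funM.
apply: eq_Rintegral => x _; rewrite mulrNN [(- x) ^+ p]exprNn mulrA; congr (_ * _).
Qed.

(** Integrate [1 + h * x <= expR (h * x)]; the mean is zero by symmetry. *)
Lemma emom0_ge1 h : 1 <= emom 0 h.
Proof.
have e1 : emom 1 0 = 0.
  by have := emomN 1 0; rewrite oppr0 expr1 mulN1r; lra.
have i0 := integrable_emom 0 0; have i1 := integrable_emom 1 0.
have : \int[rho]_x (((x : R) ^+ 0 * expR (0 * x)) + h * ((x : R) ^+ 1 * expR (0 * x))) <= emom 0 h.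
  apply: le_Rintegral => //.
  - by apply: integrable_add => //; exact: integrable_scale.
  - exact: integrable_emom.
  by move=> x _; rewrite !mul0r expR0 !mulr1 expr0 expr1 mul1r expR_ge1Dx.
rewrite RintegralD//; last exact: integrable_scale.
rewrite RintegralZl// -/(emom 1 0) e1 mulr0 addr0; apply: le_trans.
under eq_Rintegral do rewrite mul0r expR0 expr0 mulr1.
rewrite Rintegral_cst//.
by rewrite [X in fine X]probability_setT mulr1.
Qed.

Lemma is_derive_emom p (h : R) : is_derive h (1 : R) (emom p) (emom p.+1 h).
Proof.
(* For [|t| <= 1] the product of [expR (h * x)] and the remainder factor [expR |t * x|] is at most
   [expR (c * |x|)], hence at most the sum of the two tilts by [c] and [- c]. *)
pose c := `|h| + 1.
apply: (@is_derive_quadratic _ _ _ _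
  (\int[rho]_x (`|x : R| ^+ p.+2 * expR (c * x) + `|x : R| ^+ p.+2 * expR (- c * x)))) => t t1.
have i0 := integrable_emom p (h + t); have i1 := integrable_emom p h.
have i2 := integrable_emom p.+1 h.
have i3 := integrable_normX_emom p.+2 c; have i4 := integrable_normX_emom p.+2 (- c).
have i01 := integrable_sub measurableT i0 i1.
have i22 := integrable_scale measurableT t i2.
have i012 := integrable_sub measurableT i01 i22.
have i34 := integrable_add measurableT i3 i4.
rewrite /emom -RintegralB// -RintegralZl// -RintegralB//.
apply: le_trans (le_normr_Rintegral _ i012) _ => //.
rewrite mulrC -RintegralZl//.
apply: le_Rintegral => //; first exact: integrable_norm i012.
  exact: (integrable_scale measurableT (t ^+ 2) i34).
move=> x _ /=.
have -> : x ^+ p * expR ((h + t) * x) - x ^+ p * expR (h * x) - t * (x ^+ p.+1 * expR (h * x)) =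
  x ^+ p * expR (h * x) * (expR (t * x) - 1 - t * x).
  by rewrite mulrDl expRD exprS; ring.
rewrite normrM normrM normrX (ger0_norm (expR_ge0 _)).
have hc : expR (h * x) * expR `|t * x| <= expR (c * x) + expR (- c * x).
  rewrite -expRD.
  have xc : h * x + `|t * x| <= c * `|x|.
    rewrite /c mulrDl lerD// ?normrM.
      by rewrite (le_trans (ler_norm _))// normrM.
    by rewrite ler_wpM2r.
  have [x0|x0] := leP 0 (x : R).
    rewrite (ger0_norm x0) in xc.
    by apply: (@le_trans _ _ (expR (c * x))); rewrite ?ler_expR// lerDl expR_ge0.
  rewrite (ltr0_norm x0) mulrN -mulNr in xc.
  by apply: (@le_trans _ _ (expR (- c * x))); rewrite ?ler_expR// lerDr expR_ge0.
apply: (@le_trans _ _ (`|x| ^+ p * expR (h * x) * ((t * x) ^+ 2 * expR `|t * x|))).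
  by rewrite ler_wpM2l ?expR_quadratic// mulr_ge0 ?expR_ge0 ?exprn_ge0.
have -> : `|x| ^+ p * expR (h * x) * ((t * x) ^+ 2 * expR `|t * x|) =
  t ^+ 2 * `|x| ^+ p.+2 * (expR (h * x) * expR `|t * x|).
  by rewrite exprMn -[x ^+ 2]real_normK ?num_real// !exprS; ring.
set e1 := expR (c * x) in hc *; set e2 := expR (- c * x) in hc *.
have -> : t ^+ 2 * (`|x| ^+ p.+2 * e1 + `|x| ^+ p.+2 * e2) =
  t ^+ 2 * `|x| ^+ p.+2 * (e1 + e2) by ring.
by rewrite ler_wpM2l// mulr_ge0 ?sqr_ge0 ?exprn_ge0.
Qed.

End exponential_moments.

(** * Taylor polynomials at the origin *)

Section taylor_class.
Context {R : realType}.
Implicit Types (f g df : R -> R) (p q : {poly R}) (x h : R).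

Definition taylor_bound N f q C d := forall h : R, `|h| <= d -> `|f h - q.[h]| <= C * `|h| ^+ N.

(* The point of this class is its stability under antiderivatives: [emom] and [1 / emom 0]
   solve differential equations in the class, hence belong to it to all orders. *)
Definition has_taylor N f := exists q C d, 0 < d <= 1 /\ taylor_bound N f q C d.

Lemma poly_bounded q : exists2 B : R, 0 <= B & forall h : R, `|h| <= 1 -> `|q.[h]| <= B.
Proof.
elim/poly_ind: q => [|q c [B B0 H]]; first by exists 0 => // h _; rewrite horner0 normr0.
exists (B + `|c|) => [|h h1]; first by rewrite addr_ge0.
rewrite hornerMXaddC (le_trans (ler_normD _ _))// lerD2r normrM.
by rewrite -[leRHS]mulr1 ler_pM// H.
Qed.

Definition antideriv q : {poly R} :=
  \poly_(i < (size q).+1) (if i is j.+1 then q`_j / j.+1%:R else 0).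

Lemma antiderivK q : (antideriv q)^`() = q.
Proof.
apply/polyP => i; rewrite coef_deriv coef_poly ltnS.
have [iq|iq] := ltnP i (size q); last by rewrite mul0rn nth_default.
by rewrite /= -[LHS]mulr_natr divfK// pnatr_eq0.
Qed.

Lemma antideriv0 q : (antideriv q).[0] = 0.
Proof. by rewrite horner_coef0 coef_poly. Qed.

(** The mean value theorem for [f] minus the primitive of [q] gains one power of [|h|], at the same
    constant and radius. *)
Lemma taylor_antideriv N f df q C d : 0 <= C -> (forall x, is_derive x (1 : R) f (df x)) ->
  taylor_bound N df q C d ->
  taylor_bound N.+1 f ((f 0)%:P + antideriv q) C d.
Proof.
move=> C0 fE H h hd.
have D x : is_derive x (1 : R) (fun x => f x - (antideriv q).[x]) (df x - q.[x]).
  have Dq : is_derive x (1 : R) (horner (antideriv q)) q.[x].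
    by rewrite -[in X in is_derive _ _ _ X](antiderivK q); exact: is_derive_poly.
  exact: is_deriveB.
have [c c0 E] := mean_value D 0 h.
have -> : f h - ((f 0)%:P + antideriv q).[h] = (df c - q.[c]) * h.
  rewrite hornerD hornerC; move: E; rewrite antideriv0 !subr0 => <-.
  ring.
have ch : `|c| <= `|h|.
  have [h0|h0] := leP 0 h.
    by move: c0; rewrite min_l// max_r// => /andP[c1 c2]; rewrite !ger0_norm.
  move: c0; rewrite (min_r (ltW h0)) (max_l (ltW h0)) => /andP[c1 c2].
  by rewrite ler0_norm// ltr0_norm// lerN2.
rewrite normrM exprSr mulrA ler_wpM2r//.
apply: le_trans (H _ (le_trans ch hd)) _.
by rewrite ler_wpM2l// lerXn2r// nnegrE.
Qed.

Lemma has_taylorS N f df : (forall x, is_derive x (1 : R) f (df x)) ->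
  has_taylor N df -> has_taylor N.+1 f.
Proof.
move=> D [q [C [d [d0 H]]]]; exists ((f 0)%:P + antideriv q), `|C|, d; split => //.
apply: taylor_antideriv => // h hd; apply: le_trans (H _ hd) _.
by rewrite ler_wpM2r ?ler_norm// exprn_ge0.
Qed.

Lemma has_taylor0 f C : (forall h, `|h| <= 1 -> `|f h| <= C) -> has_taylor 0 f.
Proof.
move=> H; exists 0, C, 1; rewrite ltr01 lexx; split => // h h1.
by rewrite horner0 subr0 expr0 mulr1 H.
Qed.

Lemma has_taylorM N f g : has_taylor N f -> has_taylor N g ->
  has_taylor N (fun x => f x * g x).
Proof.
move=> [p [C [d [/andP[d0 d1] Hf]]]] [q [D [e [/andP[e0 e1] Hg]]]].
have [Bp Bp0 HBp] := poly_bounded p; have [Bq Bq0 HBq] := poly_bounded q.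
exists (p * q), (`|C| * (Bq + `|D|) + Bp * `|D|), (Num.min d e); split.
  by rewrite lt_min d0 e0 ge_min d1.
move=> h; rewrite le_min => /andP[hd he]; rewrite hornerM.
have h1 : `|h| <= 1 by exact: le_trans d1.
have -> : f h * g h - p.[h] * q.[h] = (f h - p.[h]) * g h + p.[h] * (g h - q.[h]) by ring.
apply: le_trans (ler_normD _ _) _; rewrite !normrM mulrDl.
have hN : 0 <= `|h| ^+ N <= 1 by rewrite exprn_ge0// exprn_ile1.
have /andP[hN0 hN1] := hN.
have Hf' : `|f h - p.[h]| <= `|C| * `|h| ^+ N.
  by apply: le_trans (Hf _ hd) _; rewrite ler_wpM2r ?ler_norm.
have Hg' : `|g h - q.[h]| <= `|D| * `|h| ^+ N.
  by apply: le_trans (Hg _ he) _; rewrite ler_wpM2r ?ler_norm.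
have gB : `|g h| <= Bq + `|D|.
  rewrite -[g h](subrK q.[h]) addrC (le_trans (ler_normD _ _))// lerD ?HBq//.
  by apply: le_trans Hg' _; rewrite -[leRHS]mulr1 ler_wpM2l.
apply: lerD.
  by rewrite mulrAC ler_pM.
by rewrite -mulrA ler_pM// HBp.
Qed.

Lemma has_taylorN N f : has_taylor N f -> has_taylor N (fun x => - f x).
Proof.
move=> [q [C [d [d0 H]]]]; exists (- q), C, d; split => // h hd.
by rewrite hornerN -opprD normrN; exact: H.
Qed.

Lemma has_taylor_scale N f b : 0 < b -> has_taylor N f -> has_taylor N (fun x => f (b * x)).
Proof.
move=> b0 [q [C [d [/andP[d0 d1] H]]]].
exists (q \Po (b *: 'X)), (C * b ^+ N), (Num.min 1 (d / b)); split.
  by rewrite lt_min ltr01 divr_gt0//= ge_min lexx.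
move=> h; rewrite le_min => /andP[h1 hd].
rewrite horner_comp hornerZ hornerX.
have bh : `|b * h| = b * `|h| by rewrite normrM gtr0_norm.
have := H (b * h); rewrite bh mulrC -ler_pdivlMr// => /(_ hd).
by rewrite exprMn mulrA mulrAC.
Qed.

(** Comparison of coefficients: once ['X^N] is divided out, the quotient is still O(h), so its value
    at 0 vanishes and another factor ['X] splits off. *)
Lemma poly_small N q (C d : R) : 0 < d ->
  (forall h, `|h| <= d -> `|q.[h]| <= C * `|h| ^+ N) -> exists p, q = p * 'X^N.
Proof.
move=> d0 H.
elim: N C H => [|N IH] C H; first by exists q; rewrite expr0 mulr1.
have [h hd|p pE] := IH (`|C| * d).
  apply: le_trans (H h hd) _; rewrite exprS mulrA ler_wpM2r ?exprn_ge0//.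
  by apply: (@le_trans _ _ (`|C| * `|h|)); rewrite ?ler_wpM2r ?ler_norm// ler_wpM2l.
have pH h : `|h| <= d -> h != 0 -> `|p.[h]| <= `|C| * `|h|.
  move=> hd h0; have := H h hd; rewrite pE hornerM hornerXn normrM normrX exprS mulrA.
  rewrite ler_pM2r ?exprn_gt0 ?normr_gt0// => /le_trans; apply.
  by rewrite ler_wpM2r// ler_norm.
suff p0 : p.[0] = 0.
  have /factor_theorem[p2 p2E] : root p 0 by rewrite rootE p0.
  by exists p2; rewrite pE p2E subr0 -mulrA -exprS.
have [p2 p2E] : exists p2, p - (p.[0])%:P = p2 * 'X.
  have /factor_theorem[p2 p2E] : root (p - (p.[0])%:P) 0.
    by rewrite rootE hornerD hornerN hornerC subrr.
  by exists p2; rewrite p2E subr0.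
have [B B0 HB] := poly_bounded p2.
have small h : 0 < h -> h <= d -> h <= 1 -> `|p.[0]| <= (`|C| + B) * h.
  move=> h0 hd h1; have hE : `|h| = h by rewrite gtr0_norm.
  have -> : p.[0] = p.[h] - p2.[h] * h.
    have := congr1 (horner^~ h) p2E; rewrite /= hornerD hornerN hornerC hornerM hornerX => <-.
    by rewrite subKr.
  apply: le_trans (ler_normB _ _) _; rewrite mulrDl normrM hE; apply: lerD.
    by rewrite -[X in _ * X]hE pH ?hE// gt_eqF.
  by apply: ler_wpM2r; [exact: ltW|apply: HB; rewrite hE].
apply/eqP; rewrite -normr_le0; apply/ler_addgt0Pr => e e0; rewrite add0r.
(* Small enough for both estimates to be valid and for [(|C| + B) * h] to stay below [e]. *)
pose h := Num.min (Num.min d 1) (e / (`|C| + B + 1)).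
have CB : 0 < `|C| + B + 1 by rewrite ltr_wpDl// addr_ge0.
have h0 : 0 < h by rewrite !lt_min d0 ltr01 divr_gt0.
have hd : h <= d by rewrite /h !ge_min lexx.
have h1 : h <= 1 by rewrite /h !ge_min lexx orbT.
have he : h * (`|C| + B + 1) <= e by rewrite -ler_pdivlMr// /h ge_min lexx orbT.
apply: le_trans (small h h0 hd h1) _; apply: le_trans he.
by rewrite mulrC; apply: ler_wpM2l; [exact: ltW|rewrite lerDl].
Qed.

End taylor_class.

(** * Moments of the exponentially tilted spin law *)

Section tilted_moments.
Context {R : realType}.
Local Notation TR := (measurableTypeR R).
Variable rho : probability TR R.
Hypothesis rhoB : classB rho.
Implicit Types (h s x : R).
Local Notation M := (emom rho).

Definition emom_inv h := (M 0 h)^-1.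
(** This is phi', and [tsquare h - tmean h ^+ 2], the variance of the tilted law, is phi''. *)
Definition tmean h := M 1 h / M 0 h.
Definition tsquare h := M 2 h / M 0 h.

Lemma emom0_gt0 h : 0 < M 0 h.
Proof. exact: lt_le_trans ltr01 (emom0_ge1 rhoB h). Qed.

Lemma is_derive_emom_inv h :
  is_derive h (1 : R) emom_inv (- (M 1 h * (emom_inv h * emom_inv h))).
Proof.
have D := is_derive_emom rhoB 0 h.
have n0 : M 0 h != 0 by rewrite gt_eqF ?emom0_gt0.
apply: (is_derive_eq (is_deriveV n0 D)).
by rewrite /emom_inv /GRing.scale/= -exprVn; ring.
Qed.

Lemma is_derive_phi h : is_derive h (1 : R) (phi rho) (tmean h).
Proof.
have D := is_derive_emom rhoB 0 h.
have -> : phi rho = (@ln R) \o (M 0).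
  apply/funext => s; rewrite /phi /= /emom; congr ln.
  by apply: eq_Rintegral => x _; rewrite expr0 mul1r.
apply: (is_derive_eq (is_derive1_comp (is_derive1_ln (emom0_gt0 h)) D)).
by rewrite mulrC.
Qed.

Lemma is_derive_tmean h : is_derive h (1 : R) tmean (tsquare h - tmean h ^+ 2).
Proof.
have D1 := is_derive_emom rhoB 1 h; have Di := is_derive_emom_inv h.
apply: is_derive_eq.
by rewrite /tsquare /tmean /emom_inv /GRing.scale/=; ring.
Qed.

Lemma derivable_tvar h : derivable (fun h => tsquare h - tmean h ^+ 2) h 1.
Proof.
have D2 := is_derive_emom rhoB 2 h; have Di := is_derive_emom_inv h.
have D1 := is_derive_tmean h.
have D3 : is_derive h (1 : R) tsquare
    (M 2 h *: (- (M 1 h * (emom_inv h * emom_inv h))) + emom_inv h *: M 3 h) by exact: is_deriveM.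
by have [D4 _] := is_deriveB D3 (is_deriveX 1 D1).
Qed.

Lemma emom_bounded p : exists C, forall h, `|h| <= 1 -> `|M p h| <= C.
Proof.
exists (\int[rho]_x (`|x : R| ^+ p * expR (1 * x) + `|x : R| ^+ p * expR (- 1 * x))) => h h1.
have i0 := integrable_emom rhoB p h.
have i3 := integrable_normX_emom rhoB p 1; have i4 := integrable_normX_emom rhoB p (- 1).
apply: le_trans (le_normr_Rintegral _ i0) _ => //.
apply: le_Rintegral => //; first exact: integrable_norm i0.
  exact: (integrable_add measurableT i3 i4).
move=> x _ /=; rewrite normrM normrX (ger0_norm (expR_ge0 _)) -mulrDr ler_wpM2l ?exprn_ge0//.
have hx : h * x <= `|x|.
  by rewrite (le_trans (ler_norm _))// normrM -[leRHS]mul1r ler_wpM2r.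
have [x0|x0] := leP 0 x.
  apply: (@le_trans _ _ (expR (1 * x))); last by rewrite lerDl expR_ge0.
  by rewrite ler_expR mul1r -{2}(ger0_norm x0).
apply: (@le_trans _ _ (expR (- 1 * x))); last by rewrite lerDr expR_ge0.
by rewrite ler_expR mulN1r -(ltr0_norm x0).
Qed.

Lemma has_taylor_emom N p : has_taylor N (M p).
Proof.
elim: N p => [|N IH] p; last by apply: has_taylorS (IH p.+1) => h; exact: is_derive_emom.
by have [C H] := emom_bounded p; exact: has_taylor0 H.
Qed.

Lemma has_taylor_emom_inv N : has_taylor N emom_inv.
Proof.
elim: N => [|N IH].
  apply: (@has_taylor0 _ _ 1) => h _.
  rewrite ger0_norm ?invr_ge0 ?(ltW (emom0_gt0 _))// invf_le1 ?emom0_gt0//.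
  exact: emom0_ge1.
apply: has_taylorS is_derive_emom_inv _; apply: has_taylorN.
by apply: has_taylorM; [exact: has_taylor_emom|exact: has_taylorM].
Qed.

Lemma has_taylor_tmean N : has_taylor N tmean.
Proof. exact: has_taylorM (has_taylor_emom _ _) (has_taylor_emom_inv _). Qed.

Lemma has_taylor_tsquare N : has_taylor N tsquare.
Proof. exact: has_taylorM (has_taylor_emom _ _) (has_taylor_emom_inv _). Qed.

Lemma tmeanN h : tmean (- h) = - tmean h.
Proof. by rewrite /tmean !emomN// expr1 expr0 mul1r mulN1r mulNr. Qed.

Lemma tsquareN h : tsquare (- h) = tsquare h.
Proof. by rewrite /tsquare !emomN// sqrrN expr1n expr0 !mul1r. Qed.

Definition tilt h (f : TR -> R) := (\int[rho]_x (f x * expR (h * x))) / M 0 h.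

Lemma integrable_normX_exp_square p :
  rho.-integrable setT (EFin \o (fun x : TR => `|x : R| ^+ p * expR ((x : R) ^+ 2))).
Proof.
have me (b : R) : measurable_fun setT (fun x : TR => expR (b * (x : R) ^+ 2)).
  by apply: measurableT_comp => //; apply: measurable_funM => //; exact: measurable_funX.
have bi : rho.-integrable setT (EFin \o (fun x : TR => expR (p.+1%:R * (x : R) ^+ 2))).
  apply/integrableP; split; first exact/measurable_EFinP.
  under eq_integral do rewrite /= ger0_norm ?expR_ge0//.
  by apply: exp_square_fin => //; rewrite ltr0n.
apply: le_integrable (integrable_scale measurableT (expR p%:R) bi) => //.
  apply/measurable_EFinP; apply: measurable_funM.
    by apply: measurable_funX; exact: normr_measurable.
  by have := me 1; under boolp.eq_fun do rewrite mul1r.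
move=> x _; rewrite /= lee_fin normrM normrX normr_id.
rewrite (ger0_norm (expR_ge0 _)) [leRHS]ger0_norm ?mulr_ge0 ?expR_ge0//.
have x1 : `|x| <= 1 + x ^+ 2.
  rewrite -(real_normK (num_real _)); set z := `|_|.
  have := sqr_ge0 (z - 1); rewrite sqrrB; have : 0 <= z by exact: normr_ge0.
  lra.
have -> : expR p%:R * expR (p.+1%:R * x ^+ 2) = expR (p%:R * (1 + x ^+ 2)) * expR (x ^+ 2).
  by rewrite -!expRD -natr1; congr expR; ring.
rewrite ler_wpM2r ?expR_ge0// expRM_natl; apply: lerXn2r; rewrite ?nnegrE ?expR_ge0//.
by apply: le_trans x1 _; rewrite (le_trans _ (expR_ge1Dx _))// lerDr.
Qed.

Definition abs_square_moment p := \int[rho]_x (`|x : R| ^+ p * expR ((x : R) ^+ 2)).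

(** Where [|x| <= |h|] the power is at most [|h| ^+ p]; elsewhere [h * x <= x ^+ 2], so the weight
    is bounded independently of [h]. Dividing by [M 0 h >= 1] does no harm. *)
Lemma tilt_normX_le p h :
  tilt h (fun x => `|x : R| ^+ p) <= `|h| ^+ p + abs_square_moment p.
Proof.
rewrite /tilt ler_pdivrMr ?emom0_gt0//.
have i1 := integrable_normX_emom rhoB p h.
have i2 := integrable_normX_exp_square p.
have i3 := integrable_scale measurableT (`|h| ^+ p) (integrable_emom rhoB 0 h).
apply: (@le_trans _ _ (\int[rho]_x (`|h| ^+ p * (x ^+ 0 * expR (h * x)) +
    `|x : R| ^+ p * expR ((x : R) ^+ 2)))).
  apply: le_Rintegral => //; first exact: (integrable_add measurableT i3 i2).
  move=> x _ /=; rewrite expr0 mul1r.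
  have [xh|hx] := leP `|x| `|h|.
    apply: (@le_trans _ _ (`|h| ^+ p * expR (h * x))).
      by rewrite ler_wpM2r ?expR_ge0// lerXn2r// nnegrE.
    by rewrite lerDl mulr_ge0 ?expR_ge0 ?exprn_ge0.
  apply: (@le_trans _ _ (`|x| ^+ p * expR (x ^+ 2))).
    rewrite ler_wpM2l ?exprn_ge0// ler_expR (le_trans (ler_norm _))// normrM.
    by rewrite -[x ^+ 2]real_normK ?num_real// expr2 ler_wpM2r// ltW.
  by rewrite lerDr mulr_ge0 ?expR_ge0 ?exprn_ge0.
rewrite RintegralD// RintegralZl//; last exact: integrable_emom.
rewrite -/(M 0 h) mulrDl lerD2l -[leLHS]mulr1 ler_wpM2l ?emom0_ge1//.
by apply: Rintegral_ge0 => x _; rewrite mulr_ge0 ?expR_ge0 ?exprn_ge0.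
Qed.

Lemma emom1_0 : M 1 0 = 0.
Proof. by have := emomN rhoB 1 0; rewrite oppr0 expr1 mulN1r => E; lra. Qed.

(** Pointwise [u <= u * expR u] for [u = h * x], and the left-hand side integrates to zero. *)
Lemma tmean_ge0 h : 0 <= h * tmean h.
Proof.
rewrite /tmean mulrA divr_ge0 ?(ltW (emom0_gt0 _))//.
have i1 := integrable_emom rhoB 1 h; have i0 := integrable_emom rhoB 1 0.
rewrite -(mulr0 h) -{1}emom1_0 /emom -!RintegralZl//.
apply: le_Rintegral => //; [exact: integrable_scale|exact: integrable_scale|].
move=> x _; rewrite !expr1 mul0r expR0 mulr1 mulrA.
have := expR_ge1Dx (h * x); have := expR_ge1Dx (- (h * x)).
have := expR_gt0 (h * x); have : expR (h * x) * expR (- (h * x)) = 1 by rewrite expRxMexpNx_1.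
by nra.
Qed.

(** Monotonicity of cosh on the positive half-line: for a <= b the difference factors as (e^b -
    e^a)(1 - e^(-a-b)). *)
Lemma expR_even_le (u v : R) : `|u| <= `|v| -> expR u + expR (- u) <= expR v + expR (- v).
Proof.
have E (w : R) : expR w + expR (- w) = expR `|w| + expR (- `|w|).
  by have [w0|w0] := leP 0 w; [rewrite ger0_norm|rewrite ltr0_norm// opprK addrC].
rewrite (E u) (E v) => uv; set a := `|u| in uv *; set b := `|v| in uv *.
have a0 : 0 <= a by exact: normr_ge0.
have ea : expR a * expR (- a) = 1 by rewrite expRxMexpNx_1.
have eb : expR b * expR (- b) = 1 by rewrite expRxMexpNx_1.
have ab : expR a <= expR b by rewrite ler_expR.
have bb : expR (- b) <= 1 by rewrite -expR0 ler_expR; lra.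
have aa : expR (- a) <= 1 by rewrite -expR0 ler_expR; lra.
have : expR b - expR a + (expR (- b) - expR (- a)) =
  (expR b - expR a) * (1 - expR (- a) * expR (- b)).
  have -> : (expR b - expR a) * (1 - expR (- a) * expR (- b)) =
    expR b - expR a - (expR b * expR (- b)) * expR (- a) + (expR a * expR (- a)) * expR (- b) by ring.
  by rewrite ea eb; ring.
have : 0 <= (expR b - expR a) * (1 - expR (- a) * expR (- b)).
  rewrite mulr_ge0 ?subr_ge0//; have := expR_ge0 (- a); have := expR_ge0 (- b); nra.
lra.
Qed.

Hypothesis var1 : M 2 0 = 1.

Lemma emom0_0 : M 0 0 = 1.
Proof.
rewrite /emom; under eq_Rintegral do rewrite mul0r expR0 expr0 mulr1.
by rewrite Rintegral_cst// [X in fine X]probability_setT mulr1.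
Qed.

(* By symmetry [expR (h * x)] may be replaced by [cosh (h * x)], which is at least [cosh h] if
   and only if [x ^+ 2] is at least 1. *)
Lemma tsquare_ge1 h : 1 <= tsquare h.
Proof.
rewrite /tsquare ler_pdivlMr ?emom0_gt0// mul1r.
pose D (t : R) := (fun x : TR => x ^+ 2 * expR (t * x) - x ^+ 0 * expR (t * x)).
have iD t : rho.-integrable setT (EFin \o D t).
  by apply: integrable_sub => //; exact: integrable_emom.
have ID t : \int[rho]_x D t x = M 2 t - M 0 t.
  by rewrite /D RintegralB//; exact: integrable_emom.
pose e := expR h + expR (- h).
have i1 : rho.-integrable setT (EFin \o (fun x => D h x + D (- h) x)) by exact: integrable_add.
have i2 : rho.-integrable setT (EFin \o (fun x => e * D 0 x)) by exact: integrable_scale.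
(* The subtracted term has integral zero because the variance is one; with it the integrand becomes
   2 (x^2 - 1)(cosh (h x) - cosh h), whose factors change sign together at |x| = 1. *)
have : 0 <= \int[rho]_x ((D h x + D (- h) x) - e * D 0 x).
  apply: Rintegral_ge0 => x _; rewrite /D !expr0 !mul0r !expR0 mulr1 !mul1r.
  have -> : x ^+ 2 * expR (h * x) - expR (h * x) + (x ^+ 2 * expR (- h * x) - expR (- h * x)) -
    e * (x ^+ 2 - 1) = (x ^+ 2 - 1) * (expR (h * x) + expR (- h * x) - e) by ring.
  rewrite /e mulNr; have [x1|x1] := leP `|x| 1.
    have : x ^+ 2 <= 1 by rewrite -[x ^+ 2]real_normK ?num_real// exprn_ile1.
    have : expR (h * x) + expR (- (h * x)) <= expR h + expR (- h).
      by apply: expR_even_le; rewrite normrM -[leRHS]mulr1 ler_wpM2l.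
    nra.
  have : 1 <= x ^+ 2 by rewrite -[x ^+ 2]real_normK ?num_real// exprn_ege1// ltW.
  have : expR h + expR (- h) <= expR (h * x) + expR (- (h * x)).
    by apply: expR_even_le; rewrite normrM -[leLHS]mulr1 ler_wpM2l// ltW.
  nra.
rewrite RintegralB// RintegralD// RintegralZl// !ID var1 emom0_0 subrr mulr0 subr0.
rewrite !emomN// sqrrN expr1n expr0 !mul1r; lra.
Qed.

Lemma tmean0 : tmean 0 = 0.
Proof. by rewrite /tmean emom1_0 mul0r. Qed.

Lemma tmean_le h : `|tmean h| <= `|h| + abs_square_moment 1.
Proof.
rewrite -[X in _ <= X + _]expr1; apply: le_trans _ (tilt_normX_le 1 h).
have i1 := integrable_emom rhoB 1 h.
rewrite /tmean /tilt normrM normfV (gtr0_norm (emom0_gt0 _)).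
rewrite ler_pM2r ?invr_gt0 ?emom0_gt0//.
apply: le_trans (le_normr_Rintegral _ i1) _ => //.
apply: le_Rintegral => //; [exact: integrable_norm i1|exact: integrable_normX_emom|].
by move=> x _ /=; rewrite normrM normrX (ger0_norm (expR_ge0 _)).
Qed.

Lemma abs_square_moment_ge0 p : 0 <= abs_square_moment p.
Proof. by apply: Rintegral_ge0 => x _; rewrite mulr_ge0 ?expR_ge0 ?exprn_ge0. Qed.

Lemma tsquare_le h : tsquare h <= h ^+ 2 + abs_square_moment 2.
Proof.
rewrite -[h ^+ 2]real_normK ?num_real//; apply: le_trans _ (tilt_normX_le 2 h).
rewrite /tsquare /tilt /emom le_eqVlt; apply/orP; left; apply/eqP; congr (_ / _).
by apply: eq_Rintegral => x _; rewrite real_normK ?num_real.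
Qed.

(* Far from the origin a power of [`|s| / d] dominates every constant, so that a local
   bound and a global one of lower order combine into a global one. *)
Lemma bound_globalize (f : R -> R) (a b C d : R) m N : 0 < d <= 1 -> (m <= N)%N ->
  0 <= a -> 0 <= b -> (forall s, `|f s| <= a + b * `|s| ^+ m) ->
  (forall s, `|s| <= d -> `|f s| <= C * `|s| ^+ N) ->
  exists2 K, 0 <= K & forall s, `|f s| <= K * `|s| ^+ N.
Proof.
move=> /andP[d0 d1] mN a0 b0 glob loc; exists (`|C| + (a + b) / d ^+ N).
  by rewrite addr_ge0// divr_ge0 ?addr_ge0// exprn_ge0// ltW.
move=> s; have [sd|ds] := leP `|s| d.
  apply: le_trans (loc s sd) _; rewrite ler_wpM2r ?exprn_ge0//.
  by rewrite (le_trans (ler_norm _))// lerDl divr_ge0 ?addr_ge0// exprn_ge0// ltW.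
apply: (le_trans (glob s)).
apply: (@le_trans _ _ ((a + b) / d ^+ N * `|s| ^+ N)); last first.
  by rewrite ler_wpM2r ?exprn_ge0// lerDr.
rewrite -mulrA [_^-1 * _]mulrC -expr_div_n.
set t := `|s| / d; have t1 : 1 <= t by rewrite ler_pdivlMr// mul1r ltW.
have st : `|s| <= t by rewrite ler_pdivlMr// -[leRHS]mulr1 ler_wpM2l.
rewrite mulrDl; apply: lerD.
  by rewrite -[leLHS]mulr1 ler_wpM2l// exprn_ege1.
rewrite ler_wpM2l//; apply: (@le_trans _ _ (t ^+ m)); last exact: ler_weXn2l.
by apply: lerXn2r; rewrite ?nnegrE// (le_trans ler01).
Qed.

(** The Taylor polynomial has no constant term because [tmean 0 = 0]; far from the origin [tmean_le]
    takes over. *)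
Lemma tmean_linear : exists2 C, 0 <= C & forall h, `|tmean h| <= C * `|h|.
Proof.
have [q [C [d [d01 H]]]] := has_taylor_tmean 1.
have /andP[d0 d1] := d01.
have [B B0 HB] := poly_bounded q.
have q0 : q.[0] = 0.
  have := H 0; rewrite normr0 expr1 mulr0 tmean0 sub0r normrN => /(_ (ltW d0)).
  by rewrite normr_le0 => /eqP.
have /factor_theorem[p pE] : root q 0 by rewrite rootE q0.
have [B' B'0 HB'] := poly_bounded p.
have [||K K0 HK] := @bound_globalize tmean (abs_square_moment 1) 1 (`|C| + B') d 1 1 d01
  (leqnn _) (abs_square_moment_ge0 1) ler01.
- by move=> s; rewrite mul1r expr1 addrC tmean_le.
- move=> s sd; rewrite expr1 -[tmean s](subrK q.[s]) mulrDl.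
  apply: le_trans (ler_normD _ _) _; apply: lerD.
    by apply: le_trans (H s sd) _; rewrite expr1 ler_wpM2r ?ler_norm.
  rewrite pE hornerM hornerD hornerN hornerX hornerC subr0 normrM ler_wpM2r// HB'//.
  exact: le_trans d1.
by exists K => // s; rewrite -[X in _ * X]expr1.
Qed.

(** The linear term cancels. This lets the evenness of [tsquare] act on its Taylor polynomial
    without any statement about individual coefficients. *)
Lemma poly_even_part (q : {poly R}) : exists2 B : R, 0 <= B &
  forall h, `|h| <= 1 -> `|q.[h] + q.[- h] - 2 * q.[0]| <= B * h ^+ 2.
Proof.
have /factor_theorem[p pE] : root (q - (q.[0])%:P) 0.
  by rewrite rootE hornerD hornerN hornerC subrr.
have /factor_theorem[r rE] : root (p - (p.[0])%:P) 0.
  by rewrite rootE hornerD hornerN hornerC subrr.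
have [B B0 HB] := poly_bounded r.
have qh h : q.[h] = q.[0] + (p.[0] + r.[h] * h) * h.
  have e1 := congr1 (horner^~ h) pE; have e2 := congr1 (horner^~ h) rE.
  rewrite /= !(hornerM, hornerD, hornerN, hornerX, hornerC) subr0 in e1 e2.
  by rewrite -e2 [X in X * h]addrC subrK -e1 addrC subrK.
exists (B + B); first by rewrite addr_ge0.
move=> h h1; rewrite (qh h) (qh (- h)).
have -> : q.[0] + (p.[0] + r.[h] * h) * h + (q.[0] + (p.[0] + r.[- h] * - h) * - h) - 2 * q.[0] =
  (r.[h] + r.[- h]) * h ^+ 2 by ring.
rewrite normrM [X in _ * X]ger0_norm ?sqr_ge0// ler_wpM2r ?sqr_ge0//.
by rewrite (le_trans (ler_normD _ _))// lerD// HB ?normrN.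
Qed.

Lemma tsquare0 : tsquare 0 = 1.
Proof. by rewrite /tsquare var1 emom0_0 divr1. Qed.

Lemma tsquare_near1 : exists2 C, 0 <= C & forall h, `|tsquare h - 1| <= C * h ^+ 2.
Proof.
have [q [C [d [d01 H]]]] := has_taylor_tsquare 2.
have /andP[d0 d1] := d01.
have [B B0 HB] := poly_even_part q.
have q0 : q.[0] = 1.
  have := H 0; rewrite normr0 expr0n/= mulr0 tsquare0 => /(_ (ltW d0)).
  by rewrite normr_le0 subr_eq0 => /eqP.
have [||K K0 HK] := @bound_globalize (fun h => tsquare h - 1)
  (1 + abs_square_moment 2) 1 (`|C| + B) d 2 2 d01 (leqnn _)
  (addr_ge0 ler01 (abs_square_moment_ge0 2)) ler01.
- move=> s; rewrite mul1r real_normK ?num_real// ger0_norm ?subr_ge0 ?tsquare_ge1//.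
  by have := tsquare_le s; have := abs_square_moment_ge0 2; lra.
- move=> s sd.
  have H1 := H s sd; have H2 := H (- s); rewrite normrN in H2; have {}H2 := H2 sd.
  have := HB s (le_trans sd d1); rewrite q0 tsquareN in H2 * => H3.
  have s2 : `|s| ^+ 2 = s ^+ 2 by rewrite real_normK ?num_real.
  rewrite s2 in H1 H2 *.
  have C1 : C * s ^+ 2 <= `|C| * s ^+ 2 by rewrite ler_wpM2r ?sqr_ge0 ?ler_norm.
  move: H1 H2 H3; rewrite !ler_norml; lra.
by exists K => // s; rewrite -[s ^+ 2]real_normK ?num_real.
Qed.

End tilted_moments.

(** * The drift of the Curie-Weiss law *)

Section critical_expansion.
Context {R : realType}.
Local Notation TR := (measurableTypeR R).
Variables (rho : probability TR R) (beta : R) (k : nat) (mu : R).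
Hypothesis rhoGHS : GHS rho.
Hypothesis var1 : emom rho 2 0 = 1.
Hypothesis beta_gt0 : 0 < beta.
Hypothesis type0 : has_type_strength (G rho beta) 0 k mu.
Implicit Types (h s x : R).

Let rhoB : classB rho := rhoGHS.1.
Local Notation m1 := (tmean rho).

Definition drift s := s - m1 (beta * s).

(** The constant c of the overview, equal to mu / (beta (2k-1)!): the term mu s^(2k) / (2k)! of [G]
    is differentiated and divided by [beta], as [G] has derivative [beta * drift]. *)
Definition drift_coef := mu * (2 * k)%:R / ((2 * k)`!)%:R / beta.

Lemma driftN s : drift (- s) = - drift s.
Proof. by rewrite /drift mulrN tmeanN// opprD opprK. Qed.

Lemma drift_coef_gt0 : 0 < drift_coef.
Proof.
case: type0 => k1 mu0 _; rewrite /drift_coef !divr_gt0// ?mulr_gt0// ltr0n ?fact_gt0//.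
by rewrite muln_gt0.
Qed.

Lemma is_derive_G s : is_derive s (1 : R) (G rho beta) (beta * drift s).
Proof.
have D := is_derive_phi rhoB (beta * s).
have Ds : is_derive s (1 : R) (fun s : R => beta * s) beta.
  by apply: is_derive_eq; rewrite /GRing.scale/= mulr1.
have Dc := is_derive1_comp D Ds.
have Dq : is_derive s (1 : R) (fun s : R => beta * s ^+ 2 / 2) (beta * s).
  by apply: is_derive_eq; rewrite /GRing.scale/=; field.
apply: (is_derive_eq (is_deriveB Dq Dc)).
by rewrite /drift mulrBr [beta * tmean _ _]mulrC.
Qed.

Lemma poly_odd_part (q : {poly R}) : exists2 B : R, 0 <= B &
  forall h, `|h| <= 1 -> `|q.[h] - q.[- h]| <= B * `|h|.
Proof.
have /factor_theorem[p pE] : root (q - (q.[0])%:P) 0.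
  by rewrite rootE hornerD hornerN hornerC subrr.
have [B B0 HB] := poly_bounded p.
have qh h : q.[h] = q.[0] + p.[h] * h.
  have e1 := congr1 (horner^~ h) pE.
  rewrite /= !(hornerM, hornerD, hornerN, hornerX, hornerC) subr0 in e1.
  by rewrite -e1 addrC subrK.
exists (B + B); first by rewrite addr_ge0.
move=> h h1; rewrite (qh h) (qh (- h)).
have -> : q.[0] + p.[h] * h - (q.[0] + p.[- h] * - h) = (p.[h] + p.[- h]) * h by ring.
rewrite normrM ler_wpM2r//.
by rewrite (le_trans (ler_normD _ _))// lerD// HB ?normrN.
Qed.

Lemma G_expansion : exists C d, 0 < d /\ forall s, `|s| <= d ->
  `|G rho beta s - (G rho beta 0 + mu * s ^+ (2 * k) / ((2 * k)`!)%:R)| <= C * `|s| ^+ (2 * k).+1.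
Proof.
case: type0 => _ _ /eqO_exP[C /= C0 H].
have {H} : \forall x \near (0 : R),
    `|G rho beta x - (G rho beta 0 + mu * (x - 0) ^+ (2 * k) / ((2 * k)`!)%:R)| <=
    C * `|(x - 0) ^+ (2 * k).+1| by exact: H.
move=> /nbhs_normP[e /= e0 He]; exists C, (e / 2); split; first by rewrite divr_gt0.
move=> s se; have := He s; rewrite /= sub0r normrN => /(_ _).
rewrite !subr0 normrX; apply; apply: le_lt_trans se _.
by rewrite ltr_pdivrMr// ltr_pMr// ltr1n.
Qed.

(** The expansion of [G] cannot be differentiated, but the Taylor polynomial of [drift] can be
    integrated. The two resulting polynomials for [G] differ by a multiple of X^(2k+1), and the
    derivative of that multiple is the error [w * 'X^(2 * k)]. *)
Lemma drift_poly : exists (q w : {poly R}) C d, [/\ 0 < d <= 1,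
  forall s, `|s| <= d -> `|drift s - q.[s]| <= C * `|s| ^+ (2 * k).+1 &
  q = (drift_coef *: 'X^((2 * k).-1) + w * 'X^(2 * k))%R].
Proof.
have [q [C [d [d01 H]]]] := has_taylor_scale beta_gt0 (has_taylor_tmean rhoB (2 * k).+1).
have [C2 [e [e0 He]]] := G_expansion.
have /andP[d0 d1] := d01.
pose q1 := 'X - q.
have H1 s : `|s| <= d -> `|drift s - q1.[s]| <= C * `|s| ^+ (2 * k).+1.
  move=> sd; rewrite /drift /q1 hornerD hornerN hornerX.
  by rewrite -normrN; have := H s sd; congr (`|_| <= _); ring.
have H2 : taylor_bound (2 * k).+1 (fun s => beta * drift s) (beta *: q1) (beta * `|C|) d.
  move=> s sd; rewrite hornerZ -mulrBr normrM (gtr0_norm beta_gt0) -mulrA ler_wpM2l ?(ltW beta_gt0)//.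
  by apply: le_trans (H1 s sd) _; rewrite ler_wpM2r ?exprn_ge0// ler_norm.
have H3 := taylor_antideriv (mulr_ge0 (ltW beta_gt0) (normr_ge0 C)) is_derive_G H2.
(* Both terms approximate [G] minus its value at 0 up to O(s^(2k+1)), so [Q] itself is of that
   order. *)
pose Q := antideriv (beta *: q1) - (mu / ((2 * k)`!)%:R) *: 'X^(2 * k).
pose f := Num.min d e; have f0 : 0 < f by rewrite lt_min d0.
have HQ s : `|s| <= f -> `|Q.[s]| <= (beta * `|C| + `|C2|) * `|s| ^+ (2 * k).+1.
  rewrite le_min => /andP[sd se].
  have a1 := H3 s sd; have a2 := He s se.
  have -> : Q.[s] = - (G rho beta s - ((G rho beta 0)%:P + antideriv (beta *: q1)).[s])
    + (G rho beta s - (G rho beta 0 + mu * s ^+ (2 * k) / ((2 * k)`!)%:R)).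
    by rewrite /Q !(hornerD, hornerN, hornerZ, hornerXn, hornerC); ring.
  apply: le_trans (ler_normD _ _) _; rewrite normrN mulrDl; apply: lerD.
    apply: le_trans a1 _; rewrite exprS mulrA ler_wpM2r ?exprn_ge0//.
    by rewrite -[leRHS]mulr1 ler_wpM2l ?mulr_ge0 ?(ltW beta_gt0)// (le_trans sd).
  by apply: le_trans a2 _; rewrite ler_wpM2r ?exprn_ge0// ler_norm.
have [p pE] := poly_small f0 HQ.
exists q1, (beta^-1 *: (p^`() * 'X + (2 * k).+1%:R *: p)), C, d; split => //.
have := congr1 (@deriv R) pE.
rewrite derivB antiderivK derivZ derivXn derivM derivXn /= => E.
have bn : beta != 0 by rewrite gt_eqF.
have -> : q1 = beta^-1 *: (beta *: q1) by rewrite scalerA mulVf// scale1r.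
have -> : beta *: q1 = (mu / ((2 * k)`!)%:R) *: ('X^((2 * k).-1) *+ (2 * k)) +
   (p^`() * 'X^((2 * k).+1) + p * ('X^(2 * k) *+ (2 * k).+1)).
  by rewrite -E addrC subrK.
rewrite scalerDr -['X^_ *+ (2 * k)]scaler_nat !scalerA /drift_coef; congr (_ + _).
  by congr (_ *: _); field; rewrite bn pnatr_eq0 -lt0n fact_gt0.
rewrite -scalerAl; congr (_ *: _).
by rewrite mulrDl -mulrA -exprS -scalerAl -['X^_ *+ _]scaler_nat -scalerAr.
Qed.

(** Since [drift] is odd, averaging its values at s and -s replaces the term w(s) s^(2k) by its odd
    part, which is smaller by one power of s. This extra power turns an error of order eps into one
    of order eps^2. *)
Lemma drift_expansion : exists2 C, 0 <= C &
  forall s, `|drift s - drift_coef * s ^+ (2 * k).-1| <= C * `|s| ^+ (2 * k).+1.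
Proof.
have [q [w [C [d [d01 H qE]]]]] := drift_poly.
have /andP[d0 d1] := d01.
have [B B0 HB] := poly_odd_part w.
have [L L0 HL] := tmean_linear rhoB.
have k1 : (0 < k)%N by case: type0.
have k2 : ((2 * k).-1).+1 = (2 * k)%N by rewrite prednK// muln_gt0.
have c0 := ltW drift_coef_gt0.
have L1 : 0 <= 1 + L * beta by rewrite addr_ge0// mulr_ge0// ltW.
apply: (@bound_globalize _ (fun s => drift s - drift_coef * s ^+ (2 * k).-1)
  (1 + L * beta) (1 + L * beta + drift_coef) (`|C| + B) d (2 * k).-1 (2 * k).+1 d01) => //.
- by rewrite (leq_trans (leq_pred _)).
- by rewrite addr_ge0.
- move=> s.
  have a1 : `|drift s| <= (1 + L * beta) * `|s|.
    rewrite /drift (le_trans (ler_normB _ _))// mulrDl mul1r lerD2l.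
    by apply: le_trans (HL _) _; rewrite normrM (gtr0_norm beta_gt0) mulrA.
  have a2 : `|s| <= 1 + `|s| ^+ (2 * k).-1.
    have [s1|s1] := leP `|s| 1; first by rewrite (le_trans s1)// lerDl exprn_ge0.
    have : `|s| ^+ 1 <= `|s| ^+ (2 * k).-1.
      by apply: ler_weXn2l; [exact: ltW|rewrite -ltnS k2; case: (k) k1 => // ? _; rewrite mulnS].
    by rewrite expr1; lra.
  apply: le_trans (ler_normB _ _) _; rewrite normrM normrX (ger0_norm c0).
  have := ler_wpM2l L1 a2; lra.
move=> s sd; have s1 : `|s| <= 1 by exact: le_trans d1.
have a1 := H s sd; have a2 := H (- s); rewrite normrN driftN in a2; have {}a2 := a2 sd.
have a3 := HB s s1.
have -> : drift s - drift_coef * s ^+ (2 * k).-1 =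
   2^-1 * (drift s - q.[s]) - 2^-1 * (- drift s - q.[- s]) + 2^-1 * (s ^+ (2 * k) * (w.[s] - w.[- s])).
  rewrite qE !(hornerD, hornerZ, hornerM, hornerXn).
  have e1 : (- s) ^+ (2 * k) = s ^+ (2 * k) by rewrite !exprM sqrrN.
  have e2 : (- s) ^+ (2 * k).-1 = - s ^+ (2 * k).-1.
    by rewrite exprNn -signr_odd -[odd _]negbK -oddS k2 oddM/= expr1 mulN1r.
  by rewrite e1 e2; field.
have e3 : `|s ^+ (2 * k) * (w.[s] - w.[- s])| <= B * `|s| ^+ (2 * k).+1.
  by rewrite normrM normrX exprSr mulrCA ler_wpM2l ?exprn_ge0.
have e4 : C * `|s| ^+ (2 * k).+1 <= `|C| * `|s| ^+ (2 * k).+1.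
  by rewrite ler_wpM2r ?exprn_ge0// ler_norm.
move: a1 a2 e3; rewrite !ler_norml; lra.
Qed.

(** The GHS inequality itself: the variance of the tilted law is phi''. *)
Lemma tvar_nonincreasing x y : 0 <= x -> x <= y ->
  tsquare rho y - m1 y ^+ 2 <= tsquare rho x - m1 x ^+ 2.
Proof.
have d1 : derive1 (phi rho) = m1.
  by apply/funext => s; rewrite derive1E; have D := is_derive_phi rhoB s; exact: derive_val.
have d2 : derive1 m1 = (fun s => tsquare rho s - m1 s ^+ 2).
  by apply/funext => s; rewrite derive1E; have D := is_derive_tmean rhoB s; exact: derive_val.
have D3 s : derivable (fun s => tsquare rho s - m1 s ^+ 2) s 1.
  exact: derivable_tvar.
apply: (@ler0_derive1_nincry _ (fun s => tsquare rho s - m1 s ^+ 2) 0).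
- by move=> s _; exact: D3.
- move=> s; rewrite in_itv/= andbT => s0; rewrite -d2 -d1; exact: (rhoGHS.2 s (ltW s0)).
- apply: continuous_subspaceT => s; apply: differentiable_continuous.
  by apply/derivable1_diffP; exact: D3.
Qed.

(* By the GHS inequality [m1] is concave on the positive half-line, and it vanishes at 0. *)
Lemma tmean_slope x y : 0 < x -> x <= y -> x * m1 y <= y * m1 x.
Proof.
move=> x0 xy; have y0 := lt_le_trans x0 xy.
have [c1 c1P E1] := mean_value (is_derive_tmean rhoB) 0 x.
have [c2 c2P E2] := mean_value (is_derive_tmean rhoB) x y.
rewrite (min_l (ltW x0)) (max_r (ltW x0)) in c1P.
rewrite (min_l xy) (max_r xy) in c2P.
move: c1P c2P => /andP[c10 c1x] /andP[c2x c2y].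
have mono := tvar_nonincreasing c10 (le_trans c1x c2x).
rewrite tmean0// !subr0 in E1.
set v1 := tsquare rho c1 - _ in E1 mono; set v2 := tsquare rho c2 - _ in E2 mono.
have -> : m1 y = m1 x + v2 * (y - x) by rewrite -E2; ring.
have : 0 <= (v1 - v2) * (x * (y - x)) by rewrite mulr_ge0 ?subr_ge0// mulr_ge0 ?subr_ge0// ltW.
rewrite E1; nra.
Qed.

(** Near the origin this is the expansion. Further out GHS keeps [drift s / s] from decreasing,
    which gives only linear growth of [drift]; hence the minimum with [s ^+ 2]. *)
Lemma drift_lower : exists2 c, 0 < c &
  forall s, c * Num.min (s ^+ (2 * k)) (s ^+ 2) <= s * drift s.
Proof.
have [C C0 HC] := drift_expansion.
have c0 := drift_coef_gt0; set c := drift_coef in c0 HC *.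
have k1 : (0 < k)%N by case: type0.
have k2 : ((2 * k).-1).+1 = (2 * k)%N by rewrite prednK// muln_gt0.
(* Up to [d] the error C s^(2k+1) is at most half of the leading term c s^(2k-1), as s^2 <= d. *)
pose d := Num.min 1 (c / (2 * (C + 1))).
have C1 : 0 < 2 * (C + 1) by rewrite mulr_gt0// ltr_wpDl.
have d0 : 0 < d by rewrite lt_min ltr01 divr_gt0.
have d1 : d <= 1 by rewrite ge_min lexx.
have dc : C * d <= c / 2.
  have : d * (2 * (C + 1)) <= c by rewrite -ler_pdivlMr// ge_min lexx orbT.
  by lra.
have near s : 0 <= s -> s <= d -> c / 2 * s ^+ (2 * k).-1 <= drift s.
  move=> s0 sd; have := HC s; rewrite (ger0_norm s0) ler_norml => /andP[+ _].
  rewrite -k2 !exprS => H.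
  have sk : 0 <= s ^+ (2 * k).-1 by rewrite exprn_ge0.
  have : C * (s * (s * s ^+ (2 * k).-1)) <= c / 2 * s ^+ (2 * k).-1.
    rewrite !mulrA ler_wpM2r//; apply: le_trans dc.
    by rewrite -mulrA ler_wpM2l// (le_trans _ sd)// -[leRHS]mulr1 ler_wpM2l// (le_trans sd).
  lra.
have dk : 0 < d ^+ (2 * k).-1 by rewrite exprn_gt0.
have dk1 : d ^+ (2 * k).-1 <= 1 by rewrite exprn_ile1 ?(ltW d0).
have cd : 0 <= c / 2 * d ^+ (2 * k).-1 by rewrite ltW// mulr_gt0// divr_gt0.
have ch : 0 <= c / 2 by rewrite ltW// divr_gt0.
exists (c / 2 * d ^+ (2 * k).-1); first by rewrite mulr_gt0// divr_gt0.
have pos s : 0 <= s -> c / 2 * d ^+ (2 * k).-1 * Num.min (s ^+ (2 * k)) (s ^+ 2) <= s * drift s.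
  move=> s0; have [sd|ds] := leP s d.
    apply: (@le_trans _ _ (c / 2 * s ^+ (2 * k))).
      apply: (@le_trans _ _ (c / 2 * d ^+ (2 * k).-1 * s ^+ (2 * k))).
        by rewrite ler_wpM2l// ge_min lexx.
      by rewrite ler_wpM2r ?exprn_ge0// -[leRHS]mulr1 ler_wpM2l.
    by rewrite -{1}k2 exprS mulrCA ler_wpM2l// near.
  (* The slope [drift s / s] is at least its value at [d], where the local bound applies. *)
  have sl := tmean_slope (mulr_gt0 beta_gt0 d0) (ler_wpM2l (ltW beta_gt0) (ltW ds)).
  have sl2 : d * m1 (beta * s) <= s * m1 (beta * d).
    by rewrite -!mulrA ler_pM2l in sl.
  have nd := near d (ltW d0) (lexx d).
  have h1 : s * drift d <= d * drift s by rewrite /drift !mulrBr (mulrC s d); lra.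
  have h2 : s * (c / 2 * d ^+ (2 * k).-1) <= d * drift s.
    by apply: le_trans h1; rewrite ler_wpM2l.
  have h3 : 0 <= drift s.
    rewrite -(pmulr_rge0 _ d0); apply: le_trans h2.
    by rewrite mulr_ge0.
  have h4 : s * (c / 2 * d ^+ (2 * k).-1) <= drift s.
    by apply: le_trans h2 _; rewrite -[leRHS]mul1r ler_wpM2r.
  apply: (@le_trans _ _ (c / 2 * d ^+ (2 * k).-1 * s ^+ 2)).
    by rewrite ler_wpM2l// ge_min lexx orbT.
  by rewrite expr2 mulrA mulrC ler_wpM2l// mulrC.
move=> s; have [s0|s0] := leP 0 s; first exact: pos.
have := pos (- s); rewrite driftN mulrNN oppr_ge0 => /(_ (ltW s0)).
by rewrite sqrrN !exprM sqrrN.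
Qed.

End critical_expansion.

(** * Polynomial growth and tilted expectations *)

Section tilt_calculus.
Context {R : realType}.
Local Notation TR := (measurableTypeR R).
Variable rho : probability TR R.
Hypothesis rhoB : classB rho.

Definition poly_growth1 (f : TR -> R) := measurable_fun setT f /\
  exists C N, forall x : R, `|f x| <= C * (1 + `|x|) ^+ N.

Section closure.
Implicit Types F G : TR * TR -> R.

Lemma pg_cst c : poly_growth (fun=> c : R).
Proof.
by split; [exact: measurable_cst|exists `|c|, 0%N => x y; rewrite expr0 mulr1].
Qed.

Lemma pg_fst : poly_growth (fun z : TR * TR => z.1 : R).
Proof.
split; first exact: measurable_fst.
by exists 1, 1%N => x y; rewrite mul1r expr1 /= -addrA addrCA lerDl addr_ge0.
Qed.

Lemma pg_snd : poly_growth (fun z : TR * TR => z.2 : R).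
Proof.
split; first exact: measurable_snd.
by exists 1, 1%N => x y; rewrite mul1r expr1 /= lerDr addr_ge0.
Qed.

Lemma growth_weaken (C z : R) N M : 0 <= z -> (N <= M)%N ->
  C * (1 + z) ^+ N <= `|C| * (1 + z) ^+ M.
Proof.
move=> z0 NM; apply: (@le_trans _ _ (`|C| * (1 + z) ^+ N)).
  by rewrite ler_wpM2r ?ler_norm// exprn_ge0// addr_ge0.
by rewrite ler_wpM2l// ler_weXn2l// lerDl.
Qed.

Lemma pgD F G : poly_growth F -> poly_growth G -> poly_growth (fun z => F z + G z).
Proof.
move=> [mF [C [N HF]]] [mG [D [M HG]]]; split; first exact: measurable_funD.
exists (`|C| + `|D|), (N + M)%N => x y; apply: le_trans (ler_normD _ _) _.
have := HF x y; have := HG x y; rewrite -!addrA mulrDl => hG hF; apply: lerD.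
  by apply: le_trans hF _; apply: growth_weaken => //; exact: leq_addr.
by apply: le_trans hG _; apply: growth_weaken => //; exact: leq_addl.
Qed.

Lemma pgM F G : poly_growth F -> poly_growth G -> poly_growth (fun z => F z * G z).
Proof.
move=> [mF [C [N HF]]] [mG [D [M HG]]]; split; first exact: measurable_funM.
exists (C * D), (N + M)%N => x y; rewrite normrM.
by rewrite exprD mulrACA ler_pM.
Qed.

Lemma pgZ c F : poly_growth F -> poly_growth (fun z => c * F z).
Proof. by move=> HF; apply: pgM => //; exact: pg_cst. Qed.

Lemma pgN F : poly_growth F -> poly_growth (fun z => - F z).
Proof.
move=> [mF [C [N HF]]]; split; first exact: measurableT_comp.
by exists C, N => x y; rewrite normrN.
Qed.

Lemma pgB F G : poly_growth F -> poly_growth G -> poly_growth (fun z => F z - G z).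
Proof. by move=> HF HG; apply: pgD => //; exact: pgN. Qed.

Lemma pgX F p : poly_growth F -> poly_growth (fun z => F z ^+ p).
Proof.
move=> HF; elim: p => [|p IH].
  by under boolp.eq_fun do rewrite expr0; exact: pg_cst.
by under boolp.eq_fun do rewrite exprS; exact: pgM.
Qed.

Lemma pg_norm F : poly_growth F -> poly_growth (fun z => `|F z|).
Proof.
move=> [mF [C [N HF]]]; split; first exact: measurableT_comp.
by exists C, N => x y; rewrite normr_id.
Qed.

Lemma pg_comp (g : TR -> R) F : poly_growth1 g -> poly_growth F ->
  poly_growth (fun z => g (F z)).
Proof.
move=> [mg [D [M Hg]]] [mF [C [N HF]]]; split; first exact: measurableT_comp.
exists (`|D| * (1 + `|C|) ^+ M), (N * M)%N => x y; apply: le_trans (Hg _) _.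
apply: (@le_trans _ _ (`|D| * (1 + `|F (x, y)|) ^+ M)).
  by rewrite ler_wpM2r ?ler_norm// exprn_ge0// addr_ge0.
have z1 : 1 <= (1 + `|x| + `|y|) ^+ N by rewrite exprn_ege1// -addrA lerDl addr_ge0.
rewrite -mulrA ler_wpM2l// exprM -exprMn; apply: lerXn2r.
- by rewrite nnegrE addr_ge0.
- by rewrite nnegrE mulr_ge0 ?addr_ge0.
rewrite mulrDl mul1r; apply: lerD => //; apply: le_trans (HF x y) _.
by rewrite ler_wpM2r ?ler_norm.
Qed.

Lemma pg_section F y : poly_growth F -> poly_growth1 (fun x => F (x, y)).
Proof.
move=> [mF [C [N HF]]]; split.
  by apply: measurableT_comp; [exact: mF|exact: measurable_pair2].
exists (`|C| * (1 + `|y : R|) ^+ N), N => x; apply: le_trans (HF _ _) _.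
rewrite -mulrA -exprMn; apply: (@le_trans _ _ (`|C| * (1 + `|x| + `|y : R|) ^+ N)).
  by rewrite ler_wpM2r ?ler_norm// exprn_ge0// !addr_ge0.
rewrite ler_wpM2l//; apply: lerXn2r; rewrite ?nnegrE ?mulr_ge0 ?addr_ge0//.
by have := mulr_ge0 (normr_ge0 x) (normr_ge0 (y : R)); rewrite mulrDl mulrDr; lra.
Qed.

Lemma pg1_cst c : poly_growth1 (fun=> c : R).
Proof. by have := pg_section (0 : R) (pg_cst c). Qed.

Lemma pg1_id : poly_growth1 (fun x : TR => x : R).
Proof. by have := pg_section (0 : R) pg_fst. Qed.

Lemma pg1_pair (f : TR -> R) : poly_growth1 f -> poly_growth (fun z => f z.1).
Proof. by move=> Hf; apply: (pg_comp Hf); exact: pg_fst. Qed.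

Lemma pg1D (f g : TR -> R) : poly_growth1 f -> poly_growth1 g -> poly_growth1 (fun x => f x + g x).
Proof. by move=> Hf Hg; have := pg_section (0 : R) (pgD (pg1_pair Hf) (pg1_pair Hg)). Qed.

Lemma pg1M (f g : TR -> R) : poly_growth1 f -> poly_growth1 g -> poly_growth1 (fun x => f x * g x).
Proof. by move=> Hf Hg; have := pg_section (0 : R) (pgM (pg1_pair Hf) (pg1_pair Hg)). Qed.

Lemma pg1Z c (f : TR -> R) : poly_growth1 f -> poly_growth1 (fun x => c * f x).
Proof. by move=> Hf; apply: pg1M => //; exact: pg1_cst. Qed.

Lemma pg1X (f : TR -> R) p : poly_growth1 f -> poly_growth1 (fun x => f x ^+ p).
Proof. by move=> Hf; have := pg_section (0 : R) (pgX p (pg1_pair Hf)). Qed.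

Lemma pg1_norm (f : TR -> R) : poly_growth1 f -> poly_growth1 (fun x => `|f x|).
Proof. by move=> Hf; have := pg_section (0 : R) (pg_norm (pg1_pair Hf)). Qed.

Lemma pg1B (f g : TR -> R) : poly_growth1 f -> poly_growth1 g -> poly_growth1 (fun x => f x - g x).
Proof. by move=> Hf Hg; have := pg_section (0 : R) (pgB (pg1_pair Hf) (pg1_pair Hg)). Qed.

End closure.

Section tilt_linear.
Variable h : R.
Implicit Types f g : TR -> R.
Local Notation tilt := (tilt rho h).

Lemma pg1_integrable f : poly_growth1 f ->
  rho.-integrable setT (EFin \o (fun x => f x * expR (h * x))).
Proof. by move=> [mf [C [N H]]]; exact: (tilt_integrable rhoB) H. Qed.

Lemma eq_tilt f g : f =1 g -> tilt f = tilt g.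
Proof. by move=> /boolp.funext ->. Qed.

Lemma tiltD f g : poly_growth1 f -> poly_growth1 g ->
  tilt (fun x => f x + g x) = tilt f + tilt g.
Proof.
move=> Hf Hg; rewrite /tilt -mulrDl -RintegralD//; try exact: pg1_integrable.
by congr (_ / _); apply: eq_Rintegral => x _; rewrite mulrDl.
Qed.

Lemma tiltZ c f : poly_growth1 f -> tilt (fun x => c * f x) = c * tilt f.
Proof.
move=> Hf; rewrite /tilt mulrA -RintegralZl//; last exact: pg1_integrable.
by congr (_ / _); apply: eq_Rintegral => x _; rewrite mulrA.
Qed.

Lemma tilt_cst c : tilt (fun=> c) = c.
Proof.
rewrite /tilt.
have -> : \int[rho]_x (c * expR (h * x)) = \int[rho]_x (c * ((x : R) ^+ 0 * expR (h * x))).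
  by apply: eq_Rintegral => x _; rewrite expr0 mul1r.
rewrite RintegralZl//; last exact: integrable_emom.
by rewrite -/(emom rho 0 h) mulfK// gt_eqF// emom0_gt0.
Qed.

Lemma tilt_id : tilt (fun x => x) = tmean rho h.
Proof. by rewrite /tilt /tmean /emom; congr (_ / _); apply: eq_Rintegral => x _; rewrite expr1. Qed.

Lemma tilt_sqr : tilt (fun x : TR => (x : R) ^+ 2) = tsquare rho h.
Proof. by []. Qed.

Lemma le_tilt f g : poly_growth1 f -> poly_growth1 g -> (forall x, f x <= g x) -> tilt f <= tilt g.
Proof.
move=> Hf Hg fg; rewrite /tilt ler_pM2r ?invr_gt0 ?emom0_gt0//.
apply: le_Rintegral => //; try exact: pg1_integrable.
by move=> x _; rewrite ler_wpM2r ?expR_ge0.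
Qed.

End tilt_linear.

Lemma expr_add_le (a b : R) p : 0 <= a -> 0 <= b -> (a + b) ^+ p <= 2 ^+ p * (a ^+ p + b ^+ p).
Proof.
move=> a0 b0; have [ab|ba] := leP a b.
  apply: (@le_trans _ _ ((2 * b) ^+ p)).
    by apply: lerXn2r; rewrite ?nnegrE ?addr_ge0 ?mulr_ge0//; lra.
  by rewrite exprMn ler_wpM2l ?exprn_ge0// lerDr exprn_ge0.
apply: (@le_trans _ _ ((2 * a) ^+ p)).
  by apply: lerXn2r; rewrite ?nnegrE ?addr_ge0 ?mulr_ge0//; lra.
by rewrite exprMn ler_wpM2l ?exprn_ge0// lerDl exprn_ge0.
Qed.

(** The spin can be integrated out at no loss in degree: a tilt of size O(|v|) displaces [x] by at
    most O(1 + |v|). *)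
Lemma tilt_growth_le (b : R) p : 0 <= b -> exists2 C, 0 <= C &
  forall h v : R, `|h| <= b * `|v| ->
    tilt rho h (fun x : TR => (1 + `|v| + `|x : R|) ^+ p) <= C * (1 + `|v|) ^+ p.
Proof.
move=> b0; pose K := abs_square_moment rho p; have K0 : 0 <= K := abs_square_moment_ge0 rho p.
exists (2 ^+ p * (1 + b ^+ p + K)); first by rewrite mulr_ge0 ?addr_ge0 ?exprn_ge0.
move=> h v hv; have v1 : 0 <= 1 + `|v| by rewrite addr_ge0.
have Hx : poly_growth1 (fun x : TR => `|x : R| ^+ p) by apply/pg1X/pg1_norm/pg1_id.
have Hs : poly_growth1 (fun x : TR => (1 + `|v|) ^+ p + `|x : R| ^+ p).
  by apply: pg1D => //; exact: pg1_cst.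
apply: (@le_trans _ _ (tilt rho h (fun x : TR => 2 ^+ p * ((1 + `|v|) ^+ p + `|x : R| ^+ p)))).
  apply: le_tilt; [|exact: pg1Z|by move=> x; exact: expr_add_le].
  by apply/pg1X/pg1D; [exact: pg1_cst|apply/pg1_norm/pg1_id].
rewrite tiltZ// tiltD//; last exact: pg1_cst.
rewrite tilt_cst -mulrA ler_wpM2l ?exprn_ge0//.
have t1 := tilt_normX_le rhoB p h.
have t2 : `|h| ^+ p <= b ^+ p * (1 + `|v|) ^+ p.
  rewrite -exprMn; apply: lerXn2r; rewrite ?nnegrE ?mulr_ge0//.
  by apply: le_trans hv _; rewrite ler_wpM2l// lerDr.
have t3 : K <= K * (1 + `|v|) ^+ p by rewrite -[leLHS]mulr1 ler_wpM2l// exprn_ege1// lerDl.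
rewrite !mulrDl mul1r -addrA lerD2l; apply: le_trans t1 _; exact: lerD.
Qed.

End tilt_calculus.

Section conditional_bound.
Context {R : realType}.
Local Notation TR := (measurableTypeR R).
Variables (rho : probability TR R) (beta : R).
Hypotheses (rhoB : classB rho) (beta_gt0 : 0 < beta).

Definition cwE n (F : TR * TR -> R) :=
  \int[curie_weiss rho n.+1 beta]_t F (cw_head t, cw_tail t).

Section linear.
Variable n : nat.
Implicit Types F G : TR * TR -> R.

Lemma cwED F G : poly_growth F -> poly_growth G ->
  cwE n (fun z => F z + G z) = cwE n F + cwE n G.
Proof. by move=> HF HG; rewrite /cwE RintegralD//; exact: cw_integrable. Qed.

Lemma cwEB F G : poly_growth F -> poly_growth G ->
  cwE n (fun z => F z - G z) = cwE n F - cwE n G.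
Proof. by move=> HF HG; rewrite /cwE RintegralB//; exact: cw_integrable. Qed.

Lemma cwEZ c F : poly_growth F -> cwE n (fun z => c * F z) = c * cwE n F.
Proof. by move=> HF; rewrite /cwE RintegralZl//; exact: cw_integrable. Qed.

Lemma cwE_cst c : cwE n (fun=> c) = c.
Proof. by rewrite /cwE Rintegral_cst// [X in fine X]probability_setT mulr1. Qed.

Lemma le_cwE F G : poly_growth F -> poly_growth G -> (forall z, F z <= G z) -> cwE n F <= cwE n G.
Proof.
by move=> HF HG FG; apply: le_Rintegral => //; exact: cw_integrable.
Qed.

Lemma le_normr_cwE F : poly_growth F -> `|cwE n F| <= cwE n (fun z => `|F z|).
Proof. by move=> HF; apply: le_normr_Rintegral => //; exact: cw_integrable. Qed.

(** A one-sided tower property. Lower bounds are obtained from it by changing the sign of [F]. *)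
Lemma cwE_le_tilt F (B : TR -> R) : poly_growth F -> poly_growth1 B ->
  (forall y : R, tilt rho (beta / n.+1%:R * y) (fun x => F (x, y)) <= B y) ->
  cwE n F <= cwE n (fun z => B z.2).
Proof.
move=> HF HB FB.
have HB2 : poly_growth (fun z : TR * TR => B z.2) by apply: (pg_comp HB); exact: pg_snd.
rewrite -subr_le0 -cwEB//; apply: cw_conditional_le0 => //; first exact: pgB.
move=> y /=; have := FB y; set h := beta / n.+1%:R * y.
have HFy := pg_section y HF.
rewrite /tilt ler_pdivrMr ?emom0_gt0// => H.
under eq_Rintegral do rewrite mulrBl.
rewrite RintegralB//; last 2 first.
- exact: (pg1_integrable rhoB).
- exact: (pg1_integrable rhoB _ (pg1_cst _)).
rewrite subr_le0; apply: le_trans H _; rewrite /emom -RintegralZl//; last exact: integrable_emom.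
rewrite le_eqVlt; apply/orP; left; apply/eqP; apply: eq_Rintegral => x _.
by rewrite expr0 mul1r.
Qed.

End linear.
End conditional_bound.

(** * The conditional Stein identity and its error *)

Section stein_error.
Context {R : realType}.
Local Notation TR := (measurableTypeR R).
Variables (rho : probability TR R) (beta : R) (k : nat) (mu : R).
Hypothesis rhoGHS : GHS rho.
Hypothesis var1 : emom rho 2 0 = 1.
Hypothesis beta_gt0 : 0 < beta.
Hypothesis type0 : has_type_strength (G rho beta) 0 k mu.

Let rhoB : classB rho := rhoGHS.1.
Local Notation m1 := (tmean rho).
Local Notation m2 := (tsquare rho).
Local Notation c := (drift_coef beta k mu).

Let k_gt0 : (0 < k)%N. Proof. by case: type0. Qed.

Let k2 : ((2 * k).-1).+1 = (2 * k)%N. Proof. by rewrite prednK// muln_gt0. Qed.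

Lemma pg1_comp (g f : TR -> R) : poly_growth1 g -> poly_growth1 f -> poly_growth1 (fun x => g (f x)).
Proof. by move=> Hg Hf; have := pg_section (0 : R) (pg_comp Hg (pg1_pair Hf)). Qed.

(** The two-variable bounds are Taylor's formula for [g] of orders zero and one, with [g1] as
    derivative. A single constant [B] makes the error estimates linear in it, so that in the end it
    carries the Lipschitz constant of the test function. *)
Definition smooth_growth (B : R) N (g g1 : R -> R) :=
  [/\ poly_growth1 (g : TR -> R), poly_growth1 (g1 : TR -> R),
   forall v, `|g v| <= B * (1 + `|v|) ^+ N,
   forall v, `|g1 v| <= B * (1 + `|v|) ^+ N &
   forall v u, `|g (v + u) - g v| <= B * `|u| * (1 + `|v| + `|u|) ^+ N /\
     `|g (v + u) - g v - u * g1 v| <= B * u ^+ 2 * (1 + `|v| + `|u|) ^+ N].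

Lemma smooth_growthN B N g g1 : smooth_growth B N g g1 ->
  smooth_growth B N (fun x => - g x) (fun x => - g1 x).
Proof.
move=> [Hg Hg1 H1 H2 H3]; split.
- by under boolp.eq_fun do rewrite -mulN1r; exact: pg1Z.
- by under boolp.eq_fun do rewrite -mulN1r; exact: pg1Z.
- by move=> v; rewrite normrN.
- by move=> v; rewrite normrN.
move=> v u; have [a1 a2] := H3 v u; split.
  by rewrite -opprD normrN.
by rewrite mulrN -!opprD normrN.
Qed.

(** The tilt is the law of X given V = v, and the tilted function is the exchangeability integrand.
    Expanding [g (v + a * x)], its conditional mean is (drift / a) g - g' up to small terms, and
    (drift / a) is c v^(2k-1) + O(e^2). Only an upper bound is stated, because [- g] provides the
    other. *)
Lemma stein_pointwise N : exists2 K, 0 <= K &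
  forall (e : R) v g g1 B, 0 < e <= 1 -> 0 <= B -> smooth_growth B N g g1 ->
  let a := e ^+ (2 * k).-1 in let s := e * v in
  tilt rho (beta * s) (fun x : TR => (s - x + e * a * x) * g (v + a * x) / a)
    - (c * v ^+ (2 * k).-1 * g v - g1 v)
  <= B * K * (e ^+ 2 + a) * (1 + `|v|) ^+ (N + 2 * k + 3).
Proof.
have [Cm Cm0 Hm] := tmean_linear rhoB.
have [Cs Cs0 Hs] := tsquare_near1 rhoB var1.
have [Cd Cd0 Hd] := drift_expansion rhoGHS beta_gt0 type0.
have [Ct Ct0 Ht] := tilt_growth_le rhoB (N + 3) (ltW beta_gt0).
(* One summand for each term of [main]: the expansion of the drift, [e * m1 h], and the coefficient
   of [g1 v]. *)
pose K1 := Cd + Cm * beta + (Cs * beta ^+ 2 + Cm * beta).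
have b0 := ltW beta_gt0.
have K10 : 0 <= K1 by rewrite !addr_ge0 ?mulr_ge0// sqr_ge0.
exists (K1 + 2 * Ct); first by rewrite addr_ge0// mulr_ge0.
move=> e v g g1 B /andP[e0 e1] B0 [Hg Hg1 gB g1B gT] /=.
set a := e ^+ (2 * k).-1; set s := e * v.
have a0 : 0 < a by rewrite exprn_gt0.
have a1 : a <= 1 by rewrite exprn_ile1// ltW.
have ee := ltW e0.
set w := 1 + `|v|; have w1 : 1 <= w by rewrite lerDl.
have w0 : 0 <= w := le_trans ler01 w1.
have sv : `|s| = e * `|v| by rewrite normrM gtr0_norm.
have vw : `|v| <= w by rewrite lerDr.
set h := beta * s.
have hv : `|h| <= beta * `|v|.
  rewrite normrM gtr0_norm// ler_wpM2l// sv -[leRHS]mul1r ler_wpM2r//.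
(* The part computable from two moments of the tilted law, with [g (v + a * x)] expanded to first
   order in the difference and to zeroth order in the small term; [rem] is of order [a]. *)
pose q (x : TR) : R := s * g v / a + ((- a^-1 + e) * g v + s * g1 v) * x + (- g1 v) * x ^+ 2.
pose rem (x : TR) : R := (s - x) * (g (v + a * x) - g v - a * x * g1 v) / a
   + e * x * (g (v + a * x) - g v).
have pgx : poly_growth1 (fun x : TR => x : R) := pg1_id.
have pgax : poly_growth1 (fun x : TR => g (v + a * x)).
  by apply: (pg1_comp Hg); apply: pg1D; [exact: pg1_cst|exact: pg1Z].
have pgq : poly_growth1 q.
  apply: pg1D; last by apply: pg1Z; exact: pg1X.
  by apply: pg1D; [exact: pg1_cst|exact: pg1Z].
have pgrem : poly_growth1 rem.
  apply: pg1D.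
    apply: pg1M; last exact: pg1_cst.
    apply: pg1M; first by apply: pg1B => //; exact: pg1_cst.
    apply: pg1B; first by apply: pg1B => //; exact: pg1_cst.
    by apply: pg1M; [exact: pg1Z|exact: pg1_cst].
  apply: pg1M; first exact: pg1Z.
  by apply: pg1B => //; exact: pg1_cst.
have -> : tilt rho h (fun x : TR => (s - x + e * a * x) * g (v + a * x) / a) =
    tilt rho h q + tilt rho h rem.
  rewrite -tiltD//; apply: eq_tilt => x; rewrite /q /rem.
  by field; rewrite gt_eqF.
have -> : tilt rho h q = s * g v / a + ((- a^-1 + e) * g v + s * g1 v) * m1 h - g1 v * m2 h.
  rewrite /q tiltD//; last by apply: pg1Z; exact: pg1X.
  rewrite tiltD//; [|exact: pg1_cst|exact: pg1Z].
  rewrite tilt_cst// tiltZ// tilt_id tiltZ//; last exact: pg1X.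
  by rewrite tilt_sqr mulNr.
  by apply: pg1D; [exact: pg1_cst|exact: pg1Z].
have remB : tilt rho h rem <= 2 * a * B * (Ct * w ^+ (N + 3)).
  apply: (@le_trans _ _ (tilt rho h (fun x : TR => 2 * a * B * (1 + `|v| + `|x : R|) ^+ (N + 3)))).
    apply: le_tilt => //.
      by apply/pg1Z/pg1X/pg1D; [exact: pg1_cst|exact: pg1_norm].
    move=> x; rewrite /rem.
    have [t1 t2] := gT v (a * x).
    have ax : `|a * (x : R)| = a * `|x : R| by rewrite normrM gtr0_norm.
    set z := 1 + `|v| + `|x : R|.
    have z1 : 1 <= z by rewrite /z -addrA lerDl addr_ge0.
    have z0 : 0 <= z := le_trans ler01 z1.
    have za : (1 + `|v| + `|a * (x : R)|) ^+ N <= z ^+ N.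
      apply: lerXn2r; rewrite ?nnegrE ?addr_ge0//.
      by rewrite lerD2l ax -[leRHS]mul1r ler_wpM2r.
    apply: le_trans (ler_norm _) _; apply: le_trans (ler_normD _ _) _.
    have r1 : `|(s - x) * (g (v + a * x) - g v - a * x * g1 v) / a| <= a * B * z ^+ (N + 3).
      rewrite 2!normrM normfV (gtr0_norm a0) ler_pdivrMr//.
      have -> : a * B * z ^+ (N + 3) * a = z * (B * (a ^+ 2 * z ^+ 2) * z ^+ N).
        by rewrite exprD; ring.
      apply: ler_pM => //.
        apply: le_trans (ler_normB _ _) _; rewrite sv /z.
        rewrite lerD2r; apply: (@le_trans _ _ (1 * `|v|)); first by rewrite ler_wpM2r.
        by rewrite mul1r lerDr.
      apply: le_trans t2 _; apply: ler_pM;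
        [by apply: mulr_ge0 => //; exact: sqr_ge0|by rewrite exprn_ge0// !addr_ge0| |exact: za].
      rewrite ler_wpM2l// exprMn ler_wpM2l ?sqr_ge0//.
      rewrite -[leLHS]real_normK ?num_real//; apply: lerXn2r; rewrite ?nnegrE//.
      by rewrite /z lerDr addr_ge0.
    have r2 : `|e * x * (g (v + a * x) - g v)| <= a * B * z ^+ (N + 3).
      rewrite normrM.
      have -> : a * B * z ^+ (N + 3) = z * (B * (a * z) * z ^+ N) * z by rewrite exprD; ring.
      rewrite -[leLHS]mulr1; apply: ler_pM; rewrite ?mulr_ge0//.
      apply: ler_pM => //.
        rewrite normrM gtr0_norm// -[leRHS]mul1r; apply: ler_pM => //.
        by rewrite /z lerDr addr_ge0.
      apply: le_trans t1 _; apply: ler_pM;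
        [exact: mulr_ge0|by rewrite exprn_ge0// !addr_ge0| |exact: za].
      by rewrite ler_wpM2l// ax ler_wpM2l ?(ltW a0)// /z lerDr addr_ge0.
    lra.
  rewrite tiltZ//; last by apply/pg1X/pg1D; [exact: pg1_cst|exact: pg1_norm].
  by rewrite ler_wpM2l ?mulr_ge0 ?(ltW a0)//; exact: Ht.
have sj : s ^+ (2 * k).-1 = a * v ^+ (2 * k).-1 by rewrite exprMn.
have an : a != 0 by rewrite gt_eqF.
(* The variance one of the spins cancels the leading multiple of [g1 v], leaving [m2 h - 1]. All
   three coefficients are now O(e^2). *)
have main : s * g v / a + ((- a^-1 + e) * g v + s * g1 v) * m1 h - g1 v * m2 h
    - (c * v ^+ (2 * k).-1 * g v - g1 v) =
  (drift rho beta s - c * s ^+ (2 * k).-1) / a * g v + e * m1 h * g v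
    + (s * m1 h - (m2 h - 1)) * g1 v.
  by rewrite sj /drift -/h; field.
have wk (i : nat) : (i <= 2 * k + 1)%N -> w ^+ i <= w ^+ (2 * k + 1) by move=> ik; exact: ler_weXn2l.
have k23 : (2 <= 2 * k + 1)%N by case: (k) k_gt0 => // i _; rewrite mulnS.
have E1 : `|(drift rho beta s - c * s ^+ (2 * k).-1) / a| <= Cd * (e ^+ 2 * w ^+ (2 * k + 1)).
  rewrite normrM normfV (gtr0_norm a0) ler_pdivrMr//; apply: le_trans (Hd s) _.
  rewrite -mulrA ler_wpM2l// sv exprMn.
  have -> : e ^+ (2 * k).+1 = e ^+ 2 * a.
    by rewrite -k2 /= /a -exprD addnC addn2.
  rewrite -mulrA [a * _]mulrC mulrA ler_wpM2r ?(ltW a0)// ler_wpM2l ?exprn_ge0//.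
  by rewrite addn1; apply: lerXn2r; rewrite ?nnegrE.
have m1B : `|m1 h| <= Cm * beta * (e * w).
  apply: le_trans (Hm h) _; rewrite -mulrA ler_wpM2l// /h normrM gtr0_norm// ler_wpM2l// sv.
  by rewrite ler_wpM2l.
have E2 : `|e * m1 h| <= Cm * beta * (e ^+ 2 * w ^+ (2 * k + 1)).
  rewrite normrM gtr0_norm//; apply: (@le_trans _ _ (e * (Cm * beta * (e * w)))).
    by rewrite ler_wpM2l.
  have -> : e * (Cm * beta * (e * w)) = Cm * beta * (e ^+ 2 * w ^+ 1) by ring.
  by rewrite ler_wpM2l ?mulr_ge0// ler_wpM2l ?exprn_ge0// wk// (leq_trans _ k23).
have E3 : `|s * m1 h - (m2 h - 1)| <= (Cs * beta ^+ 2 + Cm * beta) * (e ^+ 2 * w ^+ (2 * k + 1)).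
  have w2 : e ^+ 2 * w ^+ 2 <= e ^+ 2 * w ^+ (2 * k + 1) by rewrite ler_wpM2l ?exprn_ge0// wk.
  apply: (@le_trans _ _ ((Cs * beta ^+ 2 + Cm * beta) * (e ^+ 2 * w ^+ 2))); last first.
    by rewrite ler_wpM2l ?addr_ge0 ?mulr_ge0 ?sqr_ge0.
  apply: le_trans (ler_normB _ _) _; rewrite addrC mulrDl; apply: lerD.
    apply: le_trans (Hs h) _; rewrite -mulrA ler_wpM2l// /h exprMn ler_wpM2l ?sqr_ge0//.
    rewrite exprMn ler_wpM2l ?sqr_ge0// -[leLHS]real_normK ?num_real//.
    by apply: lerXn2r; rewrite ?nnegrE.
  rewrite normrM sv.
  have -> : Cm * beta * (e ^+ 2 * w ^+ 2) = (e * w) * (Cm * beta * (e * w)) by ring.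
  by apply: ler_pM => //; rewrite ?mulr_ge0// ler_wpM2l.
have F1 : s * g v / a + ((- a^-1 + e) * g v + s * g1 v) * m1 h - g1 v * m2 h
    - (c * v ^+ (2 * k).-1 * g v - g1 v) <= K1 * (e ^+ 2 * w ^+ (2 * k + 1)) * (B * w ^+ N).
  rewrite main; move: E1 E2 E3; set A1 := _ / a; set A2 := e * m1 h.
  set A3 := s * m1 h - _; set Q := e ^+ 2 * w ^+ _ => E1 E2 E3.
  apply: le_trans (ler_norm _) _; apply: le_trans (ler_normD _ _) _.
  have -> : K1 * Q * (B * w ^+ N) = Cd * Q * (B * w ^+ N) + Cm * beta * Q * (B * w ^+ N)
    + (Cs * beta ^+ 2 + Cm * beta) * Q * (B * w ^+ N) by rewrite /K1; ring.
  rewrite normrM; apply: lerD; last exact: ler_pM.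
  apply: le_trans (ler_normD _ _) _.
  by rewrite (normrM A1) (normrM A2); apply: lerD; exact: ler_pM.
rewrite addrAC; apply: le_trans (lerD F1 remB) _.
have p1 : w ^+ (2 * k + 1) * w ^+ N <= w ^+ (N + 2 * k + 3).
  by rewrite -exprD; apply: ler_weXn2l => //; rewrite [leqLHS]addnC addnA leq_add2l.
have p2 : w ^+ (N + 3) <= w ^+ (N + 2 * k + 3).
  by apply: ler_weXn2l => //; rewrite leq_add2r leq_addr.
set W := w ^+ (N + 2 * k + 3) in p1 p2 *.
have W0 : 0 <= W by rewrite exprn_ge0.
have -> : K1 * (e ^+ 2 * w ^+ (2 * k + 1)) * (B * w ^+ N) =
  (B * K1 * e ^+ 2) * (w ^+ (2 * k + 1) * w ^+ N) by ring.
have -> : 2 * a * B * (Ct * w ^+ (N + 3)) = (B * (2 * Ct) * a) * w ^+ (N + 3) by ring.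
apply: (@le_trans _ _ (B * K1 * e ^+ 2 * W + B * (2 * Ct) * a * W)).
  apply: lerD; first by rewrite ler_wpM2l ?mulr_ge0.
  by rewrite ler_wpM2l// !mulr_ge0// ltW.
have -> : B * (K1 + 2 * Ct) * (e ^+ 2 + a) * W = B * K1 * e ^+ 2 * W + B * (2 * Ct) * a * W
   + (B * K1 * a * W + B * (2 * Ct) * e ^+ 2 * W) by ring.
by rewrite lerDl addr_ge0// ?mulr_ge0// ltW.
Qed.

End stein_error.

(** * A priori moment bounds for the rescaled sum *)

Section moments.
Context {R : realType}.
Local Notation TR := (measurableTypeR R).
Variables (rho : probability TR R) (beta : R) (k : nat) (mu : R).
Hypothesis rhoGHS : GHS rho.
Hypothesis var1 : emom rho 2 0 = 1.
Hypothesis beta_gt0 : 0 < beta.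
Hypothesis type0 : has_type_strength (G rho beta) 0 k mu.

Let rhoB : classB rho := rhoGHS.1.
Local Notation drift := (drift rho beta).

Let k_gt0 : (0 < k)%N. Proof. by case: type0. Qed.

Let k2 : ((2 * k).-1).+1 = (2 * k)%N. Proof. by rewrite prednK// muln_gt0. Qed.

Lemma power_increment m (v u : R) :
  `|(v + u) ^+ m.+1 - v ^+ m.+1| <= m.+1%:R * `|u| * (`|v| + `|u|) ^+ m.
Proof.
elim: m => [|m IH]; first by rewrite !expr1 mulr1 mul1r addrAC subrr add0r.
have -> : (v + u) ^+ m.+2 - v ^+ m.+2 =
  (v + u) * ((v + u) ^+ m.+1 - v ^+ m.+1) + u * v ^+ m.+1.
  by rewrite ![_ ^+ m.+2]exprS; ring.
set z := `|v| + `|u|; have z0 : 0 <= z by rewrite addr_ge0.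
have -> : m.+2%:R * `|u| * z ^+ m.+1 = z * (m.+1%:R * `|u| * z ^+ m) + `|u| * z ^+ m.+1.
  by rewrite -[m.+2%:R]natr1 exprS; ring.
apply: le_trans (ler_normD _ _) _; rewrite !normrM; apply: lerD.
  by apply: ler_pM => //; exact: ler_normD.
rewrite ler_wpM2l// normrX; apply: lerXn2r; rewrite ?nnegrE// /z.
by rewrite lerDl.
Qed.

(** The Stein estimate for a power, keeping the drift unexpanded: the expansion error would involve
    moments of higher order. Here the only moment not below the order of the main term carries the
    factor [e]. *)
Lemma moment_pointwise m : exists2 K, 0 <= K & forall e v : R, 0 < e <= 1 ->
  tilt rho (beta * (e * v)) (fun x : TR =>
    drift (e * v) * v ^+ m.+1 / e ^+ (2 * k).-1 -
    (e * v - x + e * e ^+ (2 * k).-1 * x) * (v + e ^+ (2 * k).-1 * x) ^+ m.+1 / e ^+ (2 * k).-1)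
  <= K * (1 + `|v| ^+ m + e * `|v| ^+ m.+2).
Proof.
pose K2 := abs_square_moment rho 2; pose Km := abs_square_moment rho m.+2.
have K20 : 0 <= K2 := abs_square_moment_ge0 rho 2.
have Km0 : 0 <= Km := abs_square_moment_ge0 rho m.+2.
have b0 := ltW beta_gt0.
pose L := m.+2%:R * 2 ^+ m.+2 : R; have L0 : 0 <= L by rewrite mulr_ge0// exprn_ge0.
pose Q := 1 + 2 * beta ^+ m.+2 + beta ^+ 2 + 2 * Km + K2.
have bm0 : 0 <= beta ^+ m.+2 by rewrite exprn_ge0.
have b20 : 0 <= beta ^+ 2 by exact: sqr_ge0.
exists (L * Q); first by rewrite mulr_ge0// /Q !addr_ge0// mulr_ge0.
move=> e v /andP[e0 e1]; set a := e ^+ (2 * k).-1; set s := e * v; set h := beta * s.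
have dE : drift s = s - tmean rho h by [].
have a0 : 0 < a by rewrite exprn_gt0.
have a1 : a <= 1 by rewrite exprn_ile1// ltW.
have ee := ltW e0.
have pgx : poly_growth1 (fun x : TR => x : R) := pg1_id.
have pgax : poly_growth1 (fun x : TR => (v + a * x) ^+ m.+1).
  by apply/pg1X/pg1D; [exact: pg1_cst|exact: pg1Z].
pose rem (x : TR) : R := (s - x) * ((v + a * x) ^+ m.+1 - v ^+ m.+1) / a
   + e * x * (v + a * x) ^+ m.+1.
have pgrem : poly_growth1 rem.
  apply: pg1D.
    apply: pg1M; last exact: pg1_cst.
    apply: pg1M; first by apply: pg1B => //; exact: pg1_cst.
    by apply: pg1B => //; exact: pg1_cst.
  by apply: pg1M => //; exact: pg1Z.
(* The fluctuation of [x] about its tilted mean carries the large factor [1 / a], but its tilted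
   expectation vanishes. *)
pose q (x : TR) : R := - tmean rho h * v ^+ m.+1 / a + (v ^+ m.+1 / a) * x.
have pgq : poly_growth1 q by apply: pg1D; [exact: pg1_cst|exact: pg1Z].
have tq : tilt rho h q = 0.
  by rewrite tiltD//; [rewrite tilt_cst// tiltZ// tilt_id; ring|exact: pg1_cst|exact: pg1Z].
pose b (x : TR) : R := L * (e * `|v| ^+ m.+2) + (L * 2 * `|x : R| ^+ m.+2 + L * `|v| ^+ m * `|x : R| ^+ 2).
have pgn p (r : R) : poly_growth1 (fun x : TR => r * `|x : R| ^+ p).
  by apply/pg1Z/pg1X/pg1_norm.
have pgb : poly_growth1 b by apply: pg1D; [exact: pg1_cst|exact: pg1D].
apply: (@le_trans _ _ (tilt rho h (fun x => q x + b x))).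
  apply: le_tilt => //; last 2 first.
  - exact: pg1D.
  - move=> x.
    have -> : drift s * v ^+ m.+1 / a - (s - x + e * a * x) * (v + a * x) ^+ m.+1 / a =
      q x - rem x.
      by rewrite /q /rem dE; field; rewrite gt_eqF.
    rewrite lerD2l; apply: le_trans (ler_norm _) _; rewrite normrN.
    set r := `|v|; set t := `|x : R|.
    have r0 : 0 <= r by exact: normr_ge0.
    have t0 : 0 <= t by exact: normr_ge0.
    have ax : `|a * (x : R)| = a * t by rewrite normrM gtr0_norm.
    have axt : a * t <= t by rewrite -[leRHS]mul1r ler_wpM2r.
    set z := r + t; have z0 : 0 <= z by rewrite addr_ge0.
    have R1 : `|(s - x) * ((v + a * x) ^+ m.+1 - v ^+ m.+1) / a| <=
        (e * r + t) * (m.+1%:R * t * z ^+ m).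
      rewrite 2!normrM normfV (gtr0_norm a0) ler_pdivrMr// -[leRHS]mulrA.
      apply: ler_pM => //.
        by apply: le_trans (ler_normB _ _) _; rewrite normrM (gtr0_norm e0).
      apply: le_trans (power_increment _ _ _) _; rewrite ax -/r.
      have -> : m.+1%:R * t * z ^+ m * a = m.+1%:R * (a * t) * z ^+ m by ring.
      rewrite ler_wpM2l ?mulr_ge0// ?(ltW a0)//.
      by apply: lerXn2r; rewrite ?nnegrE ?addr_ge0 ?mulr_ge0 ?(ltW a0)// lerD2l.
    have R2 : `|e * x * (v + a * x) ^+ m.+1| <= e * t * z ^+ m.+1.
      rewrite 2!normrM (gtr0_norm e0) ler_wpM2l ?mulr_ge0// normrX.
      apply: lerXn2r; rewrite ?nnegrE//.
      by apply: le_trans (ler_normD _ _) _; rewrite ax lerD2l.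
    apply: le_trans (ler_normD _ _) _; apply: le_trans (lerD R1 R2) _.
    have zm : 0 <= z ^+ m by rewrite exprn_ge0.
    have z2 := expr_add_le m.+2 r0 t0; have z1 := expr_add_le m r0 t0.
    rewrite -/z in z1 z2.
    have rz : r <= z by rewrite lerDl.
    have tz : t <= z by rewrite lerDr.
    have S1 : e * r * (m.+1%:R * t * z ^+ m) <= m.+1%:R * e * z ^+ m.+2.
      have -> : e * r * (m.+1%:R * t * z ^+ m) = m.+1%:R * e * (r * t * z ^+ m) by ring.
      rewrite ler_wpM2l ?mulr_ge0// !exprS mulrA ler_wpM2r//; exact: ler_pM.
    have S2 : t * (m.+1%:R * t * z ^+ m) <= m.+1%:R * (t ^+ 2 * (2 ^+ m * (r ^+ m + t ^+ m))).
      have -> : t * (m.+1%:R * t * z ^+ m) = m.+1%:R * (t ^+ 2 * z ^+ m) by ring.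
      by rewrite ler_wpM2l// ler_wpM2l ?sqr_ge0.
    have S3 : e * t * z ^+ m.+1 <= e * z ^+ m.+2.
      by rewrite -mulrA ler_wpM2l// [leRHS]exprS ler_wpM2r ?exprn_ge0.
    have S4 : (m.+1%:R + 1) * e * z ^+ m.+2 <= L * (e * (r ^+ m.+2 + t ^+ m.+2)).
      have -> : L * (e * (r ^+ m.+2 + t ^+ m.+2)) =
        (m.+1%:R + 1) * e * (2 ^+ m.+2 * (r ^+ m.+2 + t ^+ m.+2)).
        by rewrite /L -[m.+2%:R]natr1; ring.
      by rewrite ler_wpM2l ?mulr_ge0 ?addr_ge0.
    have rm0 : 0 <= r ^+ m by rewrite exprn_ge0.
    have tm0 : 0 <= t ^+ m.+2 by rewrite exprn_ge0.
    have S5 : m.+1%:R * (t ^+ 2 * (2 ^+ m * (r ^+ m + t ^+ m))) <=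
        L * (t ^+ m.+2 + r ^+ m * t ^+ 2).
      have -> : m.+1%:R * (t ^+ 2 * (2 ^+ m * (r ^+ m + t ^+ m))) =
        (m.+1%:R * 2 ^+ m) * (t ^+ m.+2 + r ^+ m * t ^+ 2).
        by rewrite [t ^+ m.+2]exprS [t ^+ m.+1]exprS expr2; ring.
      have P0 : 0 <= t ^+ m.+2 + r ^+ m * t ^+ 2.
        by apply: addr_ge0 => //; apply: mulr_ge0 => //; exact: sqr_ge0.
      rewrite ler_wpM2r// /L; apply: ler_pM => //.
      - by rewrite ler_nat.
      - by apply: ler_weXn2l; [rewrite ler1n|exact: leq_trans (leqnSn _) (leqnSn _)].
    have S6 : L * (e * t ^+ m.+2) <= L * t ^+ m.+2.
      by rewrite ler_wpM2l// -[leRHS]mul1r ler_wpM2r.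
    by rewrite /b -/r -/t; lra.
  - have -> : (fun x : TR => drift s * v ^+ m.+1 / a - (s - x + e * a * x) * (v + a * x) ^+ m.+1 / a)
       = (fun x => q x - rem x).
      apply/funext => x; by rewrite /q /rem dE; field; rewrite gt_eqF.
    exact: pg1B.
rewrite tiltD// tq add0r /b tiltD//; [|exact: pg1_cst|exact: pg1D].
rewrite tilt_cst// tiltD// !tiltZ//; try (by apply/pg1X/pg1_norm).
have t1 := tilt_normX_le rhoB m.+2 h; have t2 := tilt_normX_le rhoB 2 h.
rewrite -/Km -/K2 in t1 t2.
set r := `|v|; have r0 : 0 <= r by exact: normr_ge0.
have hE : `|h| = beta * (e * r) by rewrite /h /s !normrM (gtr0_norm beta_gt0) (gtr0_norm e0).
have rm0 : 0 <= r ^+ m by rewrite exprn_ge0.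
have rm2 : 0 <= r ^+ m.+2 by rewrite exprn_ge0.
have em : e ^+ m.+2 <= e by rewrite -[leRHS]expr1 ler_wiXn2l.
have h1 : `|h| ^+ m.+2 <= beta ^+ m.+2 * (e * r ^+ m.+2).
  by rewrite hE !exprMn ler_wpM2l// ler_wpM2r.
have h2 : r ^+ m * `|h| ^+ 2 <= beta ^+ 2 * (e * r ^+ m.+2).
  have -> : r ^+ m * `|h| ^+ 2 = beta ^+ 2 * (e ^+ 2 * r ^+ m.+2).
    by rewrite hE [r ^+ m.+2]exprS [r ^+ m.+1]exprS; ring.
  by rewrite ler_wpM2l// ler_wpM2r// expr2 -[leRHS]mul1r ler_wpM2r.
have er0 : 0 <= e * r ^+ m.+2 by rewrite mulr_ge0.
set A := tilt rho h _ in t1 *; set B := tilt rho h _ in t2 *.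
have X1 : 2 * A <= 2 * (beta ^+ m.+2 * (e * r ^+ m.+2)) + 2 * Km by lra.
have X2 : r ^+ m * B <= beta ^+ 2 * (e * r ^+ m.+2) + K2 * r ^+ m.
  by apply: le_trans (ler_wpM2l rm0 t2) _; rewrite mulrDr [K2 * _]mulrC lerD2r.
have -> : L * (e * r ^+ m.+2) + (L * 2 * A + L * r ^+ m * B) =
  L * (e * r ^+ m.+2 + 2 * A + r ^+ m * B) by ring.
rewrite -[leRHS]mulrA ler_wpM2l//.
have Y1 : 0 <= (2 * beta ^+ m.+2 + beta ^+ 2 + 1 + K2) * 1 by rewrite mulr1 !addr_ge0// mulr_ge0.
have Y2 : 0 <= (1 + 2 * beta ^+ m.+2 + beta ^+ 2 + 2 * Km) * r ^+ m.
  by rewrite mulr_ge0// !addr_ge0// mulr_ge0.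
have Y3 : 0 <= (2 * Km + K2) * (e * r ^+ m.+2) by rewrite mulr_ge0// !addr_ge0// mulr_ge0.
rewrite /Q; move: X1 X2 Y1 Y2 Y3; lra.
Qed.

End moments.

Section scales.
Context {R : realType}.
Variable k : nat.

(** The index [n] stands for a system of [n.+1] spins, so that there is always a first one. *)
Definition cw_eps n : R := n.+1%:R `^ (- (2 * k)%:R^-1).
Definition cw_scale n : R := cw_eps n ^+ (2 * k).-1.

Lemma cw_eps_gt0 n : 0 < cw_eps n.
Proof. by rewrite powR_gt0. Qed.

Lemma cw_scale_gt0 n : 0 < cw_scale n.
Proof. by rewrite exprn_gt0// cw_eps_gt0. Qed.

Hypothesis k_gt0 : (0 < k)%N.

Lemma cw_epsX n : cw_eps n ^+ (2 * k) * n.+1%:R = 1.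
Proof.
rewrite -powR_mulrn ?ltW ?cw_eps_gt0// -powRrM mulNr mulVf ?pnatr_eq0; last first.
  by rewrite -lt0n muln_gt0.
by rewrite powRN powRr1// mulVf// pnatr_eq0.
Qed.

Lemma cw_eps_scale n : cw_eps n * cw_scale n * n.+1%:R = 1.
Proof. by rewrite /cw_scale -exprS prednK ?cw_epsX// muln_gt0. Qed.

Lemma cw_eps_le n (d : R) : 0 < d -> (d ^+ (2 * k))^-1 <= n.+1%:R -> cw_eps n <= d.
Proof.
move=> d0 dn; have kk : (0 < 2 * k)%N by rewrite muln_gt0.
rewrite -(ler_pXn2r kk) ?nnegrE ?(ltW (cw_eps_gt0 n)) ?(ltW d0)//.
have dk : 0 < d ^+ (2 * k) by rewrite exprn_gt0.
have := cw_epsX n; set x := cw_eps n ^+ _ => xn.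
have N0 : 0 < n.+1%:R :> R by [].
by rewrite -(ler_pM2r N0) xn -ler_pdivrMl// mulr1.
Qed.

Lemma cw_eps_le1 n : cw_eps n <= 1.
Proof. by apply: cw_eps_le => //; rewrite expr1n invr1 ler1n. Qed.

Lemma cw_eps01 n : 0 < cw_eps n <= 1.
Proof. by rewrite cw_eps_gt0 cw_eps_le1. Qed.

Lemma cw_scale_le1 n : cw_scale n <= 1.
Proof. by rewrite exprn_ile1 ?cw_eps_le1// (ltW (cw_eps_gt0 n)). Qed.

Lemma cw_field (b y : R) n : b / n.+1%:R * y = b * (cw_eps n * (cw_scale n * y)).
Proof.
have N0 : n.+1%:R != 0 :> R by rewrite pnatr_eq0.
have -> : n.+1%:R^-1 = cw_eps n * cw_scale n.
  by apply: (mulIf N0); rewrite mulVf// cw_eps_scale.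
by rewrite !mulrA.
Qed.

End scales.

Section uniform_moments.
Context {R : realType}.
Local Notation TR := (measurableTypeR R).
Variables (rho : probability TR R) (beta : R) (k : nat) (mu : R).
Hypothesis rhoGHS : GHS rho.
Hypothesis var1 : emom rho 2 0 = 1.
Hypothesis beta_gt0 : 0 < beta.
Hypothesis type0 : has_type_strength (G rho beta) 0 k mu.

Let rhoB : classB rho := rhoGHS.1.
Local Notation E := (cwE rho beta).
Local Notation eps := (cw_eps (R := R) k).
Local Notation scale := (cw_scale (R := R) k).

Let k_gt0 : (0 < k)%N. Proof. by case: type0. Qed.

Let k2 : ((2 * k).-1).+1 = (2 * k)%N. Proof. by rewrite prednK// muln_gt0. Qed.

Local Notation V n := (fun z : TR * TR => scale n * (z.2 : R)).

Lemma pg_V n : poly_growth (V n).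
Proof. by apply: pgZ; exact: pg_snd. Qed.

(* Since [eps n * scale n = n.+1%:R^-1], this is the integrand of [cw_exchange] divided by
   [n.+1%:R * scale n]. *)
Definition cw_balanced n (g : R -> R) (z : TR * TR) : R :=
  (eps n * V n z - z.1 + eps n * scale n * z.1) *
    g (V n z + scale n * z.1) / scale n.

Lemma pg_balanced n (g : R -> R) : poly_growth1 (g : TR -> R) -> poly_growth (cw_balanced n g).
Proof.
move=> Hg; apply: pgM; last exact: pg_cst.
apply: pgM.
  apply: pgD; last by apply: pgZ; exact: pg_fst.
  by apply: pgB; [apply: pgZ; exact: pg_V|exact: pg_fst].
by apply: (pg_comp Hg); apply: pgD; [exact: pg_V|apply: pgZ; exact: pg_fst].
Qed.

Lemma cwE_balanced n (g : R -> R) : poly_growth1 (g : TR -> R) -> E n (cw_balanced n g) = 0.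
Proof.
move=> Hg.
have Hga : poly_growth1 (fun x : TR => g (scale n * (x : R))).
  by apply: (pg1_comp Hg); apply: pg1Z; exact: pg1_id.
have := cw_exchange rhoB beta_gt0 n Hga.1 Hga.2.
set I := \int[_]_t _ => I0.
have -> : E n (cw_balanced n g) = eps n * I.
  rewrite /I -/(E n (fun z : TR * TR => ((z.2 : R) - n%:R * z.1) * g (scale n * ((z.1 : R) + z.2)))).
  rewrite -cwEZ//; last first.
    apply: pgM; first by apply: pgB; [exact: pg_snd|apply: pgZ; exact: pg_fst].
    by apply: (pg_comp Hga); apply: pgD; [exact: pg_fst|exact: pg_snd].
  rewrite /cwE; apply: eq_Rintegral => t _; rewrite /cw_balanced /=.
  have a0 : scale n != 0 by rewrite gt_eqF// cw_scale_gt0.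
  have -> : scale n * cw_tail t + scale n * cw_head t =
    scale n * (cw_head t + cw_tail t) by rewrite -mulrDr addrC.
  set gg := g _; set e := eps n; set a := scale n in a0 *.
  have ea : e * a * n.+1%:R = 1 := (cw_eps_scale k_gt0) n.
  have -> : e * (a * cw_tail t) - cw_head t + e * a * cw_head t =
    e * (a * cw_tail t) - (e * a * n.+1%:R) * cw_head t + e * a * cw_head t by rewrite ea mul1r.
  rewrite -[n.+1%:R]natr1; field; exact: a0.
by rewrite I0 mulr0.
Qed.

Lemma stein_expectation N : exists2 K, 0 <= K &
  forall n g g1 B, 0 <= B -> smooth_growth B N g g1 ->
  `|E n (fun z => drift_coef beta k mu * V n z ^+ (2 * k).-1 * g (V n z) - g1 (V n z))| <=
  B * K * (eps n ^+ 2 + scale n) * E n (fun z => (1 + `|V n z|) ^+ (N + 2 * k + 3)).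
Proof.
have [K K0 HK] := stein_pointwise rhoGHS var1 beta_gt0 type0 N.
exists K => // n.
(* The class is invariant under a change of sign, which turns the one-sided bound into a two-sided
   one. *)
suff one g g1 B : 0 <= B -> smooth_growth B N g g1 ->
  - E n (fun z => drift_coef beta k mu * V n z ^+ (2 * k).-1 * g (V n z) - g1 (V n z)) <=
  B * K * (eps n ^+ 2 + scale n) * E n (fun z => (1 + `|V n z|) ^+ (N + 2 * k + 3)).
  move=> g g1 B B0 Hg; rewrite ler_norml lerNl one//=.
  have := one _ _ _ B0 (smooth_growthN Hg).
  rewrite -mulN1r -cwEZ//; last first.
    have [pg pg1 _ _ _] := smooth_growthN Hg.
    apply: pgB; last by apply: (pg_comp pg1); exact: pg_V.
    apply: pgM; last by apply: (pg_comp pg); exact: pg_V.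
    by apply: pgZ; apply: pgX; exact: pg_V.
  congr (_ <= _); rewrite /cwE; apply: eq_Rintegral => t _; ring.
move=> B0 Hg; have [pg pg1 _ _ _] := Hg.
have pgS : poly_growth (fun z => drift_coef beta k mu * V n z ^+ (2 * k).-1 * g (V n z) - g1 (V n z)).
  apply: pgB; last by apply: (pg_comp pg1); exact: pg_V.
  apply: pgM; last by apply: (pg_comp pg); exact: pg_V.
  by apply: pgZ; apply: pgX; exact: pg_V.
have pgT := pg_balanced n pg.
rewrite -[leLHS]add0r -(cwE_balanced n pg) -cwEB//.
have pgw : poly_growth (fun z => (1 + `|V n z|) ^+ (N + 2 * k + 3)).
  by apply: pgX; apply: pgD; [exact: pg_cst|apply: pg_norm; exact: pg_V].
rewrite -cwEZ//.
pose W (y : TR) : R := B * K * (eps n ^+ 2 + scale n) * (1 + `|scale n * (y : R)|) ^+ (N + 2 * k + 3).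
apply: (@cwE_le_tilt _ _ _ rhoB beta_gt0 n _ W) => //.
- exact: pgB.
- by apply: pg1Z; apply: pg1X; apply: pg1D; [exact: pg1_cst|apply: pg1_norm; apply: pg1Z; exact: pg1_id].
move=> y; rewrite (cw_field k_gt0).
have := HK (eps n) (scale n * y) g g1 B (cw_eps01 k_gt0 n) B0 Hg.
apply: le_trans; rewrite le_eqVlt; apply/orP; left; apply/eqP.
rewrite /cw_balanced /= -/(scale n).
set T := (fun x : TR => _ / scale n).
have pT : poly_growth1 T := pg_section y pgT.
set d := drift_coef _ _ _ * _ * _ - _.
have := tiltD rhoB (beta * (eps n * (scale n * y))) pT (pg1_cst (- d)).
by rewrite tilt_cst.
Qed.

(** Exchangeability is tested with g(x) = x^(2m+1). By [drift_lower] the restoring term is at least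
    c v^(2m) min(v^(2k), e^(2-2k) v^2), and since e <= 1 this is at least c v^(2m) (v^2 - 1): the
    minimum bounds from below where v^2 >= 1, positivity covers the rest. *)
Lemma moment_recursion m : exists K c : R, [/\ 0 <= K, 0 < c & forall n,
  c * E n (fun z => `|V n z| ^+ (2 * m).+2) <=
  K + (K + c) * E n (fun z => `|V n z| ^+ (2 * m)) + K * eps n * E n (fun z => `|V n z| ^+ (2 * m).+2)].
Proof.
have [K K0 HK] := moment_pointwise k rhoGHS beta_gt0 (2 * m).
have [c c0 Hc] := drift_lower rhoGHS beta_gt0 type0.
exists K, c; split => // n.
set e := eps n; set a := scale n.
have e0 : 0 < e := cw_eps_gt0 k n; have a0 : 0 < a := cw_scale_gt0 k n.
have pgv p : poly_growth (fun z => `|V n z| ^+ p) by apply: pgX; apply: pg_norm; exact: pg_V.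
pose g (x : R) := x ^+ (2 * m).+1.
have pgg : poly_growth1 (g : TR -> R) by apply: pg1X; exact: pg1_id.
pose D (z : TR * TR) : R := c * `|V n z| ^+ (2 * m).+2 - c * `|V n z| ^+ (2 * m).
have pD : poly_growth D by apply: pgB; exact: pgZ.
pose W (y : TR) : R := K * (1 + `|a * (y : R)| ^+ (2 * m) + e * `|a * (y : R)| ^+ (2 * m).+2).
have pgay : poly_growth1 (fun y : TR => `|a * (y : R)|) by apply: pg1_norm; apply: pg1Z; exact: pg1_id.
have pW : poly_growth1 W.
  apply: pg1Z; apply: pg1D; last by apply: pg1Z; exact: pg1X.
  by apply: pg1D; [exact: pg1_cst|exact: pg1X].
have pT := pg_balanced n pgg.
have key : E n (fun z => D z - cw_balanced n g z) <= E n (fun z => W z.2).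
  apply: (@cwE_le_tilt _ _ _ rhoB beta_gt0 n _ W) => //; first exact: pgB.
  move=> y; rewrite (cw_field k_gt0) -/e -/a; set v := a * y.
  have := HK e v (cw_eps01 k_gt0 n); rewrite -/(scale n) -/a.
  set T := (fun x : TR => _ - _ / a) => H; apply: le_trans H.
  have pT' : poly_growth1 T.
    have -> : T = (fun x : TR => drift rho beta (e * v) * v ^+ (2 * m).+1 / a - cw_balanced n g (x, y)).
      by [].
    by apply: pg1B; [exact: pg1_cst|exact: pg_section pT].
  apply: le_tilt => //; first exact: (pg_section y (pgB pD pT)).
  move=> x; rewrite /T lerD2r /D /= -/a -/v -mulrBr.
  have vm : `|v| ^+ (2 * m) = v ^+ (2 * m) by rewrite !exprM real_normK ?num_real.
  have vm0 : 0 <= v ^+ (2 * m) by rewrite exprM exprn_ge0// sqr_ge0.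
  have -> : `|v| ^+ (2 * m).+2 = v ^+ (2 * m) * v ^+ 2.
    by rewrite -addn2 exprD vm real_normK ?num_real.
  rewrite vm.
  have ea : e * a = e ^+ (2 * k) by rewrite /a /cw_scale -exprS k2.
  have ek0 : 0 < e ^+ (2 * k) by rewrite exprn_gt0.
  have -> : drift rho beta (e * v) * v ^+ (2 * m).+1 / a =
      v ^+ (2 * m) * ((e * v * drift rho beta (e * v)) / e ^+ (2 * k)).
    by rewrite -ea exprS; field; rewrite !gt_eqF.
  have -> : c * (v ^+ (2 * m) * v ^+ 2 - v ^+ (2 * m)) = v ^+ (2 * m) * (c * (v ^+ 2 - 1)) by ring.
  rewrite ler_wpM2l// ler_pdivlMr//; apply: le_trans (Hc (e * v)).
  have X1 : (e * v) ^+ (2 * k) = e ^+ (2 * k) * v ^+ (2 * k) by rewrite exprMn.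
  have X2 : (e * v) ^+ 2 = e ^+ 2 * v ^+ 2 by rewrite exprMn.
  rewrite -mulrA ler_wpM2l ?(ltW c0)// le_min X1 X2; apply/andP; split.
    rewrite mulrC ler_wpM2l ?(ltW ek0)//.
    have [v1|v1] := leP 1 (v ^+ 2).
      apply: (@le_trans _ _ (v ^+ 2)); first by rewrite gerBl.
      by rewrite exprM -[leLHS]expr1; apply: ler_weXn2l.
    apply: (@le_trans _ _ 0); first by rewrite subr_le0 ltW.
    by rewrite exprM exprn_ge0// sqr_ge0.
  have ek2 : e ^+ (2 * k) <= e ^+ 2.
    by apply: ler_wiXn2l; [exact: ltW|exact: (cw_eps_le1 k_gt0)|rewrite mulnC leq_pmull].
  apply: (@le_trans _ _ (v ^+ 2 * e ^+ (2 * k))).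
    by rewrite ler_wpM2r ?(ltW ek0)// gerBl.
  by rewrite mulrC ler_wpM2r ?sqr_ge0.
rewrite cwEB// cwE_balanced// subr0 in key.
have eD : E n D = c * E n (fun z => `|V n z| ^+ (2 * m).+2) - c * E n (fun z => `|V n z| ^+ (2 * m)).
  by rewrite /D cwEB ?cwEZ//; exact: pgZ.
have eW : E n (fun z => W z.2) = K * (1 + E n (fun z => `|V n z| ^+ (2 * m)) +
    e * E n (fun z => `|V n z| ^+ (2 * m).+2)).
  have p1 : poly_growth (fun z => 1 + `|V n z| ^+ (2 * m)) by apply: pgD; [exact: pg_cst|exact: pgv].
  have p2 : poly_growth (fun z => e * `|V n z| ^+ (2 * m).+2) by exact: pgZ.
  have p3 : poly_growth (fun=> 1 : R) by exact: pg_cst.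
  have p4 := pgD p1 p2.
  by rewrite /W cwEZ// cwED// cwED// cwE_cst cwEZ.
move: key; rewrite eD eW; lra.
Qed.

(** Lets asymptotic absorption arguments yield constants valid for every [n]. *)
Lemma uniform_bound (f : nat -> R) n0 C0 : (forall n, (n0 <= n)%N -> f n <= C0) ->
  exists2 C, 0 <= C & forall n, f n <= C.
Proof.
move=> H; exists (`|C0| + \sum_(i < n0) `|f i|).
  by rewrite addr_ge0// sumr_ge0.
move=> n; have [nn|nn] := leqP n0 n.
  by apply: le_trans (H n nn) _; rewrite (le_trans (ler_norm _))// lerDl sumr_ge0.
apply: le_trans (ler_norm _) _; rewrite (bigD1 (Ordinal nn))//= addrCA lerDl.
by rewrite addr_ge0// sumr_ge0.
Qed.

(** Once [K * eps n <= c / 2], the last term of the recursion is absorbed by the left-hand side, and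
    the moment is bounded by the preceding even one. *)
Lemma even_moments m : exists2 C, 0 <= C & forall n, E n (fun z => `|V n z| ^+ (2 * m)) <= C.
Proof.
elim: m => [|m [C C0 HC]].
  by exists 1 => // n; rewrite muln0; under [fun z => _]boolp.funext do rewrite expr0; rewrite cwE_cst.
have [K [c [K0 c0 HK]]] := moment_recursion m.
have -> : (2 * m.+1 = (2 * m).+2)%N by rewrite mulnS.
pose d := c / (2 * (K + 1)).
have K1 : 0 < 2 * (K + 1) by rewrite mulr_gt0// ltr_wpDl.
have d0 : 0 < d by rewrite divr_gt0.
apply: (@uniform_bound _ (Num.bound (d ^+ (2 * k))^-1) (2 / c * (K + (K + c) * C))) => n nn.
have en : eps n <= d.
  apply: (cw_eps_le k_gt0) => //; apply: ltW; apply: lt_le_trans (archi_boundP _) _.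
    by rewrite invr_ge0 exprn_ge0// ltW.
  by rewrite ler_nat (leq_trans nn).
have Ke : K * eps n <= c / 2.
  have : d * (2 * (K + 1)) = c by rewrite divfK// gt_eqF.
  have := ler_wpM2l K0 en; have := ltW d0; nra.
have M0 : 0 <= E n (fun z => `|V n z| ^+ (2 * m).+2).
  by apply: Rintegral_ge0 => t _; rewrite exprn_ge0.
have := HK n; have := HC n; set M := E n _ in M0 *; set M' := E n _ => h1 h2.
have KC : (K + c) * M' <= (K + c) * C by rewrite ler_wpM2l// addr_ge0// ltW.
have KM : K * eps n * M <= c / 2 * M by rewrite ler_wpM2r.
have h3 : c / 2 * M <= K + (K + c) * C by lra.
rewrite -ler_pdivrMl ?divr_gt0//.
by have -> : (2 / c)^-1 = c / 2 by rewrite invf_div.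
Qed.

Lemma uniform_moments p : exists2 C, 0 <= C & forall n, E n (fun z => (1 + `|V n z|) ^+ p) <= C.
Proof.
have [C C0 HC] := even_moments p.
exists (2 ^+ (2 * p) * (1 + C)); first by rewrite mulr_ge0 ?exprn_ge0 ?addr_ge0.
move=> n.
have pgn : poly_growth (fun z => `|V n z|) by apply: pg_norm; exact: pg_V.
apply: (@le_trans _ _ (E n (fun z => 2 ^+ (2 * p) * (1 + `|V n z| ^+ (2 * p))))).
  apply: le_cwE => //.
  - by apply: pgX; apply: pgD; [exact: pg_cst|].
  - by apply: pgZ; apply: pgD; [exact: pg_cst|exact: pgX].
  move=> z; have := @expr_add_le _ 1 `|V n z| (2 * p) ler01 (normr_ge0 _).
  rewrite expr1n; apply: le_trans; apply: ler_weXn2l; first by rewrite lerDl.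
  by rewrite mulnC leq_pmulr.
have p1 : poly_growth (fun=> 1 : R) by exact: pg_cst.
have p2 : poly_growth (fun z => `|V n z| ^+ (2 * p)) by exact: pgX.
have p3 := pgD p1 p2.
by rewrite cwEZ// cwED// cwE_cst ler_wpM2l ?exprn_ge0// lerD2l.
Qed.

End uniform_moments.

(** * The Stein equation of the limit law *)

Section stein_equation.
Context {R : realType}.
Local Notation TR := (measurableTypeR R).
Local Notation leb := (@lebesgue_measure R).
Variable k : nat.
Hypothesis k_gt0 : (0 < k)%N.
Implicit Types (v x t : R) (h : R -> R).

Definition gdens v x : R := expR (exponent_Fhat k v x).

Lemma gdensN v x : gdens v (- x) = gdens v x.
Proof. by rewrite /gdens /exponent_Fhat !exprM sqrrN. Qed.

Lemma gdens_gt0 v x : 0 < gdens v x. Proof. exact: expR_gt0. Qed.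

Lemma is_derive_exponent v x : v != 0 ->
  is_derive x (1 : R) (exponent_Fhat k v) (- (x ^+ (2 * k).-1 / v)).
Proof.
move=> v0.
have k2 : (2 * k)%N = ((2 * k).-1).+1 by rewrite prednK// muln_gt0.
suff D : is_derive x (1 : R) (fun y : R => - (y ^+ (2 * k) / ((2 * k)%:R * v)))
  (- (x ^+ (2 * k).-1 / v)) by exact: D.
rewrite k2 /=; set j := (2 * k).-1.
have -> : (fun y : R => - (y ^+ j.+1 / (j.+1%:R * v))) =
    (- (j.+1%:R * v)^-1) \*: (fun y : R => y ^+ j.+1).
  by apply/funext => y; rewrite /= /GRing.scale/= mulNr mulrC.
have DX : is_derive x (1 : R) (fun y : R => y ^+ j.+1) (j.+1%:R * x ^+ j).
  have -> : (fun y : R => y ^+ j.+1) = horner ('X^(j.+1) : {poly R}).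
    by apply/funext => y; rewrite hornerXn.
  apply: (is_derive_eq (is_derive_poly _ _)).
  by rewrite derivXn hornerMn hornerXn mulr_natl.
apply: (is_derive_eq (is_deriveZ _ DX)); rewrite /GRing.scale/=.
have : j.+1%:R != 0 :> R by rewrite pnatr_eq0.
move: (j.+1%:R) => c c0.
by field; rewrite v0 c0.
Qed.

Lemma is_derive_gdens v x : v != 0 ->
  is_derive x (1 : R) (gdens v) (- (x ^+ (2 * k).-1 / v * gdens v x)).
Proof.
move=> v0; have D := is_derive_exponent x v0.
by apply: (is_derive_eq (is_derive1_comp (is_derive_expR _) D)); rewrite /gdens; ring.
Qed.

Lemma continuous_gdens v : v != 0 -> continuous (gdens v).
Proof.
move=> v0 x; apply: differentiable_continuous; apply/derivable1_diffP.
by have [] := is_derive_gdens x v0.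
Qed.

Lemma measurable_gdens v : v != 0 -> measurable_fun setT (gdens v : TR -> R).
Proof. by move=> v0; apply: continuous_measurable_fun; exact: continuous_gdens. Qed.

Lemma gdens_cvg0 v : 0 < v -> gdens v x @[x --> +oo] --> 0.
Proof.
move=> v0; pose C := (2 * k)%:R * v.
have C0 : 0 < C by rewrite mulr_gt0// ltr0n muln_gt0.
apply: (@squeeze_cvgr _ _ _ _ (cst 0) (fun x => expR (- (x / C)))).
- near=> x; rewrite /= (ltW (gdens_gt0 _ _))/= /gdens ler_expR /exponent_Fhat lerN2.
  rewrite ler_pM2r ?invr_gt0// -[leLHS]expr1; apply: ler_weXn2l; last by rewrite muln_gt0.
  by near: x; apply: nbhs_pinfty_ge.
- exact: cvg_cst.
- have : (fun x => x / C) x @[x --> +oo] --> +oo.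
    by apply: gt0_cvgMly; rewrite ?invr_gt0//; exact: cvg_id.
  by move=> H; exact: (cvg_comp _ _ H (@cvgr_expR R)).
Unshelve. all: by end_near. Qed.

(** The integrand is minus the derivative of [gdens v]. *)
Lemma gdens_tail v x : 0 < v -> 0 <= x ->
  (\int[leb]_(t in `[x, +oo[) (t ^+ (2 * k).-1 / v * gdens v t)%:E = (gdens v x)%:E)%E.
Proof.
move=> v0 x0; have vn : v != 0 by rewrite gt_eqF.
have D t : is_derive t (1 : R) (fun t => - gdens v t) (t ^+ (2 * k).-1 / v * gdens v t).
  by have D := is_derive_gdens t vn; apply: is_derive_eq; rewrite opprK.
have cont : continuous (fun t => t ^+ (2 * k).-1 / v * gdens v t).
  move=> t; apply: (@continuousM _ _ (fun t => t ^+ (2 * k).-1 / v)); last exact: continuous_gdens.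
  by apply: continuousM; [exact: exprn_continuous|exact: cst_continuous].
rewrite (@ge0_continuous_FTC2y _ _ (fun t => - gdens v t) x 0).
- by rewrite -EFinB sub0r opprK.
- move=> t xt; rewrite mulr_ge0 ?divr_ge0 ?exprn_ge0 ?(ltW v0) ?(ltW (gdens_gt0 _ _))//.
  exact: le_trans xt.
- exact: continuous_subspaceT.
- by rewrite -oppr0; apply: cvgN; exact: gdens_cvg0.
- by move=> t _; have [] := D t.
- apply: cvg_at_right_filter; apply: cvgN; exact: continuous_gdens.
- by move=> t _; rewrite derive1E; have Dt := D t; exact: derive_val.
Qed.

(** Up to a constant it dominates every Lipschitz function times the density. *)
Definition gweight v x : R := (1 + `|x|) * gdens v x.

Lemma continuous_gweight v : v != 0 -> continuous (gweight v).
Proof.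
move=> v0 x; apply: (@continuousM _ _ (fun x : R => 1 + `|x|)); last exact: continuous_gdens.
by apply: continuousD; [exact: cst_continuous|exact: norm_continuous].
Qed.

Lemma gweight_ge0 v x : 0 <= gweight v x.
Proof. by rewrite mulr_ge0 ?addr_ge0 ?(ltW (gdens_gt0 _ _)). Qed.

Lemma measurable_gweight v : v != 0 -> measurable_fun setT (gweight v : TR -> R).
Proof. by move=> v0; apply: continuous_measurable_fun; exact: continuous_gweight. Qed.

(** A Mills ratio estimate: beyond 1 the weight [1 + t] is at most [2 * t ^+ (2 * k).-1], which
    makes the integrand an exact derivative. *)
Lemma gweight_tail v x : 0 < v -> 1 <= x ->
  (\int[leb]_(t in `[x, +oo[) (gweight v t)%:E <= (2 * v * gdens v x)%:E)%E.
Proof.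
move=> v0 x1; have vn : v != 0 by rewrite gt_eqF.
have x0 : 0 <= x by exact: le_trans x1.
have mg : measurable_fun setT (fun t : TR => t ^+ (2 * k).-1 / v * gdens v t).
  apply: measurable_funM; last by apply: continuous_measurable_fun; exact: continuous_gdens.
  by apply: measurable_funM => //; exact: measurable_funX.
have g0 (t : R) : x <= t -> 0 <= t ^+ (2 * k).-1 / v * gdens v t.
  move=> xt; rewrite mulr_ge0 ?divr_ge0 ?exprn_ge0 ?(ltW v0) ?(ltW (gdens_gt0 _ _))//.
  exact: le_trans xt.
rewrite EFinM -gdens_tail// -ge0_integralZl//.
- apply: ge0_le_integral => //.
  + by move=> t _; rewrite lee_fin gweight_ge0.
  + by apply/measurable_funTS/measurable_EFinP; exact: measurable_gweight.
  + by apply/measurable_funTS; apply: emeasurable_funM => //; exact/measurable_EFinP.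
  move=> t; rewrite /= in_itv/= andbT => xt; rewrite -EFinM lee_fin.
  have t1 := le_trans x1 xt.
  have -> : 2 * v * (t ^+ (2 * k).-1 / v * gdens v t) = 2 * t ^+ (2 * k).-1 * gdens v t by field.
  rewrite /gweight ler_wpM2r ?(ltW (gdens_gt0 _ _))// ger0_norm ?(le_trans ler01)//.
  have : t ^+ 1 <= t ^+ (2 * k).-1.
    by apply: ler_weXn2l => //; case: (k) k_gt0 => // ? _; rewrite mulnS.
  by rewrite expr1; lra.
- by apply/measurable_funTS/measurable_EFinP.
- by move=> t; rewrite /= in_itv/= andbT => xt; rewrite lee_fin g0.
- by rewrite lee_fin mulr_ge0// ltW.
Qed.

Lemma gweight_fin v : 0 < v -> (\int[leb]_t (gweight v t)%:E < +oo)%E.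
Proof.
move=> v0; have vn : v != 0 by rewrite gt_eqF.
have mw (A : set TR) : measurable_fun A (EFin \o (gweight v : TR -> R)).
  by apply/measurable_funTS/measurable_EFinP; exact: measurable_gweight.
have w0 (t : R) : (0 <= (gweight v t)%:E)%E by rewrite lee_fin gweight_ge0.
rewrite ge0_symfun_integralT; last 3 first.
- exact: gweight_ge0.
- exact: continuous_gweight.
- by move=> t; rewrite /gweight /= normrN gdensN.
apply: lte_mul_pinfty => //.
have E : [set x : R | 0 <= x]%classic = `[0, 1[%classic `|` `[1, +oo[%classic.
  apply/seteqP; split => t /=; rewrite !in_itv/= andbT.
    by move=> t0; have [t1|t1] := ltP t 1; [left; rewrite t0|right].
  by case=> [/andP[]|] // t1; exact: le_trans t1.
rewrite [X in integral _ X _]E ge0_integral_setU//=.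
- apply: lte_add_pinfty.
    have ci : leb.-integrable `[0, 1] (EFin \o gweight v).
      apply: continuous_compact_integrable; first exact: segment_compact.
      by apply: continuous_subspaceT; exact: continuous_gweight.
    have : leb.-integrable `[0, 1[ (EFin \o gweight v).
      by apply: integrableS ci => //; apply: subset_itvl; rewrite bnd_simp.
    case/integrableP => _; apply: le_lt_trans.
    rewrite le_eqVlt; apply/orP; left; apply/eqP; apply: eq_integral => t _.
    by rewrite /= ger0_norm ?gweight_ge0.
  by apply: le_lt_trans (gweight_tail v0 (lexx 1)) _; rewrite ltry.
- apply/disj_set2P; rewrite -subset0 => t /= [].
  rewrite !in_itv/= andbT => /andP[_ t1] t2.
  by move: (lt_le_trans t1 t2); rewrite ltxx.
Qed.

Lemma integrable_gdens v (f : TR -> R) A : 0 < v -> measurable_fun setT f ->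
  (forall t : R, `|f t| <= A * (1 + `|t|)) ->
  leb.-integrable setT (EFin \o (fun t => f t * gdens v t)).
Proof.
move=> v0 mf fA; have vn : v != 0 by rewrite gt_eqF.
have wi : leb.-integrable setT (EFin \o gweight v).
  apply/integrableP; split; first by apply/measurable_EFinP; exact: measurable_gweight.
  under eq_integral do rewrite /= ger0_norm ?gweight_ge0//.
  exact: gweight_fin.
apply: le_integrable (integrable_scale measurableT A wi) => //.
  apply/measurable_EFinP; apply: measurable_funM => //.
  by apply: continuous_measurable_fun; exact: continuous_gdens.
move=> t _; rewrite /= lee_fin normrM (gtr0_norm (gdens_gt0 _ _)) /gweight mulrA.
rewrite normrM (gtr0_norm (gdens_gt0 _ _)) ler_wpM2r ?(ltW (gdens_gt0 _ _))//.
by apply: le_trans (fA t) _; exact: ler_norm.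
Qed.

Lemma le_gdens v w x : 0 < v -> v <= w -> gdens v x <= gdens w x.
Proof.
move=> v0 vw; rewrite /gdens ler_expR /exponent_Fhat lerN2.
have w0 := lt_le_trans v0 vw.
have k20 : 0 < (2 * k)%:R :> R by rewrite ltr0n muln_gt0.
apply: ler_wpM2l; first by rewrite exprM exprn_ge0// sqr_ge0.
by rewrite lef_pV2 ?posrE ?mulr_gt0// ler_pM2l.
Qed.

Definition gmass v := exp_mass leb (exponent_Fhat k v).
Definition gfirst v := \int[leb]_t gweight v t.

Lemma gdens_integral_pos v : 0 < v -> (0 < \int[leb]_t (gdens v t)%:E)%E.
Proof.
move=> v0; have vn : v != 0 by rewrite gt_eqF.
apply: (@lt_le_trans _ _ (\int[leb]_(t in `[0%R, 1%R]) (gdens v 1)%:E)%E).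
  rewrite integral_cst//= lebesgue_measure_itv/= lte_fin ltr01 -EFinB subr0 mule1.
  by rewrite lte_fin gdens_gt0.
apply: (@le_trans _ _ (\int[leb]_(t in `[0%R, 1%R]) (gdens v t)%:E)%E).
  apply: ge0_le_integral => //.
  - by move=> t _; rewrite lee_fin ltW// gdens_gt0.
  - by apply/measurable_funTS/measurable_EFinP; exact: measurable_gdens.
  move=> t; rewrite /= in_itv/= => /andP[t0 t1].
  rewrite lee_fin /gdens ler_expR /exponent_Fhat lerN2 ler_wpM2r//.
    by rewrite invr_ge0 mulr_ge0// ltW.
  by rewrite expr1n exprn_ile1.
apply: ge0_subset_integral => //.
- by apply/measurable_EFinP; exact: measurable_gdens.
- by move=> t _; rewrite lee_fin ltW// gdens_gt0.
Qed.

Lemma gdens_integral_fin v : 0 < v -> (\int[leb]_t (gdens v t)%:E < +oo)%E.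
Proof.
move=> v0; have := @integrable_gdens v (cst 1) 1 v0 (@measurable_cst _ _ _ _ _ _).
move=> /(_ _)/integrableP[|_].
  by move=> t; rewrite normr1 mul1r lerDl.
apply: le_lt_trans; rewrite le_eqVlt; apply/orP; left; apply/eqP; apply: eq_integral => t _.
by rewrite /= mul1r gtr0_norm// gdens_gt0.
Qed.

Lemma gmassE v : gmass v = \int[leb]_t gdens v t. Proof. by []. Qed.

Lemma gmass_gt0 v : 0 < v -> 0 < gmass v.
Proof.
by move=> v0; apply: exp_mass_gt0; [exact: gdens_integral_fin|exact: gdens_integral_pos].
Qed.

Let gweight_int v : 0 < v -> leb.-integrable setT (EFin \o (gweight v : TR -> R)).
Proof.
move=> v0; apply: (@integrable_gdens v (fun t => 1 + `|t : R|) 1 v0) => [|t].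
  by apply: measurable_funD => //; exact: normr_measurable.
by rewrite mul1r ger0_norm ?addr_ge0.
Qed.

Let gdens_int v : 0 < v -> leb.-integrable setT (EFin \o (gdens v : TR -> R)).
Proof.
move=> v0; have := @integrable_gdens v (cst 1) 1 v0 (@measurable_cst _ _ _ _ _ _).
move=> H; apply: eq_integrable (H _) => // [t _|t]; first by rewrite /= mul1r.
by rewrite normr1 mul1r lerDl.
Qed.

Lemma gmass_le v w : 0 < v -> v <= w -> gmass v <= gmass w.
Proof.
move=> v0 vw; rewrite !gmassE; apply: le_Rintegral => //.
- exact: gdens_int.
- exact/gdens_int/(lt_le_trans v0).
by move=> t _; exact: le_gdens.
Qed.

Lemma gfirst_le v w : 0 < v -> v <= w -> gfirst v <= gfirst w.
Proof.
move=> v0 vw; apply: le_Rintegral => //.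
- exact: gweight_int.
- exact/gweight_int/(lt_le_trans v0).
by move=> t _; rewrite /gweight ler_wpM2l ?addr_ge0// le_gdens.
Qed.

Lemma gfirst_ge0 v : 0 <= gfirst v.
Proof. by apply: Rintegral_ge0 => t _; exact: gweight_ge0. Qed.

Lemma Fhat_integral v (f : TR -> R) A : 0 < v -> measurable_fun setT f ->
  (forall t : R, `|f t| <= A * (1 + `|t|)) ->
  \int[Fhat k v]_t f t = (gmass v)^-1 * \int[leb]_t (f t * gdens v t).
Proof.
move=> v0 mf fA; apply: Rintegral_gibbs => //.
- exact: gdens_integral_fin.
- exact: gdens_integral_pos.
- exact: integrable_gdens fA.
Qed.

End stein_equation.

(** * A bounded solution of the Stein equation *)

Section stein_solution.
Context {R : realType}.
Local Notation TR := (measurableTypeR R).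
Local Notation leb := (@lebesgue_measure R).
Variable k : nat.
Hypothesis k_gt0 : (0 < k)%N.
Implicit Types (v x t : R) (h : R -> R).

Section lipschitz_test_function.
Variables (h : R -> R) (D : R).
Hypothesis hD : forall x y, `|h x - h y| <= D * `|x - y|.

Lemma lipschitz_const_ge0 : 0 <= D.
Proof. by have := hD 0 1; rewrite sub0r normrN normr1 mulr1; exact: le_trans. Qed.

Lemma lipschitz_continuous : continuous h.
Proof.
have D1 : 0 < D + 1 by rewrite ltr_wpDl// lipschitz_const_ge0.
move=> x; apply/cvgrPdist_le => e e0; near=> y.
apply: le_trans (hD _ _) _; apply: (@le_trans _ _ ((D + 1) * `|x - y|)).
  by rewrite ler_wpM2r// lerDl.
rewrite mulrC -ler_pdivlMr//; near: y.
by apply: cvgr_dist_le => //; exact: divr_gt0.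
Unshelve. all: by end_near. Qed.

Lemma lipschitz_growth x : `|h x| <= (`|h 0| + D) * (1 + `|x|).
Proof.
have D0 := lipschitz_const_ge0; rewrite -[h x](subrK (h 0)).
apply: le_trans (ler_normD _ _) _; have := hD x 0; rewrite subr0.
have := normr_ge0 (h 0); have := normr_ge0 x; nra.
Qed.

Lemma measurable_lipschitz : measurable_fun setT (h : TR -> R).
Proof. by apply: continuous_measurable_fun; exact: lipschitz_continuous. Qed.

Variable v : R.
Hypothesis v_gt0 : 0 < v.
Let vn : v != 0. Proof. by rewrite gt_eqF. Qed.

Let Fh := \int[Fhat k v]_t h t.
Let ratio := gfirst k v / gmass k v.

Let gm0 : 0 < gmass k v. Proof. exact: gmass_gt0. Qed.

Let hp_int : leb.-integrable setT (EFin \o (fun t : TR => h t * gdens k v t)).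
Proof. exact: (integrable_gdens k_gt0 v_gt0 measurable_lipschitz lipschitz_growth). Qed.

Let FhE : Fh = (gmass k v)^-1 * \int[leb]_t (h t * gdens k v t).
Proof. exact: (Fhat_integral k_gt0 v_gt0 measurable_lipschitz lipschitz_growth). Qed.

Lemma gdens_integrable : leb.-integrable setT (EFin \o (gdens k v : TR -> R)).
Proof.
have := @integrable_gdens R k k_gt0 v (cst 1) 1 v_gt0 (@measurable_cst _ _ _ _ _ _).
move=> H; apply: eq_integrable (H _) => // [t _|t]; first by rewrite /= mul1r.
by rewrite normr1 mul1r lerDl.
Qed.

Lemma gweight_integrable : leb.-integrable setT (EFin \o (gweight k v : TR -> R)).
Proof.
apply: (@integrable_gdens R k k_gt0 v (fun t => 1 + `|t : R|) 1 v_gt0) => [|t].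
  by apply: measurable_funD => //; exact: normr_measurable.
by rewrite mul1r ger0_norm ?addr_ge0.
Qed.

(** The left-hand side averages [h t - h s] over [s], and [|t - s| <= (1 + |t|) (1 + |s|)]; [ratio]
    is the mean of [1 + |s|]. Unlike [lipschitz_growth], the bound is proportional to [D]. *)
Lemma Fhat_center t : `|h t - Fh| <= D * ratio * (1 + `|t|).
Proof.
have D0 := lipschitz_const_ge0.
have i1 : leb.-integrable setT (EFin \o (fun s : TR => h t * gdens k v s)).
  exact: (integrable_scale measurableT (h t) gdens_integrable).
have i2 := integrable_sub measurableT i1 hp_int.
have -> : h t - Fh = (gmass k v)^-1 * \int[leb]_s (h t * gdens k v s - h s * gdens k v s).
  rewrite RintegralB// RintegralZl//; last exact: gdens_integrable.
  by rewrite -gmassE mulrBr -FhE mulrC mulfK ?gt_eqF.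
have i3 : leb.-integrable setT (EFin \o (fun s : TR => D * (1 + `|t|) * gweight k v s)).
  exact: (integrable_scale measurableT (D * (1 + `|t|)) gweight_integrable).
rewrite normrM gtr0_norm ?invr_gt0// ler_pdivrMl// /ratio.
have -> : gmass k v * (D * (gfirst k v / gmass k v) * (1 + `|t|)) = D * (1 + `|t|) * gfirst k v.
  by field; rewrite gt_eqF.
rewrite /gfirst -RintegralZl//; last exact: gweight_integrable.
apply: le_trans (le_normr_Rintegral _ i2) _ => //.
apply: le_Rintegral => //; first exact: integrable_norm i2.
move=> s _ /=; rewrite -mulrBl normrM (gtr0_norm (gdens_gt0 _ _ _)) /gweight mulrA.
rewrite ler_wpM2r ?(ltW (gdens_gt0 _ _ _))//; apply: le_trans (hD _ _) _.
rewrite -mulrA ler_wpM2l//; apply: le_trans (ler_normB _ _) _.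
by have := mulr_ge0 (normr_ge0 t) (normr_ge0 s); lra.
Qed.

Let q t := (h t - Fh) * gdens k v t.
Let Gam x := \int[leb]_(t in `]-oo, x]) q t.
Let K := D * ratio.

Let q_le t : `|q t| <= K * gweight k v t.
Proof.
rewrite /q normrM (gtr0_norm (gdens_gt0 _ _ _)) /gweight mulrA.
by rewrite ler_wpM2r ?(ltW (gdens_gt0 _ _ _))// Fhat_center.
Qed.

Let K_ge0 : 0 <= K.
Proof.
by rewrite /K mulr_ge0 ?lipschitz_const_ge0// divr_ge0 ?gfirst_ge0// ltW.
Qed.

Let q_cont : continuous q.
Proof.
move=> x; apply: (@continuousM _ _ (fun t => h t - Fh)); last exact: continuous_gdens.
by apply: (@continuousB _ _ _ h); [exact: lipschitz_continuous|exact: cst_continuous].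
Qed.

Let q_int : leb.-integrable setT (EFin \o q).
Proof.
have mh : measurable_fun setT (fun t : TR => h t - Fh).
  by apply: measurable_funB => //; exact: measurable_lipschitz.
exact: (integrable_gdens k_gt0 v_gt0 mh Fhat_center).
Qed.

Let q_int_on (A : set TR) : measurable A -> leb.-integrable A (EFin \o q).
Proof. by move=> mA; exact: integrableS q_int. Qed.

Let q_total : \int[leb]_t q t = 0.
Proof.
have i1 := integrable_scale measurableT Fh gdens_integrable.
under eq_Rintegral do rewrite /q mulrBl.
rewrite RintegralB// RintegralZl//; last exact: gdens_integrable.
by rewrite -gmassE FhE mulrAC mulVf ?mul1r ?subrr// gt_eqF.
Qed.

(** Centering [h] makes the total integral vanish, so [Gam] is small at both ends of the line. *)
Let Gam_right x : Gam x = - \int[leb]_(t in `]x, +oo[) q t.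
Proof.
have E : [set: TR] = `]-oo, x]%classic `|` `]x, +oo[%classic.
  apply/seteqP; split => t //= _; rewrite !in_itv/= andbT.
  by have [|] := leP t x; [left|right].
have := q_total; rewrite [X in Rintegral _ X _]E Rintegral_setU//.
- by move=> H; apply/eqP; rewrite -addr_eq0; apply/eqP.
- by rewrite -E.
- apply/disj_set2P; rewrite -subset0 => t /= [].
  by rewrite !in_itv/= andbT => t1 t2; move: (lt_le_trans t2 t1); rewrite ltxx.
Qed.

Let tail_bound (A : set TR) (c : R) : measurable A ->
  (\int[leb]_(t in A) (gweight k v t)%:E <= c%:E)%E -> `|\int[leb]_(t in A) q t| <= K * c.
Proof.
move=> mA Ac; apply: le_trans (le_normr_Rintegral mA (q_int_on mA)) _.
have iw : leb.-integrable A (EFin \o (gweight k v : TR -> R)) by exact: integrableS gweight_integrable.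
apply: (@le_trans _ _ (\int[leb]_(t in A) (K * gweight k v t))).
  apply: le_Rintegral => //; first exact: integrable_norm (q_int_on mA).
    exact: (integrable_scale mA K iw).
rewrite RintegralZl// ler_wpM2l// -lee_fin /Rintegral fineK//.
exact: integrable_fin_num iw.
Qed.

(** The tail that does not contain the origin is used: the right one for x >= 1, the left one, by
    reflection, for x <= -1. In between the whole integral is taken and
    [gdens k v x >= gdens k v 1]. *)
Let Gam_bound x : `|Gam x| <= K * (2 * v + gfirst k v / gdens k v 1) * gdens k v x.
Proof.
have gx := gdens_gt0 k v x; have g1 := gdens_gt0 k v 1.
have r0 : 0 <= gfirst k v / gdens k v 1 by rewrite divr_ge0 ?gfirst_ge0// ltW.
have v2 : 0 <= 2 * v by rewrite mulr_ge0// ltW.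
rewrite -mulrA; have [x1|x1] := leP 1 x.
  apply: (@le_trans _ _ (K * (2 * v * gdens k v x))); last first.
    by rewrite ler_wpM2l// ler_wpM2r ?(ltW gx)// lerDl.
  rewrite Gam_right normrN; apply: tail_bound => //.
  apply: le_trans (gweight_tail k_gt0 v_gt0 x1).
  apply: ge0_subset_integral => //.
  - by apply/measurable_funTS/measurable_EFinP; exact: measurable_gweight.
  - by move=> t _; rewrite lee_fin gweight_ge0.
  - by apply: subset_itvr; rewrite bnd_simp.
have [x2|x2] := leP x (- 1).
  apply: (@le_trans _ _ (K * (2 * v * gdens k v x))); last first.
    by rewrite ler_wpM2l// ler_wpM2r ?(ltW gx)// lerDl.
  apply: tail_bound => //.
  have := gweight_tail k_gt0 v_gt0 (_ : 1 <= - x); rewrite gdensN => H.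
  rewrite -(opprK x) ge0_integration_by_substitutionNy.
  - rewrite opprK; apply: le_trans (H _); last by lra.
    rewrite le_eqVlt; apply/orP; left; apply/eqP; apply: eq_integral => t _.
    by rewrite /= /gweight normrN gdensN.
  - by apply: continuous_subspaceT; exact: continuous_gweight.
  - by move=> t _; exact: gweight_ge0.
have xa : `|x| <= 1 by rewrite ler_norml (ltW x1) ltW.
apply: (@le_trans _ _ (K * (gfirst k v / gdens k v 1 * gdens k v x))); last first.
  by rewrite ler_wpM2l// ler_wpM2r ?(ltW gx)// lerDr.
apply: tail_bound => //.
apply: (@le_trans _ _ (gfirst k v)%:E).
  rewrite /gfirst /Rintegral fineK; last exact: integrable_fin_num gweight_integrable.
  apply: ge0_subset_integral => //.
  - by apply/measurable_EFinP; exact: measurable_gweight.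
  - by move=> t _; rewrite lee_fin gweight_ge0.
rewrite lee_fin mulrAC ler_pdivlMr// ler_wpM2l ?gfirst_ge0//.
rewrite /gdens ler_expR /exponent_Fhat lerN2 ler_wpM2r ?invr_ge0 ?mulr_ge0 ?(ltW v_gt0)//.
by rewrite expr1n (le_trans (ler_norm _))// normrX exprn_ile1.
Qed.

(** The integrating factor [gdens] gives the solution [Gam / gdens], which is bounded because [Gam]
    decays at least as fast as the density. *)
Lemma stein_solution : exists g : R -> R,
  (forall x, `|g x| <= D * ratio * (2 * v + gfirst k v / gdens k v 1)) /\
  forall x, is_derive x (1 : R) g (x ^+ (2 * k).-1 / v * g x + (h x - Fh)).
Proof.
exists (fun x => Gam x * (gdens k v x)^-1); split => x.
  rewrite normrM normfV (gtr0_norm (gdens_gt0 _ _ _)).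
  by rewrite ler_pdivrMr ?gdens_gt0.
have [dG eG] : derivable Gam x 1 /\ derive1 Gam x = q x.
  apply: (@continuous_FTC1 _ q -oo%O x (x + 1)).
  - by rewrite ltrDl.
  - exact: q_int_on.
  - by rewrite ltNyr.
  - exact: q_cont.
have DG : is_derive x (1 : R) Gam (q x) by split => //; rewrite -derive1E.
have gn : gdens k v x != 0 by rewrite gt_eqF ?gdens_gt0.
have DV := is_deriveV gn (is_derive_gdens k_gt0 x vn).
apply: (is_derive_eq (is_deriveM DG DV)).
by rewrite /q /GRing.scale/=; field; rewrite gn vn.
Qed.

End lipschitz_test_function.

End stein_solution.

Section uniform_stein_solution.
Context {R : realType}.
Local Notation TR := (measurableTypeR R).
Variables (k : nat) (v0 v1 : R).
Hypothesis k_gt0 : (0 < k)%N.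
Hypothesis v0_gt0 : 0 < v0.

(** The constants of [stein_solution] at their worst over [v0, v1]: [gfirst], [gmass] and [gdens]
    increase with the parameter, so numerators are taken at [v1] and denominators at [v0]. Up to the
    factor [D], [M] bounds the solution, [L] the growth of its derivative and [B] also the
    increments of that derivative. *)
Let r : R := gfirst k v1 / gmass k v0.
Let M : R := r * (2 * v1 + gfirst k v1 / gdens k v0 1).
Let L : R := M / v0 + r.
Let B : R := M + L + ((2 * k)%:R * M + L) / v0 + 1.

Section fixed_variance.
Variables (h : R -> R) (D v : R).
Hypothesis hD : forall x y, `|h x - h y| <= D * `|x - y|.
Hypothesis v0v : v0 <= v.
Hypothesis vv1 : v <= v1.

Let v_gt0 : 0 < v. Proof. exact: lt_le_trans v0v. Qed.
Let v1_gt0 : 0 < v1. Proof. exact: lt_le_trans vv1. Qed.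
Let D0 : 0 <= D. Proof. exact: lipschitz_const_ge0 hD. Qed.
Let r0 : 0 <= r.
Proof. by rewrite divr_ge0 ?gfirst_ge0// ltW// gmass_gt0. Qed.
Let M0 : 0 <= M.
Proof.
apply: mulr_ge0 => //; apply: addr_ge0; first by rewrite mulr_ge0// ltW.
by rewrite divr_ge0 ?gfirst_ge0// ltW// gdens_gt0.
Qed.
Let L0 : 0 <= L. Proof. by rewrite addr_ge0// divr_ge0// ltW. Qed.
Let X0 : 0 <= ((2 * k)%:R * M + L) / v0.
Proof. by rewrite divr_ge0 ?(ltW v0_gt0)// addr_ge0// mulr_ge0. Qed.

Let ratio_le : gfirst k v / gmass k v <= r.
Proof.
apply: ler_pM; rewrite ?gfirst_ge0 ?invr_ge0 ?(ltW (gmass_gt0 _ _))//.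
  exact: gfirst_le.
by rewrite lef_pV2 ?posrE ?gmass_gt0// gmass_le.
Qed.

Variable g : R -> R.
Local Notation Fh := (\int[Fhat k v]_t h t).
Let g1 x : R := x ^+ (2 * k).-1 / v * g x + (h x - Fh).
Hypothesis gB : forall x, `|g x| <=
  D * (gfirst k v / gmass k v) * (2 * v + gfirst k v / gdens k v 1).
Hypothesis g_deriv : forall x, is_derive x (1 : R) g (g1 x).

Let g_le x : `|g x| <= D * M.
Proof.
apply: le_trans (gB x) _; rewrite -mulrA ler_wpM2l//.
have gd : 0 < gdens k v 1 by exact: gdens_gt0.
apply: ler_pM => //.
- by rewrite divr_ge0 ?gfirst_ge0// ltW// gmass_gt0.
- by rewrite addr_ge0 ?divr_ge0 ?gfirst_ge0 ?(ltW gd)// mulr_ge0// ltW.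
apply: lerD; first by rewrite ler_wpM2l.
apply: ler_pM; rewrite ?gfirst_ge0 ?invr_ge0 ?(ltW gd)//; first exact: gfirst_le.
by rewrite lef_pV2 ?posrE ?gdens_gt0// le_gdens.
Qed.

Let g1_le x w : 1 + `|x| <= w -> `|g1 x| <= D * L * w ^+ (2 * k).
Proof.
move=> xw; have w1 : 1 <= w by apply: le_trans xw; rewrite lerDl.
have w0 := le_trans ler01 w1.
have xw' : `|x| <= w by apply: le_trans xw; rewrite lerDr.
apply: le_trans (ler_normD _ _) _.
have -> : D * L * w ^+ (2 * k) = w ^+ (2 * k) / v0 * (D * M) + D * r * w ^+ (2 * k).
  by rewrite /L; ring.
apply: lerD.
  rewrite normrM; apply: ler_pM => //.
  rewrite normrM normfV (gtr0_norm v_gt0) normrX.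
  apply: ler_pM; rewrite ?exprn_ge0 ?invr_ge0 ?(ltW v_gt0)//.
    apply: (@le_trans _ _ (w ^+ (2 * k).-1)); first by apply: lerXn2r; rewrite ?nnegrE.
    by apply: ler_weXn2l => //; exact: leq_pred.
  by rewrite lef_pV2 ?posrE.
apply: le_trans (Fhat_center k_gt0 hD v_gt0 x) _.
apply: ler_pM; [|by rewrite addr_ge0|by rewrite ler_wpM2l|].
  by rewrite mulr_ge0// divr_ge0 ?gfirst_ge0// ltW// gmass_gt0.
by apply: le_trans xw _; rewrite -[leLHS]expr1; apply: ler_weXn2l => //; rewrite muln_gt0.
Qed.

Let between (x u z w : R) : `|x| + `|u| <= w -> `|z - x| <= `|u| -> `|z| <= w.
Proof.
move=> h1 h2; rewrite -[z](subrK x); apply: le_trans (ler_normD _ _) _.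
by apply: le_trans h1; rewrite addrC lerD2l.
Qed.

Let mvt (x u : R) : exists2 z, `|z - x| <= `|u| & g (x + u) - g x = u * g1 z.
Proof.
have [z /andP[z1 z2] ->] := mean_value g_deriv x (x + u); exists z; last first.
  by rewrite addrAC subrr add0r mulrC.
move: z1 z2; rewrite ge_min le_max ler_norml => /orP z1 /orP z2.
have := ler_norm u; have := ler_norm (- u); rewrite normrN.
by case: z1; case: z2; lra.
Qed.

Let g_increment (x u w : R) : 1 + `|x| + `|u| <= w ->
  `|g (x + u) - g x| <= `|u| * (D * L * w ^+ (2 * k)).
Proof.
move=> xw; have [z zx ->] := mvt x u.
rewrite normrM ler_wpM2l//; apply: g1_le.
rewrite -lerBrDl; apply: between zx.
by rewrite lerBrDl addrA.
Qed.

Let pow_increment (x u w : R) : 0 <= w -> `|x| + `|u| <= w -> 1 <= w ->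
  `|(x + u) ^+ (2 * k).-1 - x ^+ (2 * k).-1| <= (2 * k)%:R * `|u| * w ^+ (2 * k).
Proof.
move=> w0 xw w1; have -> : (2 * k).-1 = ((2 * k.-1).+1)%N.
  by rewrite -{1}(prednK k_gt0) mulnS.
apply: le_trans (power_increment _ _ _) _.
have m2k : ((2 * k.-1).+1 <= 2 * k)%N by rewrite -{2}(prednK k_gt0) mulnS.
apply: ler_pM; rewrite ?mulr_ge0 ?exprn_ge0 ?addr_ge0//.
  by rewrite ler_wpM2r// ler_nat.
apply: (@le_trans _ _ (w ^+ (2 * k.-1))); first by apply: lerXn2r; rewrite ?nnegrE ?addr_ge0.
by apply: ler_weXn2l => //; exact: ltnW.
Qed.

(** It takes the place of a second derivative. The right-hand side of the Stein equation is a
    product of locally Lipschitz functions plus [h]; the degree [4 * k] comes from a power of [x]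
    times an increment of [g]. *)
Let g1_increment (x u w : R) : 1 + `|x| + `|u| <= w ->
  `|g1 (x + u) - g1 x| <= D * B * `|u| * w ^+ (4 * k).
Proof.
move=> xw; have w1 : 1 <= w by apply: le_trans xw; rewrite -addrA lerDl addr_ge0.
have w0 := le_trans ler01 w1.
have xuw : `|x| + `|u| <= w by apply: le_trans xw; rewrite -addrA lerDr.
have x_le : `|x| <= w by apply: le_trans xuw; rewrite lerDl.
have -> : g1 (x + u) - g1 x = v^-1 * (((x + u) ^+ (2 * k).-1 - x ^+ (2 * k).-1) * g (x + u)) +
    v^-1 * (x ^+ (2 * k).-1 * (g (x + u) - g x)) + (h (x + u) - h x).
  by rewrite /g1; field; rewrite gt_eqF.
have vi : 0 <= v^-1 <= v0^-1.
  by rewrite invr_ge0 (ltW v_gt0) lef_pV2 ?posrE.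
have [vi0 viv] := andP vi.
have q2 : w ^+ (2 * k) <= w ^+ (4 * k) by apply: ler_weXn2l => //; rewrite leq_mul2r orbT.
have q1 : 1 <= w ^+ (4 * k) by rewrite exprn_ege1.
have q4 : w ^+ (2 * k) * w ^+ (2 * k) = w ^+ (4 * k) by rewrite -exprD -mulnDl.
have p1 : `|v^-1 * (((x + u) ^+ (2 * k).-1 - x ^+ (2 * k).-1) * g (x + u))| <=
    v0^-1 * (((2 * k)%:R * `|u| * w ^+ (4 * k)) * (D * M)).
  rewrite normrM (ger0_norm vi0); apply: ler_pM => //.
  rewrite normrM; apply: ler_pM => //; apply: le_trans (pow_increment w0 xuw w1) _.
  by rewrite ler_wpM2l// mulr_ge0.
have p2 : `|v^-1 * (x ^+ (2 * k).-1 * (g (x + u) - g x))| <=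
    v0^-1 * (`|u| * (D * L * w ^+ (4 * k))).
  rewrite normrM (ger0_norm vi0); apply: ler_pM => //.
  rewrite normrM -q4 [leRHS](_ : _ = w ^+ (2 * k) * (`|u| * (D * L * w ^+ (2 * k)))); last by ring.
  apply: ler_pM => //; last exact: g_increment.
  rewrite normrX; apply: (@le_trans _ _ (w ^+ (2 * k).-1)); first by apply: lerXn2r; rewrite ?nnegrE.
  by apply: ler_weXn2l => //; exact: leq_pred.
have p3 : `|h (x + u) - h x| <= D * `|u| * w ^+ (4 * k).
  apply: le_trans (hD _ _) _; rewrite [x + u]addrC addrK -[leLHS]mulr1.
  by rewrite ler_wpM2l// mulr_ge0.
have p4 : 0 <= D * (M + L) * `|u| * w ^+ (4 * k).
  by do 2 (apply: mulr_ge0; [|by rewrite ?exprn_ge0]); rewrite mulr_ge0// addr_ge0.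
apply: le_trans (ler_normD _ _) _; apply: le_trans (lerD (ler_normD _ _) (lexx _)) _.
apply: le_trans (lerD (lerD p1 p2) p3) _.
have -> : D * B * `|u| * w ^+ (4 * k) = (v0^-1 * (((2 * k)%:R * `|u| * w ^+ (4 * k)) * (D * M)) +
   v0^-1 * (`|u| * (D * L * w ^+ (4 * k))) + D * `|u| * w ^+ (4 * k)) +
   D * (M + L) * `|u| * w ^+ (4 * k) by rewrite /B; ring.
by rewrite lerDl.
Qed.

Lemma stein_solution_smooth : smooth_growth (D * B) (4 * k) g g1.
Proof.
have cg : continuous g.
  by move=> x; apply: differentiable_continuous; apply/derivable1_diffP; have [] := g_deriv x.
have pg : poly_growth1 (g : TR -> R).
  split; first exact: continuous_measurable_fun.
  by exists (D * M), 0%N => x; rewrite expr0 mulr1.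
have LB : D * L <= D * B by rewrite ler_wpM2l// /B; move: L0 M0 X0; lra.
have MB : D * M <= D * B by rewrite ler_wpM2l// /B; move: L0 M0 X0; lra.
have DB0 : 0 <= D * B by apply: le_trans MB; exact: mulr_ge0.
have q2 (w : R) : 1 <= w -> w ^+ (2 * k) <= w ^+ (4 * k).
  by move=> w1; apply: ler_weXn2l => //; rewrite leq_mul2r orbT.
split => //.
- apply: pg1D.
    apply: pg1M => //; apply: pg1M; last exact: pg1_cst.
    by apply: pg1X; exact: pg1_id.
  apply: pg1B; last exact: pg1_cst.
  split; first exact: measurable_lipschitz hD.
  by exists (`|h 0| + D), 1%N => x; rewrite expr1; exact: lipschitz_growth hD x.
- move=> x; apply: le_trans (g_le x) _; apply: le_trans MB _.
  by rewrite -[leLHS]mulr1 ler_wpM2l// exprn_ege1// lerDl.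
- move=> x; apply: le_trans (g1_le (lexx _)) _.
  have w1 : 1 <= 1 + `|x| by rewrite lerDl.
  apply: ler_pM; [exact: mulr_ge0| |exact: LB|exact: q2].
  by rewrite exprn_ge0// (le_trans ler01).
move=> x u; set w := 1 + `|x| + `|u|; have w1 : 1 <= w by rewrite /w -addrA lerDl addr_ge0.
have w0 := le_trans ler01 w1.
split.
  apply: le_trans (g_increment (lexx _)) _; rewrite -/w.
  rewrite mulrCA mulrA; apply: ler_pM; [|exact: exprn_ge0| |exact: q2].
    by rewrite mulr_ge0// mulr_ge0.
  by rewrite ler_wpM2r.
have [z zx ->] := mvt x u.
rewrite -mulrBr normrM -[u ^+ 2]real_normK ?num_real// expr2.
rewrite [leRHS](_ : _ = `|u| * (D * B * `|u| * w ^+ (4 * k))); last by ring.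
rewrite ler_wpM2l// -[z](subrK x) [z - x + x]addrC.
apply: le_trans (g1_increment (lexx _)) _; apply: ler_pM.
- by rewrite mulr_ge0.
- by rewrite exprn_ge0// !addr_ge0.
- by rewrite ler_wpM2l.
by apply: lerXn2r; rewrite ?nnegrE ?addr_ge0// /w lerD2l.
Qed.

End fixed_variance.

Lemma uniform_stein_solution : exists B' : R, forall h D v,
  (forall x y, `|h x - h y| <= D * `|x - y|) -> v0 <= v <= v1 ->
  exists g, smooth_growth (D * B') (4 * k) g
    (fun x => x ^+ (2 * k).-1 / v * g x + (h x - \int[Fhat k v]_t h t)).
Proof.
exists B => h D v hD /andP[v0v vv1].
have [g [gB gd]] := stein_solution k_gt0 hD (lt_le_trans v0_gt0 v0v).
by exists g; exact: (stein_solution_smooth hD v0v vv1 gB gd).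
Qed.

End uniform_stein_solution.

(** * The parameter of the limit law and lower moment bounds *)

Section distance_to_limit.
Context {R : realType}.
Local Notation TR := (measurableTypeR R).
Variables (rho : probability TR R) (beta : R) (k : nat) (mu : R).
Hypothesis rhoGHS : GHS rho.
Hypothesis var1 : emom rho 2 0 = 1.
Hypothesis beta_gt0 : 0 < beta.
Hypothesis type0 : has_type_strength (G rho beta) 0 k mu.

Let rhoB : classB rho := rhoGHS.1.
Local Notation E := (cwE rho beta).
Local Notation eps := (cw_eps (R := R) k).
Local Notation a := (cw_scale (R := R) k).
Local Notation c := (drift_coef beta k mu).
Local Notation V n := (fun z : TR * TR => a n * (z.2 : R)).

Let k_gt0 : (0 < k)%N. Proof. by case: type0. Qed.
Let k2 : ((2 * k).-1).+1 = (2 * k)%N. Proof. by rewrite prednK// muln_gt0. Qed.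
Let a0 n : 0 < a n. Proof. exact: cw_scale_gt0. Qed.
Let a1 n : a n <= 1. Proof. exact: (cw_scale_le1 k_gt0). Qed.
Let e1 n : eps n <= 1. Proof. exact: (cw_eps_le1 k_gt0). Qed.
Let pgV n : poly_growth (V n). Proof. exact: pg_V. Qed.
Let pgm n p : poly_growth (fun z : TR * TR => (1 + `|a n * (z.2 : R)| + `|z.1 : R|) ^+ p).
Proof.
apply: pgX; apply: pgD; last by apply: pg_norm; exact: pg_fst.
by apply: pgD; [exact: pg_cst|apply: pg_norm; exact: pgV].
Qed.

Definition cwW n (z : TR * TR) : R := a n * ((z.1 : R) + z.2).

Let cwWE n z : cwW n z = V n z + a n * z.1.
Proof. by rewrite /cwW mulrDr addrC. Qed.

Lemma pg_cwW n : poly_growth (cwW n).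
Proof. by apply: pgZ; apply: pgD; [exact: pg_fst|exact: pg_snd]. Qed.

(** Given V the tilt of X is at most [beta * |V|], so the moments of X are controlled by those of
    V. *)
Lemma mixed_moments p : exists2 C, 0 <= C &
  forall n, E n (fun z => (1 + `|V n z| + `|z.1 : R|) ^+ p) <= C.
Proof.
have [C C0 HC] := uniform_moments rhoGHS beta_gt0 type0 p.
have [K K0 HK] := tilt_growth_le rhoB p (ltW beta_gt0).
exists (K * C) => [|n]; first exact: mulr_ge0.
apply: (@le_trans _ _ (K * E n (fun z => (1 + `|V n z|) ^+ p))); last first.
  by rewrite ler_wpM2l//; exact: HC.
have pgw : poly_growth (fun z => (1 + `|V n z|) ^+ p).
  by apply: pgX; apply: pgD; [exact: pg_cst|apply: pg_norm; exact: pgV].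
rewrite -cwEZ//.
apply: (@cwE_le_tilt _ _ _ rhoB beta_gt0 n _ (fun y : TR => K * (1 + `|a n * (y : R)|) ^+ p)) => //.
  apply: pg1Z; apply: pg1X; apply: pg1D; first exact: pg1_cst.
  by apply: pg1_norm; apply: pg1Z; exact: pg1_id.
move=> y; rewrite (cw_field k_gt0).
apply: (HK (beta * (eps n * (a n * y))) (a n * y)).
rewrite normrM gtr0_norm// ler_wpM2l ?(ltW beta_gt0)// normrM gtr0_norm; last exact: cw_eps_gt0.
by rewrite -[leRHS]mul1r ler_wpM2r.
Qed.

(** Given Y = y, the mean of (X + y)^2 is m2 + 2 y m1 + y^2, where m2 >= 1 and y m1 >= 0 because the
    tilt has the sign of y. *)
Lemma second_moment_ge1 n : 1 <= E n (fun z => ((z.1 : R) + z.2) ^+ 2) /\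
  1 <= E n (fun z => (z.1 : R) ^+ 2).
Proof.
have N0 : 0 < beta / n.+1%:R by rewrite divr_gt0.
have pS : poly_growth (fun z : TR * TR => ((z.1 : R) + z.2) ^+ 2).
  by apply: pgX; apply: pgD; [exact: pg_fst|exact: pg_snd].
have pX : poly_growth (fun z : TR * TR => (z.1 : R) ^+ 2) by apply: pgX; exact: pg_fst.
have p1 : poly_growth (fun=> 1 : R) by exact: pg_cst.
have pgx : poly_growth1 (fun x : TR => x : R) by exact: pg1_id.
have pgx2 : poly_growth1 (fun x : TR => (x : R) ^+ 2) by exact: pg1X.
split; rewrite -subr_le0 -(cwE_cst rho beta n 1) -cwEB// -(cwE_cst rho beta n 0).
- apply: (@cwE_le_tilt _ _ _ rhoB beta_gt0 n _ (fun=> 0)); [exact: pgB|exact: pg1_cst|] => y.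
  set h := beta / n.+1%:R * y.
  have -> : (fun x : TR => 1 - ((x : R) + y) ^+ 2) =
      (fun x : TR => (1 - y ^+ 2) + ((- (2 * y)) * x + (-1) * (x : R) ^+ 2)).
    by apply/funext => x; ring.
  rewrite tiltD//; [|exact: pg1_cst|by apply: pg1D; exact: pg1Z].
  rewrite tilt_cst// tiltD//; try exact: pg1Z.
  rewrite !tiltZ// tilt_id tilt_sqr.
  have := tsquare_ge1 rhoB var1 h; have := tmean_ge0 rhoB h.
  rewrite {1}/h -mulrA pmulr_rge0// => t1 t2; have := sqr_ge0 y; lra.
- apply: (@cwE_le_tilt _ _ _ rhoB beta_gt0 n _ (fun=> 0)); [exact: pgB|exact: pg1_cst|] => y.
  have -> : (fun x : TR => 1 - (x : R) ^+ 2) = (fun x : TR => 1 + (-1) * (x : R) ^+ 2).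
    by apply/funext => x; ring.
  rewrite tiltD//; [|exact: pg1_cst|exact: pg1Z].
  rewrite tilt_cst// tiltZ// tilt_sqr.
  by have := tsquare_ge1 rhoB var1 (beta / n.+1%:R * y); lra.
Qed.

(** From [x^2 <= 1/4 + 2 x^3] for x >= 0, checked separately on both sides of 1/2, follows 1 <= 1/4
    + 2 E|X|^3. *)
Lemma third_moment_ge n : 3 / 8 <= E n (fun z => `|z.1 : R| ^+ 3).
Proof.
have [_ H] := second_moment_ge1 n.
have p3 : poly_growth (fun z : TR * TR => `|z.1 : R| ^+ 3) by apply: pgX; apply: pg_norm; exact: pg_fst.
have p1 : poly_growth (fun=> 4^-1 : R) by exact: pg_cst.
have p2 : poly_growth (fun z : TR * TR => 2 * `|z.1 : R| ^+ 3) by exact: pgZ.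
have : E n (fun z => (z.1 : R) ^+ 2) <= E n (fun z => 4^-1 + 2 * `|z.1 : R| ^+ 3).
  apply: le_cwE => //; first by apply: pgX; exact: pg_fst.
    exact: pgD.
  move=> z; rewrite -[_ ^+ 2]real_normK ?num_real//; set x := `|_|.
  have x0 : 0 <= x by exact: normr_ge0.
  have [x1|x1] := leP x 2^-1.
    have : 0 <= x ^+ 3 by rewrite exprn_ge0.
    have : x ^+ 2 <= 4^-1 by nra.
    lra.
  have -> : 2 * x ^+ 3 = (2 * x) * x ^+ 2 by ring.
  have := sqr_ge0 x; nra.
rewrite cwED// cwEZ// cwE_cst; lra.
Qed.

(** From [x <= 1/2 + 2^(k-1) x^k] with x = S^2, checked on both sides of 1/2, follows 1 <= 1/2 +
    2^(k-1) E S^(2k). *)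
Lemma even_moment_ge n : 2^-1 ^+ k <= E n (fun z => ((z.1 : R) + z.2) ^+ (2 * k)).
Proof.
have [H _] := second_moment_ge1 n.
have p3 : poly_growth (fun z : TR * TR => ((z.1 : R) + z.2) ^+ (2 * k)).
  by apply: pgX; apply: pgD; [exact: pg_fst|exact: pg_snd].
have p1 : poly_growth (fun=> 2^-1 : R) by exact: pg_cst.
have p2 : poly_growth (fun z : TR * TR => 2 ^+ k.-1 * ((z.1 : R) + z.2) ^+ (2 * k)) by exact: pgZ.
have : E n (fun z => ((z.1 : R) + z.2) ^+ 2) <=
    E n (fun z => 2^-1 + 2 ^+ k.-1 * ((z.1 : R) + z.2) ^+ (2 * k)).
  apply: le_cwE => //; first by apply: pgX; apply: pgD; [exact: pg_fst|exact: pg_snd].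
    exact: pgD.
  move=> z; rewrite exprM; set x := _ ^+ 2; have x0 : 0 <= x by exact: sqr_ge0.
  have [x1|x1] := leP x 2^-1.
    by apply: le_trans x1 _; rewrite lerDl; apply: mulr_ge0; apply: exprn_ge0.
  have -> : 2 ^+ k.-1 * x ^+ k = (2 * x) ^+ k.-1 * x.
    have -> : x ^+ k = x ^+ k.-1 * x by rewrite -exprSr prednK.
    by rewrite (exprMn k.-1 2 x) mulrA.
  have : 1 <= (2 * x) ^+ k.-1 by apply: exprn_ege1; lra.
  nra.
rewrite cwED// cwEZ// cwE_cst => H2; rewrite exprVn -{1}(prednK k_gt0) exprS invfM.
rewrite mulrC ler_pdivrMl//; lra.
Qed.

Lemma smooth_growth_id : smooth_growth 1 1 (fun x : R => x) (fun=> 1).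
Proof.
split.
- exact: pg1_id.
- exact: pg1_cst.
- by move=> v; rewrite mul1r expr1 lerDr.
- by move=> v; rewrite mul1r expr1 normr1 lerDl.
move=> v u; rewrite mulr1 addrAC subrr add0r subrr normr0 !mul1r expr1; split.
  by rewrite -[leLHS]mulr1 ler_wpM2l// -addrA lerDl addr_ge0.
by rewrite mulr_ge0 ?sqr_ge0// !addr_ge0.
Qed.

Definition cwv n := E n (fun z => cwW n z ^+ (2 * k)).

Let rate n := eps n ^+ 2 + a n.

Let rate_ge0 n : 0 <= rate n.
Proof. by rewrite /rate addr_ge0 ?sqr_ge0// ltW. Qed.

Let rate_ge_a n : a n <= rate n.
Proof. by rewrite /rate lerDr sqr_ge0. Qed.

Lemma cwv_near : exists2 C, 0 <= C & forall n, `|c * cwv n - 1| <= C * rate n.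
Proof.
have [K K0 HK] := stein_expectation rhoGHS var1 beta_gt0 type0 1.
have [M M0 HM] := uniform_moments rhoGHS beta_gt0 type0 (1 + 2 * k + 3).
have [L L0 HL] := mixed_moments (2 * k).
have c0 : 0 <= c by apply: ltW; exact: drift_coef_gt0 type0.
exists (K * M + c * ((2 * k)%:R * L)).
  by apply: addr_ge0; apply: mulr_ge0 => //; exact: mulr_ge0.
move=> n.
have pV : poly_growth (fun z => V n z ^+ (2 * k)) by exact: pgX.
have pW : poly_growth (fun z => cwW n z ^+ (2 * k)) by apply: pgX; exact: pg_cwW.
have H1 : `|c * E n (fun z => V n z ^+ (2 * k)) - 1| <= K * M * rate n.
  have := HK n _ _ _ ler01 smooth_growth_id.
  have -> : E n (fun z => c * V n z ^+ (2 * k).-1 * V n z - 1) =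
      c * E n (fun z => V n z ^+ (2 * k)) - 1.
    rewrite -cwEZ// -(cwE_cst rho beta n 1) -cwEB//; [|exact: pgZ|exact: pg_cst].
    rewrite cwE_cst; congr (cwE _ _ _ _); apply/funext => z.
    by rewrite -mulrA -exprSr k2.
  move=> /le_trans; apply; rewrite mul1r -/(rate n) mulrAC ler_wpM2r//.
  by rewrite ler_wpM2l//; exact: HM.
(* The first spin, absent from V, changes W by [a n * z.1] only. *)
have H2 : `|cwv n - E n (fun z => V n z ^+ (2 * k))| <= (2 * k)%:R * L * a n.
  rewrite /cwv -cwEB//; apply: le_trans (le_normr_cwE rhoB beta_gt0 n (pgB pW pV)) _.
  apply: (@le_trans _ _ (E n (fun z => ((2 * k)%:R * a n) * (1 + `|V n z| + `|z.1 : R|) ^+ (2 * k)))).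
    apply: le_cwE => //; [by apply: pg_norm; exact: pgB|by apply: pgZ; exact: pgm|].
    move=> z; rewrite cwWE -k2; apply: le_trans (power_increment _ _ _) _.
    rewrite normrM gtr0_norm// k2.
    set w := 1 + `|V n z| + `|z.1 : R|.
    have w1 : `|z.1 : R| <= w by rewrite /w lerDr addr_ge0.
    have w2 : `|V n z| + a n * `|z.1 : R| <= w.
      rewrite /w -addrA (le_trans _ (_ : `|V n z| + `|z.1 : R| <= _))// ?lerDr//.
      by rewrite lerD2l -[leRHS]mul1r ler_wpM2r.
    have -> : w ^+ (2 * k) = w * w ^+ (2 * k).-1 by rewrite -exprS k2.
    rewrite !mulrA; apply: ler_pM.
    - by rewrite !mulr_ge0// ltW.
    - by rewrite exprn_ge0// addr_ge0// mulr_ge0// ltW.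
    - by rewrite ler_wpM2l// mulr_ge0// ltW.
    - by apply: lerXn2r; rewrite ?nnegrE// addr_ge0// mulr_ge0// ltW.
  rewrite cwEZ; [|done|done|exact: pgm].
  by rewrite mulrAC ler_wpM2r ?(ltW (a0 n))// ler_wpM2l//; exact: HL.
have -> : c * cwv n - 1 = (c * E n (fun z => V n z ^+ (2 * k)) - 1) +
   c * (cwv n - E n (fun z => V n z ^+ (2 * k))) by ring.
apply: le_trans (ler_normD _ _) _; rewrite normrM (ger0_norm c0) mulrDl; apply: lerD => //.
rewrite -[leRHS]mulrA ler_wpM2l//; apply: le_trans H2 _.
by rewrite ler_wpM2l// mulr_ge0.
Qed.

(* For large [n] this is [cwv_near]; the remaining [n] only need [cwv] to be positive. *)
Lemma cwv_bounds : exists v0 v1 : R, 0 < v0 /\ forall n, v0 <= cwv n <= v1.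
Proof.
have [C C0 HC] := cwv_near.
have c0 : 0 < c by exact: drift_coef_gt0 type0.
have e0 n : 0 < eps n by exact: cw_eps_gt0.
have ae n : a n <= eps n.
  rewrite /cw_scale -[leRHS]expr1; apply: ler_wiXn2l => //; first exact: ltW.
  by rewrite -ltnS k2 mulnC leq_pmull.
have rate2 n : rate n <= 2 * eps n.
  have : eps n ^+ 2 <= eps n by rewrite expr2 -[leRHS]mul1r ler_wpM2r// ltW.
  by have := ae n; rewrite /rate; lra.
(* When [eps n <= d], the error [C * rate n <= 2 * C * eps n] is at most 1/2, so that
   [c * cwv n >= 1/2]. *)
pose d : R := (4 * (C + 1))^-1.
have C4 : 0 < 4 * (C + 1) by rewrite mulr_gt0// ltr_wpDl.
have d0 : 0 < d by rewrite invr_gt0.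
(* When [eps n > d], the scale is at least [d ^+ (2 * k).-1], and [even_moment_ge] supplies the
   other factor. *)
pose v2 := (d ^+ (2 * k).-1) ^+ (2 * k) * 2^-1 ^+ k.
have v20 : 0 < v2 by rewrite mulr_gt0 ?exprn_gt0.
exists (Num.min (2 * c)^-1 v2), ((1 + 2 * C) / c).
split; first by rewrite lt_min v20 invr_gt0 mulr_gt0.
move=> n; apply/andP; split; last first.
  rewrite ler_pdivlMr// mulrC.
  have := HC n; rewrite ler_norml => /andP[_]; have := ler_wpM2l C0 (rate2 n).
  have := ler_wpM2l C0 (e1 n); lra.
have [ed|ed] := leP (eps n) d.
  rewrite ge_min; apply/orP; left.
  rewrite -(ler_pM2l c0) invfM mulrCA mulfV ?gt_eqF// mulr1.
  have h1 : C * rate n <= 2^-1.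
    have h2 := ler_wpM2l C0 (rate2 n).
    have h3 := ler_wpM2l C0 ed.
    have : d * (4 * (C + 1)) = 1 by rewrite /d mulVf// gt_eqF.
    have := ltW d0; lra.
  have := HC n; rewrite ler_norml => /andP[+ _]; lra.
rewrite ge_min; apply/orP; right.
have -> : cwv n = a n ^+ (2 * k) * E n (fun z => ((z.1 : R) + z.2) ^+ (2 * k)).
  rewrite -cwEZ//; last by apply: pgX; apply: pgD; [exact: pg_fst|exact: pg_snd].
  by congr (cwE _ _ _ _); apply/funext => z; rewrite /cwW exprMn.
have d1 := ltW d0.
apply: ler_pM; [by do 2 apply: exprn_ge0|by apply: exprn_ge0|  |exact: even_moment_ge].
apply: lerXn2r; rewrite ?nnegrE ?exprn_ge0 ?(ltW d0) ?(ltW (e0 n))//.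
by apply: lerXn2r; rewrite ?nnegrE ?(ltW d0) ?(ltW (e0 n))// ltW.
Qed.

End distance_to_limit.

(** * Distance to the limit law *)

Section main_bound.
Context {R : realType}.
Local Notation TR := (measurableTypeR R).
Variables (rho : probability TR R) (beta : R) (k : nat) (mu : R).
Hypothesis rhoGHS : GHS rho.
Hypothesis var1 : emom rho 2 0 = 1.
Hypothesis beta_gt0 : 0 < beta.
Hypothesis type0 : has_type_strength (G rho beta) 0 k mu.

Let rhoB : classB rho := rhoGHS.1.
Let k_gt0 : (0 < k)%N. Proof. by case: type0. Qed.
Local Notation E := (cwE rho beta).
Local Notation eps := (cw_eps (R := R) k).
Local Notation a := (cw_scale (R := R) k).
Local Notation c := (drift_coef beta k mu).
Local Notation V n := (fun z : TR * TR => a n * (z.2 : R)).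
Local Notation W := (cwW (R := R) k).
Local Notation v := (cwv rho beta k).

(** The Stein equation is solved with the coefficient 1 / v, whereas the approximate identity has
    the coefficient c; by [cwv_near] the discrepancy has the same order as the other errors. *)
Lemma distance_to_limit : exists2 C, 0 <= C & forall n (h : R -> R) D,
  (forall x y, `|h x - h y| <= D * `|x - y|) ->
  `|E n (fun z => h (W n z)) - \int[Fhat k (v n)]_t h t| <= D * C * (eps n ^+ 2 + a n).
Proof.
have [v0 [v1 [v0_gt0 Hv]]] := cwv_bounds rhoGHS var1 beta_gt0 type0.
have [B HB] := uniform_stein_solution v1 k_gt0 v0_gt0.
have [K K0 HK] := stein_expectation rhoGHS var1 beta_gt0 type0 (4 * k).
set p := (4 * k + 2 * k + 3)%N in HK.
have [M M0 HM] := uniform_moments rhoGHS beta_gt0 type0 p.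
have [C1 C10 HC1] := cwv_near rhoGHS var1 beta_gt0 type0.
have [L L0 HL] := mixed_moments rhoGHS beta_gt0 type0 1.
(* [HB] gives no sign for its constant, while [HK] asks for a nonnegative one. *)
pose B' := `|B|; have B'0 : 0 <= B' by exact: normr_ge0.
have q0 : 0 <= C1 / v0 by rewrite divr_ge0// ltW.
exists (L + (B' * K * M + C1 / v0 * (B' * M))).
  by apply: addr_ge0 => //; apply: addr_ge0; apply: mulr_ge0 => //; exact: mulr_ge0.
move=> n h D hD; have D0 := lipschitz_const_ge0 hD.
have /andP[v0v vv1] := Hv n; have vn0 := lt_le_trans v0_gt0 v0v.
have [g sgB] := HB h D _ hD (Hv n).
pose Fh := \int[Fhat k (v n)]_t h t; rewrite -/Fh.
pose g1 x := x ^+ (2 * k).-1 / v n * g x + (h x - Fh).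
have [Hg Hg1 gB g1B gT] : smooth_growth (D * B) (4 * k) g g1 := sgB.
have sg : smooth_growth (D * B') (4 * k) g g1.
  have BB (y z : R) : 0 <= y -> 0 <= z -> D * B * y * z <= D * B' * y * z.
    by move=> y0 z0; rewrite !ler_wpM2r// ler_wpM2l// ler_norm.
  have BB1 (z : R) : 0 <= z -> D * B * z <= D * B' * z.
    by move=> z0; rewrite ler_wpM2r// ler_wpM2l// ler_norm.
  split => //.
  - by move=> x; apply: le_trans (gB x) _; apply: BB1; rewrite exprn_ge0// addr_ge0.
  - by move=> x; apply: le_trans (g1B x) _; apply: BB1; rewrite exprn_ge0// addr_ge0.
  move=> x u; have [t1 t2] := gT x u; split.
    by apply: le_trans t1 _; apply: BB => //; rewrite exprn_ge0// !addr_ge0.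
  by apply: le_trans t2 _; apply: BB; rewrite ?sqr_ge0// exprn_ge0// !addr_ge0.
have DB0 : 0 <= D * B' by rewrite mulr_ge0.
set rate := eps n ^+ 2 + a n.
have a0 : 0 < a n by exact: cw_scale_gt0.
have rate0 : 0 <= rate by rewrite addr_ge0 ?sqr_ge0// ltW.
have ph : poly_growth1 (h : TR -> R).
  split; first exact: measurable_lipschitz hD.
  by exists (`|h 0| + D), 1%N => x; rewrite expr1; exact: lipschitz_growth hD x.
have pV : poly_growth (V n) by exact: pg_V.
have phV := pg_comp ph pV.
have phW := pg_comp ph (pg_cwW k n).
have pVg : poly_growth (fun z => V n z ^+ (2 * k).-1 * g (V n z)).
  by apply: pgM; [exact: pgX|exact: (pg_comp Hg pV)].
have pw : poly_growth (fun z => (1 + `|V n z|) ^+ p).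
  by apply: pgX; apply: pgD; [exact: pg_cst|exact: pg_norm].
have pw1 : poly_growth (fun z : TR * TR => (1 + `|V n z| + `|z.1 : R|) ^+ 1).
  apply: pgX; apply: pgD; last by apply: pg_norm; exact: pg_fst.
  by apply: pgD; [exact: pg_cst|exact: pg_norm].
have s1 : `|E n (fun z => h (W n z)) - E n (fun z => h (V n z))| <= D * L * rate.
  rewrite -cwEB//; apply: le_trans (le_normr_cwE rhoB beta_gt0 n (pgB phW phV)) _.
  apply: (@le_trans _ _ (E n (fun z => (D * a n) * (1 + `|V n z| + `|z.1 : R|) ^+ 1))).
    apply: le_cwE => //; [by apply: pg_norm; exact: pgB|exact: pgZ|].
    move=> z; apply: le_trans (hD _ _) _; rewrite -mulrA ler_wpM2l//.
    rewrite /cwW mulrDr addrK normrM (gtr0_norm a0) expr1 ler_wpM2l ?(ltW a0)//.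
    by rewrite lerDr addr_ge0.
  rewrite cwEZ// -!mulrA ler_wpM2l// mulrC; apply: ler_pM => //.
  - by apply: Rintegral_ge0 => t _; rewrite exprn_ge0// !addr_ge0.
  - exact: ltW.
  - by rewrite /rate lerDr sqr_ge0.
have s2 : `|E n (fun z => c * V n z ^+ (2 * k).-1 * g (V n z) - g1 (V n z))| <=
    D * (B' * K * M) * rate.
  apply: le_trans (HK n _ _ _ DB0 sg) _.
  rewrite -/rate -!mulrA !ler_wpM2l// mulrC ler_wpM2r//; exact: HM.
have s3 : `|c - (v n)^-1| <= C1 / v0 * rate.
  have -> : c - (v n)^-1 = (c * v n - 1) / v n by field; rewrite gt_eqF.
  rewrite normrM normfV (gtr0_norm vn0) [leRHS]mulrAC; apply: ler_pM => //.
  - by rewrite invr_ge0 ltW.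
  - by rewrite lef_pV2 ?posrE.
have s4 : `|E n (fun z => V n z ^+ (2 * k).-1 * g (V n z))| <= D * (B' * M).
  apply: le_trans (le_normr_cwE rhoB beta_gt0 n pVg) _.
  apply: (@le_trans _ _ (E n (fun z => (D * B') * (1 + `|V n z|) ^+ p))); last first.
    by rewrite cwEZ// -mulrA ler_wpM2l// ler_wpM2l//; exact: HM.
  apply: le_cwE => //; [exact: pg_norm|exact: pgZ|] => z; set x := a n * _.
  have x1 : 1 <= 1 + `|x| by rewrite lerDl.
  have [_ _ gB' _ _] := sg.
  rewrite normrM normrX.
  apply: (@le_trans _ _ ((1 + `|x|) ^+ (2 * k).-1 * (D * B' * (1 + `|x|) ^+ (4 * k)))).
    apply: ler_pM => //.
    by apply: lerXn2r; rewrite ?nnegrE// lerDr.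
  rewrite mulrCA ler_wpM2l// -exprD; apply: ler_weXn2l => //.
  by rewrite /p addnC -addnA leq_add2l (leq_trans (leq_pred _))// leq_addr.
have e1 : E n (fun z => c * V n z ^+ (2 * k).-1 * g (V n z) - g1 (V n z)) =
    (c - (v n)^-1) * E n (fun z => V n z ^+ (2 * k).-1 * g (V n z)) -
    (E n (fun z => h (V n z)) - Fh).
  have pc : poly_growth (fun=> Fh) by exact: pg_cst.
  rewrite -(cwE_cst rho beta n Fh) -cwEB// -cwEZ// -cwEB//; [|exact: pgZ|exact: pgB].
  by congr (cwE _ _ _ _); apply/funext => z; rewrite /g1; ring.
(* Three errors: passing from W to V, replacing 1 / v by c, and the Stein error proper. *)
have e2 : E n (fun z => h (W n z)) - Fh = (E n (fun z => h (W n z)) - E n (fun z => h (V n z))) +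
   ((c - (v n)^-1) * E n (fun z => V n z ^+ (2 * k).-1 * g (V n z)) -
    E n (fun z => c * V n z ^+ (2 * k).-1 * g (V n z) - g1 (V n z))).
  by rewrite e1; ring.
rewrite e2; apply: le_trans (ler_normD _ _) _.
have -> : D * (L + (B' * K * M + C1 / v0 * (B' * M))) * rate =
    D * L * rate + ((C1 / v0 * rate) * (D * (B' * M)) + D * (B' * K * M) * rate) by ring.
apply: lerD => //; apply: le_trans (ler_normB _ _) _; apply: lerD => //.
by rewrite normrM; exact: ler_pM.
Qed.

End main_bound.

(** * Location of the minimum and the normal law as a special case *)

Section limit_law_facts.
Context {R : realType}.
Local Notation TR := (measurableTypeR R).

(** [G] is even, so [- alpha] would be a second minimum. In particular the centering of the spin sum
    vanishes. *)
Lemma minimum_at_origin (rho : probability TR R) (beta alpha : R) : classB rho ->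
  unique_global_min (G rho beta) alpha -> alpha = 0.
Proof.
move=> rhoB min; have phiN s : phi rho (- s) = phi rho s.
  have phiE h : phi rho h = ln (emom rho 0 h).
    by rewrite /phi /emom; congr ln; apply: eq_Rintegral => x _; rewrite expr0 mul1r.
  by rewrite !phiE (emomN rhoB) expr0 mul1r.
have [//|/eqP a0] := eqVneq alpha 0; have na : - alpha != alpha by apply/eqP => e; apply: a0; lra.
by have := min _ na; rewrite /G mulrN phiN sqrrN ltxx.
Qed.

(** The densities are proportional, and the total mass one of the normal law then identifies its
    peak with the inverse of [gmass 1 v]. *)
Lemma normal_prob_Fhat (v : R) (f : R -> R) : 0 < v ->
  \int[normal_prob 0 (Num.sqrt v)]_t f t = \int[Fhat 1 v]_t f t.
Proof.
move=> v0; have s0 : Num.sqrt v != 0 by rewrite gt_eqF// sqrtr_gt0.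
have pdfE x : normal_pdf 0 (Num.sqrt v) x = normal_peak (Num.sqrt v) * gdens 1 v x.
  rewrite /normal_pdf (negbTE s0) /normal_fun /gdens /exponent_Fhat; congr (_ * expR _).
  by rewrite subr0 sqr_sqrtr ?(ltW v0)// muln1 mulr_natl mulNr.
have mg : measurable_fun setT (gdens 1 v : TR -> R).
  by apply: measurable_gdens => //; rewrite gt_eqF.
have setE A : measurable A -> normal_prob 0 (Num.sqrt v) A =
    ((normal_peak (Num.sqrt v))%:E * \int[lebesgue_measure]_(x in A) (gdens 1 v x)%:E)%E.
  move=> mA; rewrite /normal_prob -ge0_integralZl//.
  - by apply: eq_integral => x _; rewrite pdfE EFinM.
  - by apply/measurable_EFinP; exact: measurable_funTS.
  - by move=> x _; rewrite lee_fin ltW// gdens_gt0.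
  - by rewrite lee_fin normal_peak_ge0.
have peakE : normal_peak (Num.sqrt v) = (gmass 1 v)^-1.
  have := @integral_normal_pdf R 0 (Num.sqrt v); under eq_integral do rewrite pdfE EFinM.
  rewrite ge0_integralZl//; last first.
  - by rewrite lee_fin normal_peak_ge0.
  - by move=> x _; rewrite lee_fin ltW// gdens_gt0.
  - exact/measurable_EFinP.
  have gf : (\int[lebesgue_measure]_x (gdens 1 v x)%:E)%E \is a fin_num.
    rewrite ge0_fin_numE; first exact: gdens_integral_fin.
    by apply: integral_ge0 => x _; rewrite lee_fin ltW// gdens_gt0.
  rewrite -(fineK gf) -EFinM => -[e1].
  by apply: (mulIf (lt0r_neq0 (gmass_gt0 (ltnSn 0) v0))); rewrite mulVf ?e1// gt_eqF ?gmass_gt0.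
rewrite /Rintegral; congr fine; apply: eq_measure_integral => A mA _.
apply: etrans (setE A mA) _; rewrite peakE /= /mnormalize.
have m0 := gdens_integral_pos (ltnSn 0) v0; have mf := gdens_integral_fin (ltnSn 0) v0.
by rewrite gt_eqF// lt_eqF//= muleC.
Qed.
End limit_law_facts.

Section spin_sum_expectation.
Context {R : realType}.
Local Notation TR := (measurableTypeR R).
Variables (rho : probability TR R) (beta : R) (n : nat).
Local Notation P := (curie_weiss rho n.+1 beta).

Lemma cwE_spin_sum k (f : R -> R) :
  cwE rho beta n (fun z => f (cwW k n z)) = \int[P]_x f (cw_scale k n * spin_sum x).
Proof.
by apply: eq_Rintegral => t _; rewrite /cwW /= /cw_tail addrCA subrr addr0.
Qed.

Lemma third_momentE (i : 'I_n.+1) : i = ord0 ->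
  third_moment P i = cwE rho beta n (fun z => `|z.1 : R| ^+ 3).
Proof. by move=> ->. Qed.

Lemma cw_scaleE k : (0 < k)%N -> (n.+1%:R `^ (1 - (2 * k)%:R^-1))^-1 = cw_scale k n :> R.
Proof.
move=> k0; have N0 : n.+1%:R != 0 :> R by rewrite pnatr_eq0.
rewrite powRD; last by rewrite N0 implybT.
rewrite powRr1// -/(cw_eps k n); apply: (mulIf (lt0r_neq0 (cw_eps_gt0 k n))).
apply: (mulIf N0); rewrite [X in _ = X * _]mulrC cw_eps_scale//.
by rewrite invfM divfK ?mulVf// gt_eqF// cw_eps_gt0.
Qed.

Lemma cw_eps_sqr k : (0 < k)%N -> (n.+1%:R `^ k%:R^-1)^-1 = cw_eps k n ^+ 2 :> R.
Proof.
move=> k0; have k1 : k%:R != 0 :> R by rewrite pnatr_eq0 -lt0n.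
rewrite -powRN /cw_eps -powR_mulrn ?powR_ge0// -powRrM; congr (_ `^ _).
by rewrite natrM; field.
Qed.

End spin_sum_expectation.

Theorem theorem1p10 (R : realType) (rho : probability (measurableTypeR R) R)
    (rhoGHS : GHS rho) (rho_var1 : (\int[rho]_x ((x : R) ^+ 2)%:E = 1)%E)
    (beta : R) (beta_gt0 : 0 < beta)
    (alpha : R) (alpha_min : unique_global_min (G rho beta) alpha)
    (k : nat) (mu : R) (alpha_type : has_type_strength (G rho beta) alpha k mu) :
  (k = 1%N ->
    exists C : R,
    forall (n : nat) (n_gt0 : (0 < n)%N),
    let i1 := Ordinal n_gt0 in
    let P := curie_weiss rho n beta in
    let W := fun x : n.-tuple (measurableTypeR R) => spin_sum x / Num.sqrt n%:R in
    let Phi_W := normal_prob 0 (Num.sqrt (\int[P]_x (W x ^+ 2))) in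
    forall kappa : R.-pker (n.-1.-tuple (measurableTypeR R)) ~> (measurableTypeR R),
    conditional_distribution P i1 kappa ->
    forall h : R -> R, lipschitz h ->
      `| \int[P]_x h (W x) - \int[Phi_W]_z h z | <=
      derivative_norm h *
        (C * Num.max (third_moment P i1) (resampled_third_moment P i1 kappa)
           / Num.sqrt n%:R))
  /\
  ((2 <= k)%N ->
    exists C1 C2 : R,
    forall (n : nat) (n_gt0 : (0 < n)%N),
    let i1 := Ordinal n_gt0 in
    let P := curie_weiss rho n beta in
    let W := fun x : n.-tuple (measurableTypeR R) =>
      (spin_sum x - n%:R * alpha) / n%:R `^ (1 - (2 * k)%:R^-1) in
    let F_W := Fhat k (\int[P]_x (W x ^+ (2 * k))) in
    forall kappa : R.-pker (n.-1.-tuple (measurableTypeR R)) ~> (measurableTypeR R),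
    conditional_distribution P i1 kappa ->
    forall h : R -> R, lipschitz h ->
      `| \int[P]_x h (W x) - \int[F_W]_z h z | <=
      derivative_norm h *
        (C1 * (n%:R `^ k%:R^-1)^-1 +
         C2 * Num.max (third_moment P i1) (resampled_third_moment P i1 kappa)
           / n%:R `^ (1 - (2 * k)%:R^-1))).
Proof.
have rhoB := rhoGHS.1.
have a0 := minimum_at_origin rhoB alpha_min; rewrite a0 {alpha alpha_min a0} in alpha_type *.
have var1 : emom rho 2 0 = 1.
  rewrite /emom /Rintegral; under eq_integral do rewrite mul0r expR0 mulr1.
  by rewrite rho_var1.
have k_gt0 : (0 < k)%N by case: alpha_type.
have [C0 C00 main] := distance_to_limit rhoGHS var1 beta_gt0 alpha_type.
have [v0 [v1 [v0_gt0 Hv]]] := cwv_bounds rhoGHS var1 beta_gt0 alpha_type.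
split=> hk.
  (* The 2 counts [eps^2] and the scale, both at most n^(-1/2), and 8/3 compensates for the lower
     bound 3/8 of the third moment. *)
  exists (2 * C0 * (8 / 3)) => -[//|n] n_gt0 i1 P W Phi kappa _ h lip.
  have hD := lipschitz_derivative_norm lip.
  have D0 := lipschitz_const_ge0 hD.
  have sE : (Num.sqrt n.+1%:R)^-1 = cw_scale k n :> R.
    rewrite -cw_scaleE// -powR12_sqrt//; congr (_ `^ _)^-1.
    by rewrite hk muln1; field.
  have WE x : W x = cw_scale k n * spin_sum x by rewrite /W sE mulrC.
  have varE : \int[P]_x (W x ^+ 2) = cwv rho beta k n.
    rewrite /cwv (cwE_spin_sum rho beta n k (fun t => t ^+ (2 * k))).
    by apply: eq_Rintegral => t _; rewrite WE hk muln1.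
  have {main} := main n h _ hD.
  rewrite cwE_spin_sum {2}hk -normal_prob_Fhat; last first.
    by have /andP[/(lt_le_trans v0_gt0)] := Hv n.
  rewrite -/P -varE -/Phi.
  have -> : \int[P]_x h (cw_scale k n * spin_sum x) = \int[P]_x h (W x).
    by apply: eq_Rintegral => x _; rewrite WE.
  move/le_trans; apply.
  rewrite -mulrA ler_wpM2l// sE.
  have third : 3 / 8 <= Num.max (third_moment P i1) (resampled_third_moment P i1 kappa).
    by rewrite le_max third_momentE ?third_moment_ge//; apply: val_inj.
  have a0 : 0 < cw_scale k n :> R := cw_scale_gt0 k n.
  have aE : cw_scale k n = cw_eps k n :> R by rewrite /cw_scale hk expr1.
  have e1 : cw_eps k n ^+ 2 <= cw_scale k n :> R.
    by rewrite aE expr2 -[leRHS]mul1r ler_wpM2r ?cw_eps_le1// ltW// cw_eps_gt0.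
  apply: (@le_trans _ _ (C0 * (2 * cw_scale k n))).
    by rewrite ler_wpM2l//; lra.
  rewrite mulrA ler_wpM2r ?(ltW a0)// [C0 * 2]mulrC -[leLHS]mulr1 -!mulrA !ler_wpM2l//.
  lra.
exists (2 * C0), 0 => -[//|n] n_gt0 i1 P W F_W kappa _ h lip.
have hD := lipschitz_derivative_norm lip.
have D0 := lipschitz_const_ge0 hD.
have WE x : W x = cw_scale k n * spin_sum x.
  by rewrite /W mulr0 subr0 cw_scaleE// mulrC.
have varE : \int[P]_x (W x ^+ (2 * k)) = cwv rho beta k n.
  rewrite /cwv (cwE_spin_sum rho beta n k (fun t => t ^+ (2 * k))).
  by apply: eq_Rintegral => t _; rewrite WE.
have {main} := main n h _ hD.
rewrite cwE_spin_sum -/P -varE -/F_W.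
have -> : \int[P]_x h (cw_scale k n * spin_sum x) = \int[P]_x h (W x).
  by apply: eq_Rintegral => x _; rewrite WE.
move/le_trans; apply.
rewrite mul0r mul0r addr0 cw_eps_sqr// -mulrA ler_wpM2l//.
(* The scale is the power [2 * k - 1 >= 2] of [cw_eps k n <= 1]. *)
have ae : cw_scale k n <= cw_eps k n ^+ 2 :> R.
  apply: ler_wiXn2l; [exact/ltW/cw_eps_gt0|exact: cw_eps_le1|].
  by rewrite -ltnS prednK ?muln_gt0// (leq_trans _ (leq_mul (leqnn 2) hk)).
by rewrite [2 * C0]mulrC -mulrA ler_wpM2l//; lra.
Qed.
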